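(* Let $M,N$ be positive integers with $N\ge M$, $\lambda_S,\lambda_R,\mu>0$, and $\rho$ a probability density on $[-\pi,\pi]$ with absolutely convergent Fourier series and $\int_{-\pi}^\pi\rho(\theta)\sin\theta\cos\theta\,\mathrm{d}\theta=0$. Let $h_0\ge0$ on $\mathbb{R}^M$ with $\int h_0(\mathbf v)e^{-\pi|\mathbf v|^2}\mathrm{d}\mathbf v=1$ and $\mathcal S(h_0)<\infty$, and let $h_k$ be as in the context. Then for every $k\ge0$, $$\mathcal S(h_k)\le\left[\frac{M}{N+M}+\frac{N}{N+M}\Big(1-\mu_\rho\frac{N+M}{N\Lambda}\Big)^k\right]\mathcal S(h_0),\qquad\mu_\rho=\mu\int_{-\pi}^\pi\rho(\theta)\sin^2\theta\,\mathrm{d}\theta.$$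
   Context: For a pair $\alpha=(i,j)$, $1\le i<j\le M+N$, $r_\alpha(\theta)$ is the rotation of $\mathbb{R}^{M+N}$ in the $(i,j)$ coordinate plane such that $r_\alpha(\theta)^{-1}\mathbf z$ has $i$-th coordinate $z_i\cos\theta-z_j\sin\theta$, $j$-th coordinate $z_i\sin\theta+z_j\cos\theta$, other coordinates unchanged. $\Lambda=\lambda_SM/2+\lambda_RN/2+\mu M$; $\lambda_{(i,j)}=\lambda_S/(\Lambda(M-1))$ if $j\le M$, $=\lambda_R/(\Lambda(N-1))$ if $i\ge M+1$, $=\mu/(\Lambda N)$ if $i\le M<j$. With $P(\mathbf v,\mathbf w)=\mathbf v$, $$h_k(\mathbf v)=\sum_{\alpha_1,\dots,\alpha_k}\lambda_{\alpha_1}\cdots\lambda_{\alpha_k}\int_{[-\pi,\pi]^k}\prod_{l=1}^k\rho(\theta_l)\,\mathrm{d}\underline\theta\int_{\mathbb{R}^N}(h_0\circ P)\Big(\big[\textstyle\prod_{l=1}^kr_{\alpha_l}(\theta_l)\big]^{-1}(\mathbf v,\mathbf w)\Big)e^{-\pi|\mathbf w|^2}\,\mathrm{d}\mathbf w.$$ $\mathcal S(h)=\int_{\mathbb{R}^M}h\log h\,e^{-\pi|\mathbf v|^2}\mathrm{d}\mathbf v$. *)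

(* Defs.v *)
From HB Require Import structures.
From mathcomp Require Import all_boot all_order all_algebra.
From mathcomp Require Import all_classical all_reals all_analysis.
Set Implicit Arguments. Unset Strict Implicit. Unset Printing Implicit Defensive.
Import Order.TTheory GRing.Theory Num.Theory.
Local Open Scope classical_set_scope.
Local Open Scope ring_scope.

Section Defs.
Variable R : realType.

(* Iterated Lebesgue integral over D^n of f : R^n -> \bar R
   (R^n represented by n.-tuple R, which carries the product sigma-algebra).
   iint D f = \int_{x_1 in D} ... \int_{x_n in D} f(x_1,...,x_n). *)
Fixpoint iint (D : set R) (n : nat) : (n.-tuple R -> \bar R) -> \bar R :=
  match n return (n.-tuple R -> \bar R) -> \bar R with
  | 0 => fun f => f [tuple]
  | n'.+1 => fun f =>
      (\int[@lebesgue_measure R]_(x in D)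
          iint D (fun t : n'.-tuple R => f (cons_tuple x t)))%E
  end.

Definition sqnorm n (v : n.-tuple R) : R := \sum_(i < n) tnth v i ^+ 2.

Definition gint n (f : n.-tuple R -> \bar R) : \bar R :=
  iint setT (fun v => (f v * (expR (- pi * sqnorm v))%:E)%E).

Definition entropyS M (h : M.-tuple R -> R) : \bar R :=
  gint (fun v => (h v * ln (h v))%:E).

Definition rot_inv n (a : 'I_n * 'I_n) (th : R) (z : n.-tuple R) : n.-tuple R :=
  [tuple (if k == a.1 then tnth z a.1 * cos th - tnth z a.2 * sin th
          else if k == a.2 then tnth z a.1 * sin th + tnth z a.2 * cos th
          else tnth z k) | k < n].

(* [prod_{l=1}^k r_{alpha_l}(theta_l)]^{-1} z
   = r_{alpha_k}^{-1} ( ... r_{alpha_1}^{-1} z ...) *)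
Fixpoint rots_inv n (al : seq ('I_n * 'I_n)) (th : seq R) (z : n.-tuple R)
  : n.-tuple R :=
  match al, th with
  | a :: al', t :: th' => rots_inv al' th' (rot_inv a t z)
  | _, _ => z
  end.

Definition Lam (M N : nat) (lS lR mu : R) : R :=
  lS * M%:R / 2 + lR * N%:R / 2 + mu * M%:R.

(* lambda_(i,j) for 0-based i < j < M+N; coordinates 0..M-1 are v,
   M..M+N-1 are w. *)
Definition lam (M N : nat) (lS lR mu : R) (a : 'I_(M + N) * 'I_(M + N)) : R :=
  if (a.2 < M)%N then lS / (Lam M N lS lR mu * (M - 1)%:R)
  else if (M <= a.1)%N then lR / (Lam M N lS lR mu * (N - 1)%:R)
  else mu / (Lam M N lS lR mu * N%:R).

Definition vw M N (v : M.-tuple R) (w : N.-tuple R) : (M + N).-tuple R :=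
  cat_tuple v w.
Definition projP M N (z : (M + N).-tuple R) : M.-tuple R :=
  [tuple tnth z (lshift N i) | i < M].

Definition hk (M N : nat) (lS lR mu : R) (rho : R -> R)
  (h0 : M.-tuple R -> R) (k : nat) (v : M.-tuple R) : R :=
  fine (\sum_(al : k.-tuple ('I_(M + N) * 'I_(M + N))
             | all (fun a : 'I_(M + N) * 'I_(M + N) => (a.1 < a.2)%N) al)
        ((\prod_(a <- al) lam lS lR mu a)%:E *
         iint `[(- pi)%R, pi%R] (fun th : k.-tuple R =>
           ((\prod_(t <- th) rho t)%:E *
            gint (fun w : N.-tuple R =>
               (h0 (projP (rots_inv al th (vw v w))))%:E))%E))%E).

Definition fcos (rho : R -> R) (n : nat) : R :=
  Rintegral (@lebesgue_measure R) `[- pi, pi] (fun x => rho x * cos (n%:R * x)).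
Definition fsin (rho : R -> R) (n : nat) : R :=
  Rintegral (@lebesgue_measure R) `[- pi, pi] (fun x => rho x * sin (n%:R * x)).

End Defs.

(* Main.v *)
Require Import Defs.
From HB Require Import structures.
From mathcomp Require Import all_boot all_order all_algebra.
From mathcomp Require Import all_classical all_reals all_analysis.
From mathcomp Require Import measurable_realfun ring lra.
Set Implicit Arguments. Unset Strict Implicit. Unset Printing Implicit Defensive.
Import Order.TTheory GRing.Theory Num.Theory.
Import numFieldNormedType.Exports.
Local Open Scope classical_set_scope.
Local Open Scope ring_scope.


(** Write z = (v, w), let O be a random word of plane rotations, and lift the
    initial density to H(z) = h_0(v); then h_k(v) is the average over O of the
    w-marginal of H o O.  Give H a Gaussian noise of size c and evaluate it at
    t z, with c^2 + t^2 = 1: this interpolates between the constant mean of H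
    (c = 1, t = 0) and H itself (c = 0, t = 1).  If t^2 grows and c^2 decreases
    by s^2 then, up to O(s^3), the entropy of the noisy function b grows by
    (s^2/2) E |grad b|^2 / b, and by the Cauchy-Schwarz inequality
    (E e)^2 / E b <= E (e^2 / b) the entropy of the w-marginal of b o O grows by
    at most the same expression with grad b replaced by the v-part of O^T grad b.
    Since H does not depend on w, grad b has no w-part, and the average over O
    of the squared norm of the v-part of O^T d is then a multiple c_k |d|^2.
    Summing over m steps, the errors m O(m^(-3/2)) vanish in the limit, and so
    the averaged entropy of the marginals is at most c_k times the entropy of H.
    Jensen's inequality for x ln x and a truncation of h_0 conclude.  The number
    c_k comes from the linear action of one random rotation on the quadratic
    forms a |v|^2 + b |w|^2. *)

(** * Integrals of real functions *)

(** A single rotation can leave the whole of [d] in the first block, so the contraction is visible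
    only on average; the increment bound is therefore proved for each rotation separately and
    averaged before the steps are summed. The lifted function [H] is merely measurable, so every
    derivative is that of a Gaussian density: a displacement of the argument is transferred to the
    noise by the Cameron-Martin formula, and the bounds [eps <= H <= K] together with c^2 >= delta
    make all constants uniform. Time is discrete, which avoids differentiating an entropy under the
    integral sign. The interpolation has to stop at c^2 = delta; the remaining noise is removed by
    an L1 convergence that must hold without continuity of [H]. The bounds on [H] come from
    truncating h_0, and a truncation does not have mass 1: this is why the inequality for bounded
    [H] carries a second term, a multiple of [xlnx] of the mean, which disappears in the limit. *)

Section RealIntegrals.
Context {R : realType}.

Lemma integrable_bounded d (T : measurableType d)
    (P : {finite_measure set T -> \bar R}) (f : T -> R) (C : R) :
  measurable_fun setT f -> (forall x, `|f x| <= C) ->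
  P.-integrable setT (EFin \o f).
Proof.
move=> mf fC; apply: measurable_bounded_integrable => //.
- by rewrite -ge0_fin_numE// fin_num_measure.
- by exists C; split; [exact: num_real|move=> y Cy x _; exact: le_trans (fC x) (ltW Cy)].
Qed.

Lemma integrable_dominated d (T : measurableType d)
    (P : {measure set T -> \bar R}) (f g : T -> R) :
  measurable_fun setT f -> P.-integrable setT (EFin \o g) ->
  (forall x, `|f x| <= g x) -> P.-integrable setT (EFin \o f).
Proof.
move=> mf ig fg; apply: le_integrable ig => //; first exact/measurable_EFinP.
by move=> x _ /=; rewrite lee_fin (le_trans (fg x))// ler_norm.
Qed.

(** Tonelli is applied to the positive and the negative part separately and [fine] is measurable, so
    the conclusion holds even if the integral is infinite or undefined for some x. Measurability of
    parameter integrals thus never waits for an integrability proof. *)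
Lemma measurable_partial_Rintegral d1 d2 (T1 : measurableType d1)
    (T2 : measurableType d2) (P2 : {sigma_finite_measure set T2 -> \bar R})
    (f : T1 * T2 -> R) :
  measurable_fun setT f ->
  measurable_fun setT (fun x => \int[P2]_y f (x, y)).
Proof.
move=> mf; apply: (measurableT_comp (fine_measurable measurableT)) => //.
have -> : (fun x => \int[P2]_y (f (x, y))%:E)%E =
    (fun x => \int[P2]_y ((EFin \o f)^\+ (x, y)) -
              \int[P2]_y ((EFin \o f)^\- (x, y)))%E.
  apply/funext => x; rewrite integralE.
  by congr (_ - _)%E; apply: eq_integral => y _; rewrite ?funeposE ?funenegE.
have mF : measurable_fun setT (EFin \o f) by exact/measurable_EFinP.
apply: emeasurable_funB.
- exact: measurable_fun_fubini_tonelli_F (measurable_funepos mF) _.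
- exact: measurable_fun_fubini_tonelli_F (measurable_funeneg mF) _.
Qed.

Section MeasurableReal.
Context d (T : measurableType d) (f : T -> R).
Hypothesis mf : measurable_fun setT f.

Lemma measurable_fun_normr : measurable_fun setT (fun x => `|f x|).
Proof. exact: (measurableT_comp (@normr_measurable R setT) mf). Qed.

Lemma measurable_fun_opp : measurable_fun setT (fun x => - f x).
Proof. exact: (measurableT_comp (@oppr_measurable R setT) mf). Qed.

Lemma measurable_fun_expR : measurable_fun setT (fun x => expR (f x)).
Proof. exact: (measurableT_comp (@measurable_expR R) mf). Qed.

Lemma measurable_fun_ln : measurable_fun setT (fun x => ln (f x)).
Proof. exact: (measurableT_comp (@measurable_ln R) mf). Qed.

Lemma measurable_fun_cos : measurable_fun setT (fun x => cos (f x)).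
Proof.
apply: (measurableT_comp _ mf).
by apply: continuous_measurable_fun; exact: continuous_cos.
Qed.

Lemma measurable_fun_sin : measurable_fun setT (fun x => sin (f x)).
Proof.
apply: (measurableT_comp _ mf).
by apply: continuous_measurable_fun; exact: continuous_sin.
Qed.

End MeasurableReal.

Section MeasurableInv.
Context d (T : measurableType d) (f : T -> R).
Hypotheses (mf : measurable_fun setT f) (f0 : forall x, 0 < f x).

Lemma measurable_fun_inv : measurable_fun setT (fun x => (f x)^-1).
Proof.
under eq_fun do rewrite -(lnK (f0 _)) -expRN.
exact/measurable_fun_expR/measurable_fun_opp/measurable_fun_ln.
Qed.

End MeasurableInv.

End RealIntegrals.

(** Measurability by recursion on the syntax of the function. Subtraction is matched before
    addition, and a partial integral is reduced to the joint measurability of its integrand. *)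
Ltac mstep :=
  cbv beta;
  lazymatch goal with
  | |- is_true _ => by []
  | |- measurable_fun _ (fun x => x) => exact: measurable_id
  | |- measurable_fun _ (fun _ => ?c) => exact: measurable_cst
  | |- measurable_fun _ (fun x => (@?f x).1) =>
      apply: (measurableT_comp (f := fst) (g := f)); [exact: measurable_fst|]
  | |- measurable_fun _ (fun x => (@?f x).2) =>
      apply: (measurableT_comp (f := snd) (g := f)); [exact: measurable_snd|]
  | |- measurable_fun _ (fun x => (@?f x, @?g x)) =>
      apply: (measurable_fun_pair (f := f) (g := g))
  | |- measurable_fun _ (fun x => @GRing.add _ (@?f x) (@GRing.opp _ (@?g x))) =>
      apply: (measurable_funB (f := f) (g := g))
  | |- measurable_fun _ (fun x => @GRing.add _ (@?f x) (@?g x)) =>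
      apply: (measurable_funD (f := f) (g := g))
  | |- measurable_fun _ (fun x => @GRing.mul _ (@?f x) (@?g x)) =>
      apply: (measurable_funM (f := f) (g := g))
  | |- measurable_fun _ (fun x => @GRing.opp _ (@?f x)) =>
      apply: (measurable_fun_opp (f := f))
  | |- measurable_fun _ (fun x => @GRing.exp _ (@?f x) ?n) =>
      apply: (measurable_funX (f := f) n)
  | |- measurable_fun _ (fun x => @Num.norm _ _ (@?f x)) =>
      apply: (measurable_fun_normr (f := f))
  | |- measurable_fun _ (fun x => expR (@?f x)) =>
      apply: (measurable_fun_expR (f := f))
  | |- measurable_fun _ (fun x => ln (@?f x)) =>
      apply: (measurable_fun_ln (f := f))
  | |- measurable_fun _ (fun x => cos (@?f x)) =>
      apply: (measurable_fun_cos (f := f))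
  | |- measurable_fun _ (fun x => sin (@?f x)) =>
      apply: (measurable_fun_sin (f := f))
  | |- measurable_fun _ (fun x => EFin (@?f x)) =>
      apply/measurable_EFinP; change (measurable_fun setT f)
  | |- measurable_fun _ (fun x => @tnth _ _ (@?t x) ?i) =>
      apply: (measurableT_comp (f := fun y => tnth y i) (g := t));
        [exact: measurable_tnth|]
  | |- measurable_fun _ (fun x => @bigop.body _ _ _ _ _) =>
      apply: measurable_sum => ?
  | |- measurable_fun _ (fun x => Rintegral ?P setT (@?f x)) =>
      apply: (@measurable_partial_Rintegral _ _ _ _ _ _ (fun z => f z.1 z.2))
  | H : measurable_fun _ ?f |- measurable_fun _ ?f => exact: H
  | H : measurable_fun _ ?f |- measurable_fun _ (fun x => ?f (@?g x)) =>
      apply: (measurableT_comp (f := f) (g := g)); [exact: H|]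
  end.
Ltac msolve := repeat mstep.

Section Fubini.
Context {R : realType}.
Context d1 d2 (T1 : measurableType d1) (T2 : measurableType d2)
  (P1 : {sigma_finite_measure set T1 -> \bar R})
  (P2 : {sigma_finite_measure set T2 -> \bar R}).

Lemma Rfubini1 (f : T1 * T2 -> R) :
  (P1 \x P2)%E.-integrable setT (EFin \o f) ->
  \int[(P1 \x P2)%E]_z f z = \int[P1]_x \int[P2]_y f (x, y).
Proof.
move=> fi; rewrite /Rintegral -(integral12_prod_meas1 fi); congr fine.
apply: ae_eq_integral => //.
- exact: (measurable_fubini_F fi).
- apply/measurable_EFinP; apply: measurable_partial_Rintegral.
  by apply/measurable_EFinP; exact: measurable_int fi.
- apply: filterS (ae_integrable1 fi) => x /= xi _.
  rewrite /fubini_F /fubini_G /Rintegral fineK//; exact: integrable_fin_num.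
Qed.

Lemma Rfubini2 (f : T1 * T2 -> R) :
  (P1 \x P2)%E.-integrable setT (EFin \o f) ->
  \int[(P1 \x P2)%E]_z f z = \int[P2]_y \int[P1]_x f (x, y).
Proof.
move=> fi; rewrite /Rintegral -(integral21_prod_meas1 fi); congr fine.
apply: ae_eq_integral => //.
- exact: (measurable_fubini_G fi).
- apply/measurable_EFinP.
  apply: (@measurable_partial_Rintegral _ _ _ _ _ P1 (fun z => f (z.2, z.1))).
  apply: (measurableT_comp (f := f)); last exact: measurable_fun_pair.
  by apply/measurable_EFinP; exact: measurable_int fi.
- apply: filterS (ae_integrable2 fi) => x /= xi _.
  rewrite /fubini_F /fubini_G /Rintegral fineK//; exact: integrable_fin_num.
Qed.

Lemma Rfubini (f : T1 -> T2 -> R) :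
  (P1 \x P2)%E.-integrable setT (fun z => (f z.1 z.2)%:E) ->
  \int[P1]_x \int[P2]_y f x y = \int[P2]_y \int[P1]_x f x y.
Proof. by move=> fi; rewrite -(Rfubini1 fi) (Rfubini2 fi). Qed.

Lemma integrable_prod (f : T1 * T2 -> R) (p : T1 -> R) (q : T2 -> R) :
  measurable_fun setT f ->
  P1.-integrable setT (EFin \o p) -> P2.-integrable setT (EFin \o q) ->
  (forall x, 0 <= p x) -> (forall y, 0 <= q y) ->
  (forall x y, `|f (x, y)| <= p x * q y) ->
  (P1 \x P2)%E.-integrable setT (EFin \o f).
Proof.
move=> mf ip iq p0 q0 fpq.
have mp : measurable_fun setT p by apply/measurable_EFinP; exact: measurable_int ip.
have mq : measurable_fun setT q by apply/measurable_EFinP; exact: measurable_int iq.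
apply/integrable12ltyP; first exact/measurable_EFinP.
apply: (@le_lt_trans _ _ (\int[P1]_x \int[P2]_y (p x * q y)%:E)%E).
  apply: ge0_le_integral => //=.
  - by move=> x _; exact: integral_ge0.
  - apply: (@measurable_fun_fubini_tonelli_F _ _ _ _ _ P2
      (fun z => `|(f z)%:E|%E)) => //.
    by apply: measurableT_comp => //; exact/measurable_EFinP.
  - apply: (@measurable_fun_fubini_tonelli_F _ _ _ _ _ P2
      (fun z => (p z.1 * q z.2)%:E)) => //=; last first.
      by move=> z; rewrite lee_fin mulr_ge0.
    by msolve.
  - move=> x _; apply: ge0_le_integral => //=.
    + by msolve.
    + by msolve.
    + by move=> y _; rewrite lee_fin.
under eq_integral => x _.
  under eq_integral => y _ do rewrite EFinM.
  rewrite integralZl//.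
  over.
have pfin := integrable_fin_num measurableT ip.
have qfin := integrable_fin_num measurableT iq.
by rewrite -(fineK qfin) integralZr// -(fineK pfin) -EFinM ltry.
Qed.

End Fubini.

Lemma Rintegral_prob_cst {R : realType} d (T : measurableType d)
  (P : probability T R) (r : R) : \int[P]_x r = r.
Proof.
rewrite Rintegral_cst// (_ : fine _ = 1) ?mulr1//.
by have /(congr1 fine) := @probability_setT _ _ _ P.
Qed.

Lemma integrable_bounded_prod {R : realType} d1 d2 (T1 : measurableType d1)
    (T2 : measurableType d2) (P1 : probability T1 R) (P2 : probability T2 R)
    (f : T1 * T2 -> R) (C : R) :
  measurable_fun setT f -> (forall x, `|f x| <= C) ->
  (P1 \x P2)%E.-integrable setT (EFin \o f).
Proof.
move=> mf fC.
apply: (@integrable_prod _ _ _ _ _ P1 P2 f (fun=> `|C|) (fun=> 1)) => //.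
- by apply: (@integrable_bounded _ _ _ P1 _ `|C|) => // x; rewrite normr_id.
- by apply: (@integrable_bounded _ _ _ P2 _ 1) => // x; rewrite normr1.
- by move=> x y; rewrite mulr1 (le_trans (fC _))// ler_norm.
Qed.

(** * Measures given by a density *)

Section Density.
Context {R : realType} d (T : measurableType d) (mu : {measure set T -> \bar R}).
Variable p : T -> R.
Hypotheses (mp : measurable_fun setT p) (p0 : forall x, 0 <= p x).

Import HBNNSimple.

(** Indicators first, then simple functions by linearity, then monotone convergence along
    [nnsfun_approx]. *)
Lemma ge0_integral_density (Q : {measure set T -> \bar R}) :
  (forall A, measurable A -> Q A = \int[mu]_(x in A) (p x)%:E)%E ->
  forall F : T -> \bar R, measurable_fun setT F -> (forall x, 0 <= F x)%E ->
  (\int[Q]_x F x = \int[mu]_x (F x * (p x)%:E))%E.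
Proof.
move=> QE F mF F0.
have mpE : measurable_fun setT (EFin \o p) by exact/measurable_EFinP.
have indE A : measurable A -> (\int[Q]_x (\1_A x)%:E = \int[mu]_x ((\1_A x)%:E * (p x)%:E))%E.
  move=> mA; rewrite integral_indic// setIT QE// integral_mkcond.
  apply: eq_integral => x _; rewrite patchE indicE.
  by case: ifPn => _; rewrite ?mul1e ?mul0e.
have simE (h : {nnsfun T >-> R}) :
    (\int[Q]_x (h x)%:E = \int[mu]_x ((h x)%:E * (p x)%:E))%E.
  under [LHS]eq_integral do rewrite fimfunE -fsumEFin//.
  rewrite [LHS]ge0_integral_fsum//; last 2 first.
    - by move=> r; exact/measurable_EFinP/measurableT_comp.
    - by move=> n x _; rewrite EFinM nnfun_muleindic_ge0.
  under [RHS]eq_integral.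
    move=> x _; rewrite fimfunE -fsumEFin// ge0_mule_fsuml; last first.
      by move=> r; rewrite EFinM nnfun_muleindic_ge0.
    over.
  rewrite [RHS]ge0_integral_fsum//; last 2 first.
    - move=> r; apply: emeasurable_funM => //.
      by apply/measurable_EFinP; apply/measurableT_comp.
    - by move=> n x _; apply: mule_ge0; [rewrite EFinM nnfun_muleindic_ge0|rewrite lee_fin].
  apply: eq_fsbigr => r; rewrite inE => -[t _ <-].
  under [LHS]eq_integral do rewrite EFinM.
  rewrite ge0_integralZl//; last 2 first.
    - by apply/measurable_EFinP; exact: measurable_indic.
    - by rewrite lee_fin.
  rewrite indE// -ge0_integralZl//; last 3 first.
    - apply: emeasurable_funM => //; apply/measurable_EFinP; exact: measurable_indic.
    - by move=> x _; rewrite mule_ge0// lee_fin.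
    - by rewrite lee_fin.
  by apply: eq_integral => x _; rewrite EFinM muleA.
pose f_ := nnsfun_approx measurableT mF.
transitivity (limn (fun n => \int[Q]_x (f_ n x)%:E)%E).
  rewrite -monotone_convergence//=.
  - by apply: eq_integral => x _; apply/esym/cvg_lim => //=; exact: cvg_nnsfun_approx.
  - by move=> n; exact/measurable_EFinP/measurable_funTS.
  - by move=> n x _; rewrite lee_fin.
  - by move=> x _ m n mn; rewrite lee_fin; exact/lefP/nd_nnsfun_approx.
transitivity (limn (fun n => \int[mu]_x ((f_ n x)%:E * (p x)%:E))%E).
  by apply: congr_lim; apply/funext => n /=; exact: simE.
rewrite -monotone_convergence//=.
- apply: eq_integral => x _; apply/cvg_lim => //=.
  by apply: cvgeZr => //; exact: cvg_nnsfun_approx.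
- move=> n; apply: emeasurable_funM => //.
  exact/measurable_EFinP/measurable_funTS.
- by move=> n x _; rewrite mule_ge0// lee_fin.
- move=> x _ m n mn; rewrite lee_wpmul2r ?lee_fin//.
  exact/lefP/nd_nnsfun_approx.
Qed.

Lemma density_probability :
  (\int[mu]_x (p x)%:E = 1)%E ->
  exists Q : probability T R,
    forall F : T -> \bar R, measurable_fun setT F -> (forall x, 0 <= F x)%E ->
    (\int[Q]_x F x = \int[mu]_x (F x * (p x)%:E))%E.
Proof.
move=> p1.
have mpE : measurable_fun setT (EFin \o p) by exact/measurable_EFinP.
pose m (A : set T) : \bar R := (\int[mu]_(x in A) (p x)%:E)%E.
have m0 : m set0 = 0%E by rewrite /m integral_set0.
have mge0 A : (0 <= m A)%E by apply: integral_ge0 => x _; rewrite lee_fin.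
have msa : semi_sigma_additive m.
  move=> A mA tA mUA; rewrite /m ge0_integral_bigcup//.
  - apply: is_cvg_ereal_nneg_natsum_cond => n _ _.
    by apply: integral_ge0 => x _; rewrite lee_fin.
  - exact: measurable_funTS.
  - by move=> x _; rewrite lee_fin.
pose mm : {measure set T -> \bar R} := HB.pack m (isMeasure.Build _ _ _ m m0 mge0 msa).
have mT : mm setT = 1%E by [].
pose Q : probability T R := HB.pack (mm : set T -> \bar R) (Measure.on mm)
  (Measure_isProbability.Build _ _ R mm mT).
by exists Q => F mF F0; exact: ge0_integral_density.
Qed.

End Density.

(** * Laws and product measures *)

Section Law.
Context {R : realType}.

(** Equality of laws is tested on nonnegative functions: the invariances below are obtained by
    transforming exactly such integrals, and Tonelli then asks for no integrability. *)
Definition has_law d d' (T : measurableType d) (T' : measurableType d')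
    (P : set T -> \bar R) (phi : T -> T') (P' : set T' -> \bar R) : Prop :=
  forall F : T' -> \bar R, measurable_fun setT F -> (forall y, 0 <= F y)%E ->
  (\int[P]_x F (phi x) = \int[P']_y F y)%E.

Section HasLaw.
Context d d' (T : measurableType d) (T' : measurableType d')
  (P : {measure set T -> \bar R}) (phi : T -> T') (P' : {measure set T' -> \bar R}).
Hypothesis lawP : has_law P phi P'.

Lemma has_law_integral (F : T' -> \bar R) : measurable_fun setT F ->
  (\int[P]_x F (phi x) = \int[P']_y F y)%E.
Proof.
move=> mF; rewrite integralE [RHS]integralE; congr (_ - _)%E.
- rewrite -(lawP (measurable_funepos mF))//.
  by apply: eq_integral => x _; rewrite !funeposE.
- rewrite -(lawP (measurable_funeneg mF))//.
  by apply: eq_integral => x _; rewrite !funenegE.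
Qed.

Lemma has_law_Rintegral (f : T' -> R) : measurable_fun setT f ->
  \int[P]_x f (phi x) = \int[P']_y f y.
Proof.
by move=> mf; congr fine; apply: (has_law_integral (F := EFin \o f));
  exact/measurable_EFinP.
Qed.

Lemma has_law_integrable (f : T' -> R) : measurable_fun setT phi ->
  P'.-integrable setT (EFin \o f) -> P.-integrable setT (fun x => (f (phi x))%:E).
Proof.
move=> mphi /integrableP[mf fi]; apply/integrableP; split.
  exact: (measurableT_comp mf).
rewrite (lawP (F := fun y => `|(f y)%:E|%E))//.
exact: measurableT_comp.
Qed.

Lemma has_law_integrable_inv (f : T' -> R) : measurable_fun setT f ->
  P.-integrable setT (fun x => (f (phi x))%:E) -> P'.-integrable setT (EFin \o f).
Proof.
move=> mf /integrableP[_ fi]; apply/integrableP; split.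
  exact/measurable_EFinP.
rewrite -(lawP (F := fun y => `|(f y)%:E|%E))//.
by apply: measurableT_comp => //; exact/measurable_EFinP.
Qed.

End HasLaw.

Lemma has_law_comp d d' d'' (T : measurableType d) (T' : measurableType d')
    (T'' : measurableType d'') (P : set T -> \bar R) (P' : set T' -> \bar R)
    (P'' : set T'' -> \bar R) (phi : T -> T') (psi : T' -> T'') :
  measurable_fun setT psi ->
  has_law P phi P' -> has_law P' psi P'' -> has_law P (psi \o phi) P''.
Proof.
move=> mpsi l1 l2 F mF F0; rewrite -(l2 F mF F0).
apply: (l1 (F \o psi)) => [|y]; [exact: measurableT_comp|exact: F0].
Qed.

End Law.

Section ProductMeasure.
Context {R : realType}.
Implicit Type Q : probability (measurableTypeR R) R.

Definition tuple_cons n (p : measurableTypeR R * n.-tuple R) : n.+1.-tuple R :=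
  cons_tuple p.1 p.2.

Lemma measurable_tuple_cons n : measurable_fun setT (@tuple_cons n).
Proof. exact: (measurable_cons (f := fst) (g := snd)). Qed.

HB.instance Definition _ n :=
  isMeasurableFun.Build _ _ _ _ (@tuple_cons n) (@measurable_tuple_cons n).

(** The recursion follows that of [iint], first coordinate outermost, so that iterated integrals and
    product measures can be compared by induction. *)
Fixpoint tuple_prob Q n : probability (n.-tuple R) R :=
  match n with
  | 0 => \d_([tuple] : 0.-tuple R)
  | n'.+1 => distribution (Q \x tuple_prob Q n')%E (@tuple_cons n')
  end.

Lemma law_tuple_cons Q n :
  has_law (Q \x tuple_prob Q n)%E (@tuple_cons n) (tuple_prob Q n.+1).
Proof.
by move=> F mF F0; rewrite /= ge0_integral_distribution.
Qed.

Lemma ge0_integral_tuple_probS Q n (F : n.+1.-tuple R -> \bar R) :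
  measurable_fun setT F -> (forall y, 0 <= F y)%E ->
  (\int[tuple_prob Q n.+1]_z F z =
   \int[Q]_x \int[tuple_prob Q n]_t F (cons_tuple x t))%E.
Proof.
move=> mF F0; rewrite -law_tuple_cons// fubini_tonelli1//.
exact: (measurableT_comp mF (@measurable_tuple_cons n)).
Qed.

Lemma measurable_vw M N :
  measurable_fun setT (fun p : M.-tuple R * N.-tuple R => vw p.1 p.2).
Proof.
apply/measurable_fun_tnthP => i.
case: (split_ordP i) => j ->.
- rewrite (_ : _ \o _ = fun p => tnth p.1 j).
    by msolve.
  by apply/funext => p; rewrite /= tnth_lshift.
- rewrite (_ : _ \o _ = fun p => tnth p.2 j).
    by msolve.
  by apply/funext => p; rewrite /= tnth_rshift.
Qed.

Lemma law_vw Q M N :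
  has_law (tuple_prob Q M \x tuple_prob Q N)%E
    (fun p : M.-tuple R * N.-tuple R => vw p.1 p.2) (tuple_prob Q (M + N)).
Proof.
elim: M => [|M IH] F mF F0.
  have mFv : measurable_fun setT
    (fun p : 0.-tuple R * N.-tuple R => F (vw p.1 p.2)).
    exact: (measurableT_comp mF (@measurable_vw 0 N)).
  rewrite (fubini_tonelli1 (fun p => F (vw p.1 p.2)))//=.
  rewrite integral_dirac//=; last exact: measurable_fun_fubini_tonelli_F.
  rewrite diracT mul1e; apply: eq_integral => w _.
  by congr F; apply: val_inj.
have mFv : measurable_fun setT
    (fun p : M.+1.-tuple R * N.-tuple R => F (vw p.1 p.2)).
  exact: (measurableT_comp mF (@measurable_vw M.+1 N)).
rewrite (fubini_tonelli1 (fun p => F (vw p.1 p.2)))//=.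
rewrite ge0_integral_tuple_probS//; last 2 first.
- exact: (measurable_fun_fubini_tonelli_F (fun p => F (vw p.1 p.2))).
- by move=> y; apply: integral_ge0.
rewrite [RHS](@ge0_integral_tuple_probS _ (M + N))//.
apply: eq_integral => x _.
have mFx : measurable_fun setT (fun z : (M + N).-tuple R => F (cons_tuple x z)).
  apply: (measurableT_comp mF).
  apply: (measurableT_comp (@measurable_tuple_cons (M + N)) (g := pair x)).
  exact: pair1_measurable.
rewrite -[RHS](IH (fun z => F (cons_tuple x z)))// (fubini_tonelli1 (fun p => F (cons_tuple x (vw p.1 p.2))))//=; last first.
  exact: (measurableT_comp mFx (@measurable_vw M N)).
apply: eq_integral => v _; apply: eq_integral => w _.
by congr F; apply: val_inj.
Qed.

End ProductMeasure.

(** * Iterated integrals and the Gaussian measure *)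

Section IteratedIntegral.
Context {R : realType}.

(** The integral of [F] may be infinite. The negative part is at most 1, so its integral is finite
    and can be added to both sides: (F + 1) + F^- and F^+ + 1 are the same function, written as two
    sums of nonnegative terms. *)
Lemma integral_add1 d (T : measurableType d) (P : probability T R)
    (F : T -> \bar R) : measurable_fun setT F -> (forall x, -1 <= F x)%E ->
  (\int[P]_x (F x + 1) = \int[P]_x F x + 1)%E.
Proof.
move=> mF F1.
have F10 x : (0 <= F x + 1)%E by rewrite -leeBlDr// sub0e.
have mFp := measurable_funepos mF; have mFn := measurable_funeneg mF.
have Fn1 x : (F^\- x <= 1)%E.
  by rewrite funenegE ge_max lee01 andbT leeNl.
have int1 : (\int[P]_x (cst 1%E x) = 1)%E.
  rewrite integral_cst// mul1e; exact: probability_setT.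
have nfin : (\int[P]_x F^\- x)%E \is a fin_num.
  rewrite ge0_fin_numE; last exact: integral_ge0.
  apply: (@le_lt_trans _ _ (\int[P]_x (cst 1%E x))%E); last by rewrite int1 ltry.
  exact: ge0_le_integral.
have eL : (\int[P]_x ((F x + 1) + F^\- x) =
    \int[P]_x (F x + 1) + \int[P]_x F^\- x)%E.
  by apply: ge0_integralD => //; exact: emeasurable_funD.
have eR : (\int[P]_x (F^\+ x + cst 1%E x) = \int[P]_x F^\+ x + 1)%E.
  by rewrite -[in RHS]int1; apply: ge0_integralD => //.
have : (\int[P]_x (F x + 1) + \int[P]_x F^\- x = \int[P]_x F^\+ x + 1)%E.
  rewrite -eL -eR; apply: eq_integral => x _; rewrite funeposE funenegE /=.
  move: (F1 x); case: (F x) => [r _| _|//]; last by rewrite maxNye maxye.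
  rewrite -EFinN -!EFin_max -!EFinD; congr (_%:E).
  by rewrite /Num.max; case: ifPn; case: ifPn; lra.
move=> /(congr1 (fun z => z - \int[P]_x F^\- x)%E).
rewrite addeK// => ->; rewrite [in RHS]integralE.
by rewrite addeAC.
Qed.

Lemma integral_lower_bound d (T : measurableType d) (P : probability T R)
    (F : T -> \bar R) : measurable_fun setT F -> (forall x, -1 <= F x)%E ->
  (-1 <= \int[P]_x F x)%E.
Proof.
move=> mF F1; rewrite -(@leeD2rE _ 1%E)// -integral_add1//.
rewrite -EFinN -EFinD addNr; apply: integral_ge0 => x _.
by rewrite -leeBlDr// sub0e.
Qed.

Section FubiniLowerBound.
Context d1 d2 (T1 : measurableType d1) (T2 : measurableType d2)
  (P1 : probability T1 R) (P2 : probability T2 R) (F : T1 * T2 -> \bar R).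
Hypotheses (mF : measurable_fun setT F) (F1 : forall x, (-1 <= F x)%E).

Let F10 x : (0 <= F x + 1)%E. Proof. by rewrite -leeBlDr// sub0e. Qed.

Let mF1 : measurable_fun setT (fun x => F x + 1)%E.
Proof. exact: emeasurable_funD. Qed.

Let FE x : (\int[P2]_y F (x, y) = \int[P2]_y (F (x, y) + 1) - 1)%E.
Proof.
by rewrite integral_add1// ?addeK//; exact: measurable_fun_pair2.
Qed.

Lemma measurable_integral_lower_bound :
  measurable_fun setT (fun x => \int[P2]_y F (x, y))%E.
Proof.
under eq_fun do rewrite FE.
apply: emeasurable_funB => //.
exact: (measurable_fun_fubini_tonelli_F (fun z => F z + 1)%E).
Qed.

(** Tonelli for the nonnegative function F + 1, after which 1 is subtracted from both sides. *)
Lemma fubini_lower_bound :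
  (\int[P1 \x P2]_z F z = \int[P1]_x \int[P2]_y F (x, y))%E.
Proof.
have h : (\int[P1 \x P2]_z (F z + 1) = \int[P1]_x \int[P2]_y F (x, y) + 1)%E.
  rewrite (fubini_tonelli1 (fun z => F z + 1)%E)// /fubini_F.
  rewrite -integral_add1; last 2 first.
  - exact: measurable_integral_lower_bound.
  - by move=> x; apply: integral_lower_bound => //; exact: measurable_fun_pair2.
  by apply: eq_integral => x _; rewrite FE subeK.
by move: h; rewrite integral_add1// => /(congr1 (fun z => z - 1)%E); rewrite !addeK.
Qed.

End FubiniLowerBound.

(** No integrability is assumed. For c > 0 both parts scale, and the case analysis checks that the
    value given to oo - oo is compatible with the factor c; c = 0 is treated apart, with 0 times oo
    equal to 0. *)
Lemma integralZ_ge0 d (T : measurableType d) (mu : {measure set T -> \bar R})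
    (D : set T) (F : T -> \bar R) (c : R) : measurable D ->
  measurable_fun D F -> 0 <= c ->
  (\int[mu]_(x in D) (c%:E * F x) = c%:E * \int[mu]_(x in D) F x)%E.
Proof.
move=> mD mF; rewrite le_eqVlt => /predU1P[<-|c0].
  by under eq_integral do rewrite mul0e; rewrite mul0e integral0.
rewrite integralE [in RHS]integralE.
rewrite ge0_funeposM ?(ltW c0)// ge0_funenegM ?(ltW c0)//.
rewrite !ge0_integralZl ?lee_fin ?(ltW c0)//; last 2 first.
- exact: measurable_funeneg.
- exact: measurable_funepos.
have : (0 <= \int[mu]_(x in D) F^\+ x)%E by exact: integral_ge0.
have : (0 <= \int[mu]_(x in D) F^\- x)%E by exact: integral_ge0.
case: (\int[mu]_(x in D) F^\+ x)%E => [a| |]; case: (\int[mu]_(x in D) F^\- x)%E => [b| |]//= _ _;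
 by rewrite ?gt0_muley ?gt0_muleNy ?lte_fin//= -?EFinM -?EFinD -?EFinM ?mulrBr//= ?gt0_muley ?gt0_muleNy ?lte_fin.
Qed.

Section IteratedDensity.
Variables (D : set (measurableTypeR R)) (p : R -> R)
  (Q : probability (measurableTypeR R) R).
Hypotheses (mD : measurable D) (mp : measurable_fun D p)
  (p0 : forall x, D x -> 0 <= p x).
Hypothesis QE : forall F : measurableTypeR R -> \bar R,
  measurable_fun setT F -> (forall x, 0 <= F x)%E ->
  (\int[Q]_x F x = \int[lebesgue_measure]_(x in D) (F x * (p x)%:E))%E.

Lemma integral_densityE (F : measurableTypeR R -> \bar R) :
  measurable_fun setT F ->
  (\int[Q]_x F x = \int[lebesgue_measure]_(x in D) (F x * (p x)%:E))%E.
Proof.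
move=> mF; rewrite integralE [RHS]integralE; congr (_ - _)%E.
- rewrite QE//; last exact: measurable_funepos.
  apply: eq_integral => x; rewrite inE => /p0 px.
  by rewrite !funeposE maxe_pMl// ?mul0e// lee_fin.
- rewrite QE//; last exact: measurable_funeneg.
  apply: eq_integral => x; rewrite inE => /p0 px.
  by rewrite !funenegE -mulNe maxe_pMl// ?mul0e// lee_fin.
Qed.

(* The bound [-1 <= F] excludes oo - oo; entropies satisfy it since
   [x ln x >= x - 1]. *)
Lemma iint_density n (F : n.-tuple R -> \bar R) (c : R) :
  0 <= c -> measurable_fun setT F -> (forall v, -1 <= F v)%E ->
  iint D (fun v => F v * (c * \prod_(i < n) p (tnth v i))%:E)%E =
  (c%:E * \int[tuple_prob Q n]_v F v)%E.
Proof.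
(* The constant [c] is generalised: it accumulates the densities of the coordinates already split
   off. *)
elim: n F c => [|n IH] F c c0 mF F1.
  rewrite /= integral_dirac// diracT mul1e big_ord0 mulr1 muleC.
  by congr (_ * F _)%E; exact: val_inj.
have mF' : measurable_fun setT (fun z : measurableTypeR R * n.-tuple R => F (cons_tuple z.1 z.2)).
  exact: (measurableT_comp mF (@measurable_tuple_cons _ n)).
rewrite -(has_law_integral (@law_tuple_cons _ Q n))//.
rewrite (@fubini_lower_bound _ _ _ _ Q (tuple_prob Q n) (fun z => F (cons_tuple z.1 z.2)))//=.
have mG := @measurable_integral_lower_bound _ _ _ _ (tuple_prob Q n) _ mF' (fun z => F1 _).
rewrite [in RHS]integral_densityE// -integralZ_ge0//; last first.
  by apply: emeasurable_funM; [exact: measurable_funTS|exact/measurable_EFinP].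
apply: eq_integral => x; rewrite inE => Dx.
rewrite muleC -muleA -EFinM muleC [p x * c]mulrC -IH//; last 2 first.
- by rewrite mulr_ge0// p0.
- exact: measurable_fun_pair2 mF'.
congr iint; apply/funext => t; congr (_ * _%:E)%E.
rewrite big_ord_recl mulrA; congr (_ * _).
by apply: eq_bigr => i _; rewrite tnthS.
Qed.

End IteratedDensity.
End IteratedIntegral.

Section GaussianMeasure.
Context {R : realType}.

(** The variance 1 / (2 pi) makes the normal density equal to exp(- pi x^2), with peak 1. *)
Let sigma : R := (Num.sqrt (pi *+ 2))^-1.

Definition gauss1 : probability (measurableTypeR R) R := normal_prob 0 sigma.

Lemma gauss1E (F : measurableTypeR R -> \bar R) :
  measurable_fun setT F -> (forall x, 0 <= F x)%E ->
  (\int[gauss1]_x F x =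
   \int[lebesgue_measure]_x (F x * (expR (- pi * x ^+ 2))%:E))%E.
Proof.
have sigma0 : sigma != 0.
  by rewrite invr_eq0 gt_eqF// sqrtr_gt0 mulrn_wgt0// pi_gt0.
have sigma2 : sigma ^+ 2 = (pi *+ 2)^-1.
  by rewrite exprVn sqr_sqrtr// mulrn_wge0// pi_ge0.
have aux (a y : R) : a != 0 -> - y / ((a * 2)^-1 * 2) = - a * y.
  by move=> a0; field.
move=> mF F0.
rewrite (@ge0_integral_density _ _ _ lebesgue_measure (normal_pdf 0 sigma))//.
- apply: eq_integral => x _; congr (_ * _%:E)%E.
  rewrite normal_pdfE// /normal_peak /normal_fun sigma2.
  have p0 : (pi : R) != 0 by rewrite gt_eqF// pi_gt0.
  have -> : (pi *+ 2)^-1 * pi *+ 2 = 1 :> R by rewrite -mulrnAr mulVf// mulrn_eq0.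
  rewrite sqrtr1 invr1 mul1r subr0; congr expR.
  rewrite -[pi *+ 2]mulr_natr -[_^-1 *+ 2]mulr_natr. exact: aux.
- exact: measurable_normal_pdf.
- by move=> x; exact: normal_pdf_ge0.
Qed.

Definition gauss n : probability (n.-tuple R) R := tuple_prob gauss1 n.

Lemma gintE n (F : n.-tuple R -> \bar R) :
  measurable_fun setT F -> (forall v, -1 <= F v)%E ->
  gint F = (\int[gauss n]_v F v)%E.
Proof.
move=> mF F1.
rewrite -[RHS]mul1e -(@iint_density _ setT (fun x => expR (- pi * x ^+ 2)) gauss1)//.
- congr iint; apply/funext => v; congr (_ * _%:E)%E.
  by rewrite mul1r -expR_sum; congr expR; rewrite /sqnorm mulr_sumr.
- by msolve.
- exact: gauss1E.
Qed.

End GaussianMeasure.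

(** * Translations and rotations of the Gaussian measure *)

Section VectorOps.
Context {R : realType}.

Definition lc n (a b : R) (x y : n.-tuple R) : n.-tuple R :=
  [tuple a * tnth x i + b * tnth y i | i < n].

Definition dot n (x y : n.-tuple R) : R := \sum_(i < n) tnth x i * tnth y i.

Lemma tnth_lc n a b (x y : n.-tuple R) i :
  tnth (lc a b x y) i = a * tnth x i + b * tnth y i.
Proof. by rewrite tnth_mktuple. Qed.

Lemma lc_cons n a b x y (u v : n.-tuple R) :
  lc a b (cons_tuple x u) (cons_tuple y v) = cons_tuple (a * x + b * y) (lc a b u v).
Proof.
apply: eq_from_tnth => i; rewrite tnth_lc.
by case: (unliftP ord0 i) => [j|] ->; rewrite ?tnthS ?tnth_lc// !tnth0.
Qed.

Lemma dot_cons n x y (u v : n.-tuple R) :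
  dot (cons_tuple x u) (cons_tuple y v) = x * y + dot u v.
Proof.
rewrite /dot big_ord_recl; congr (_ + _).
by apply: eq_bigr => i _; rewrite !tnthS.
Qed.

Lemma sqnorm_cons n x (u : n.-tuple R) :
  sqnorm (cons_tuple x u) = x ^+ 2 + sqnorm u.
Proof.
rewrite /sqnorm big_ord_recl; congr (_ + _).
by apply: eq_bigr => i _; rewrite !tnthS.
Qed.

Lemma sqnormE n (x : n.-tuple R) : sqnorm x = dot x x.
Proof. by apply: eq_bigr => i _; rewrite expr2. Qed.

Lemma sqnorm_ge0 n (x : n.-tuple R) : 0 <= sqnorm x.
Proof. by apply: sumr_ge0 => i _; rewrite sqr_ge0. Qed.

Lemma sqnorm_lc n a b (x y : n.-tuple R) :
  sqnorm (lc a b x y) = a ^+ 2 * sqnorm x + (a * b * dot x y) *+ 2 + b ^+ 2 * sqnorm y.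
Proof.
rewrite /sqnorm /dot !mulr_sumr -sumrMnl -!big_split/=; apply: eq_bigr => i _.
by rewrite tnth_lc; ring.
Qed.

Lemma dot_lcr n a b (z x y : n.-tuple R) :
  dot z (lc a b x y) = a * dot z x + b * dot z y.
Proof.
rewrite /dot !mulr_sumr -!big_split/=; apply: eq_bigr => i _.
by rewrite tnth_lc; ring.
Qed.

Lemma dotC n (x y : n.-tuple R) : dot x y = dot y x.
Proof. by apply: eq_bigr => i _; rewrite mulrC. Qed.

Lemma measurable_fun_lc d (T : measurableType d) n a b (f g : T -> n.-tuple R) :
  measurable_fun setT f -> measurable_fun setT g ->
  measurable_fun setT (fun x => lc a b (f x) (g x)).
Proof.
move=> mf mg; apply/measurable_fun_tnthP => i.
rewrite (_ : _ \o _ = fun x => a * tnth (f x) i + b * tnth (g x) i); first by msolve.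
by apply/funext => x; rewrite /= tnth_lc.
Qed.

Lemma measurable_fun_dot d (T : measurableType d) n (f g : T -> n.-tuple R) :
  measurable_fun setT f -> measurable_fun setT g ->
  measurable_fun setT (fun x => dot (f x) (g x)).
Proof. by move=> mf mg; rewrite /dot; msolve. Qed.

Lemma measurable_fun_sqnorm d (T : measurableType d) n (f : T -> n.-tuple R) :
  measurable_fun setT f -> measurable_fun setT (fun x => sqnorm (f x)).
Proof. by move=> mf; rewrite /sqnorm; msolve. Qed.

Lemma measurable_fun_cons d (T : measurableType d) n (f : T -> R) (g : T -> n.-tuple R) :
  measurable_fun setT f -> measurable_fun setT g ->
  measurable_fun setT (fun x => cons_tuple (f x) (g x)).
Proof. exact: measurable_cons. Qed.

Lemma measurable_fun_vw d (T : measurableType d) M N (f : T -> M.-tuple R)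
    (g : T -> N.-tuple R) :
  measurable_fun setT f -> measurable_fun setT g ->
  measurable_fun setT (fun x => vw (f x) (g x)).
Proof.
move=> mf mg.
exact: (measurableT_comp (@measurable_vw R M N) (measurable_fun_pair mf mg)).
Qed.

End VectorOps.

Ltac mstep2 :=
  cbv beta;
  lazymatch goal with
  | |- measurable_fun _ (fun x => lc ?a ?b (@?f x) (@?g x)) =>
      apply: measurable_fun_lc
  | |- measurable_fun _ (fun x => dot (@?f x) (@?g x)) =>
      apply: measurable_fun_dot
  | |- measurable_fun _ (fun x => sqnorm (@?f x)) =>
      apply: measurable_fun_sqnorm
  | |- measurable_fun _ (fun x => cons_tuple (@?f x) (@?g x)) =>
      apply: measurable_fun_cons
  | |- measurable_fun _ (fun x => vw (@?f x) (@?g x)) =>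
      apply: measurable_fun_vw
  | |- measurable_fun _ (fun x => @mule _ (@?f x) (@?g x)) =>
      apply: (emeasurable_funM (f := f) (g := g))
  | |- _ => mstep
  end.
Ltac msolve2 := repeat mstep2.

(** * Translation of the Gaussian measure: the Cameron-Martin formula *)

Section CameronMartin.
Context {R : realType}.

(** The translated measure agrees with Lebesgue measure on half-open intervals, and uniqueness
    applies. *)
Lemma lebesgue_translation (u : R) (F : measurableTypeR R -> \bar R) :
  measurable_fun setT F -> (forall x, 0 <= F x)%E ->
  (\int[lebesgue_measure]_x F (x + u)%R = \int[lebesgue_measure]_x F x)%E.
Proof.
move=> mF F0.
have mphi : measurable_fun setT (fun x : measurableTypeR R => x + u : measurableTypeR R).
  by msolve.
rewrite -(ge0_integral_pushforward mphi lebesgue_measure measurableT mF)//.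
apply: eq_measure_integral => A mA _; apply/esym.
apply: (@lebesgue_measure_unique R (pushforward lebesgue_measure
  (fun x : measurableTypeR R => x + u : measurableTypeR R))) => //.
move=> _ [[a b]] _ <- /=; rewrite /pushforward.
rewrite (_ : _ @^-1` _ = `]a - u, b - u]%classic); last first.
  by apply/seteqP; split => x /=; rewrite !in_itv/= ltrBlDr lerBrDr.
rewrite !lebesgue_measure_itv/= !lte_fin ltrD2r; case: ifP => // _.
by rewrite -!EFinB; congr (_%:E); ring.
Qed.

Lemma gauss1_shift (u : R) (F : measurableTypeR R -> \bar R) :
  measurable_fun setT F -> (forall x, 0 <= F x)%E ->
  (\int[gauss1]_x F (x + u)%R =
   \int[gauss1]_x (F x * (expR (2 * pi * u * x - pi * u ^+ 2))%:E))%E.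
Proof.
move=> mF F0.
rewrite gauss1E//; last first.
  by apply: (measurableT_comp mF); msolve2.
rewrite [RHS]gauss1E//; last 2 first.
- by msolve2.
- by move=> x; rewrite mule_ge0// lee_fin expR_ge0.
rewrite -[RHS](lebesgue_translation u); last 2 first.
- by msolve2.
- by move=> x; rewrite !mule_ge0// lee_fin expR_ge0.
apply: eq_integral => x _; rewrite -muleA -EFinM -expRD; congr (_ * (expR _)%:E)%E.
by ring.
Qed.

(** The Cameron-Martin formula, one coordinate at a time. It moves a displacement of the argument of
    a measurable function into a smooth density, which is the source of all derivatives below. *)
Lemma gauss_shift n (u : n.-tuple R) (F : n.-tuple R -> \bar R) :
  measurable_fun setT F -> (forall x, 0 <= F x)%E ->
  (\int[gauss n]_x F (lc 1 1 x u)%R =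
   \int[gauss n]_x (F x * (expR (2 * pi * dot u x - pi * sqnorm u))%:E))%E.
Proof.
elim: n u F => [|n IH] u F mF F0.
  have uE (x y : 0.-tuple R) : x = y by rewrite (tuple0 x) (tuple0 y).
  apply: eq_integral => x _; rewrite (uE (lc _ _ _ _) x) /dot /sqnorm !big_ord0.
  by rewrite !mulr0 subr0 expR0 mule1.
case/tupleP: u => a u; rewrite -[[tuple of a :: u]]/(cons_tuple a u).
rewrite !ge0_integral_tuple_probS//; last 3 first.
- by msolve2.
- by move=> y; rewrite mule_ge0// lee_fin expR_ge0.
- by apply: (measurableT_comp mF); msolve2.
under eq_integral => x _.
  under eq_integral do rewrite lc_cons.
  rewrite (IH u (fun t => F (cons_tuple (1 * x + 1 * a) t)))//; last first.
    by msolve2.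
  rewrite !mul1r.
  over.
pose G x := (\int[gauss n]_t (F (cons_tuple x t) * (expR (2 * pi * dot u t - pi * sqnorm u))%:E))%E.
rewrite (gauss1_shift a (F := G)); last 2 first.
- apply: (measurable_fun_fubini_tonelli_F (fun p => F (cons_tuple p.1 p.2) * (expR (2 * pi * dot u p.2 - pi * sqnorm u))%:E)%E).
    by msolve2.
  by move=> p; rewrite mule_ge0// lee_fin expR_ge0.
- by move=> x; apply: integral_ge0 => t _; rewrite mule_ge0// lee_fin expR_ge0.
apply: eq_integral => x _; rewrite /G -ge0_integralZr//; last 2 first.
- by msolve2.
- by move=> t _; rewrite mule_ge0// lee_fin expR_ge0.
apply: eq_integral => t _.
rewrite -muleA -EFinM -expRD dot_cons sqnorm_cons; congr (_ * (expR _)%:E)%E.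
by ring.
Qed.

End CameronMartin.

(** * Rotations of a pair of independent Gaussian vectors *)

Section Shears.
Context {R : realType}.

(** The weight [w] stands for exp(pi |x|^2), which turns the Gaussian into Lebesgue measure,
    preserved by shears. A composite [U] of shears that also preserves [w] therefore preserves the
    Gaussian: the quotient of F by [w] is transported, and the weight is put back at the end. *)
Lemma law_of_shears d (T : measurableType d) (P : {measure set T -> \bar R})
    (w : T -> R) (S1 S2 U : T -> T) :
  measurable_fun setT w -> (forall x, 0 < w x) ->
  measurable_fun setT S1 -> measurable_fun setT S2 ->
  (forall F, measurable_fun setT F -> (forall x, 0 <= F x)%E ->
    (\int[P]_x (F (S1 x) * (w x)%:E) = \int[P]_x (F x * (w x)%:E))%E) ->
  (forall F, measurable_fun setT F -> (forall x, 0 <= F x)%E ->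
    (\int[P]_x (F (S2 x) * (w x)%:E) = \int[P]_x (F x * (w x)%:E))%E) ->
  (forall x, S1 (S2 (S1 x)) = U x) -> (forall x, w (U x) = w x) ->
  has_law P U P.
Proof.
move=> mw w0 mS1 mS2 inv1 inv2 SU wU F mF F0.
have mw' := measurable_fun_inv mw w0.
pose G x : \bar R := (F x * ((w x)^-1)%:E)%E.
have mG : measurable_fun setT G by rewrite /G; msolve2.
have G0 x : (0 <= G x)%E by rewrite /G mule_ge0// lee_fin invr_ge0 ltW.
have GE x y : w x = w y -> F x = (G x * (w y)%:E)%E.
  by move=> <-; rewrite /G -muleA -EFinM mulVf ?gt_eqF// mule1.
transitivity (\int[P]_x (G (U x) * (w x)%:E))%E.
  by apply: eq_integral => x _; exact: GE.
under eq_integral do rewrite -SU.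
rewrite (inv1 (fun x => G (S1 (S2 x))))//; last by msolve2.
rewrite (inv2 (fun x => G (S1 x)))//; last by msolve2.
by rewrite inv1//; apply: eq_integral => x _; rewrite -GE.
Qed.

Lemma gauss1_translation (u : R) (F : measurableTypeR R -> \bar R) :
  measurable_fun setT F -> (forall x, 0 <= F x)%E ->
  (\int[gauss1]_x (F (x + u)%R * (expR (pi * x ^+ 2))%:E) =
   \int[gauss1]_x (F x * (expR (pi * x ^+ 2))%:E))%E.
Proof.
move=> mF F0.
have h (G : measurableTypeR R -> \bar R) : measurable_fun setT G ->
    (forall x, 0 <= G x)%E ->
    (\int[gauss1]_x (G x * (expR (pi * x ^+ 2))%:E) =
     \int[lebesgue_measure]_x G x)%E.
  move=> mG G0; rewrite gauss1E; last 2 first.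
  - by msolve2.
  - by move=> x; rewrite mule_ge0// lee_fin expR_ge0.
  apply: eq_integral => x _.
  by rewrite -muleA -EFinM -expRD mulNr subrr expR0 mule1.
rewrite (h (fun x => F (x + u)%R))//; last first.
  by apply: (measurableT_comp mF); msolve2.
by rewrite lebesgue_translation// h.
Qed.

(** Translation invariance of Lebesgue measure in disguise: the Cameron-Martin density and the
    weight at the translated point multiply to the original weight, by expanding |x - t y|^2. *)
Lemma gauss_translation n (t : R) (y : n.-tuple R) (F : n.-tuple R -> \bar R) :
  measurable_fun setT F -> (forall x, 0 <= F x)%E ->
  (\int[gauss n]_x (F (lc 1 t x y) * (expR (pi * sqnorm x))%:E) =
   \int[gauss n]_x (F x * (expR (pi * sqnorm x))%:E))%E.
Proof.
move=> mF F0; pose u := lc 0 t y y.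
have uE x : lc 1 1 x u = lc 1 t x y.
  by apply: eq_from_tnth => i; rewrite !tnth_lc; ring.
have suE x : lc 1 t (lc 1 (- t) x y) y = x.
  by apply: eq_from_tnth => i; rewrite !tnth_lc; ring.
have usE x : lc 1 (-t) (lc 1 t x y) y = x.
  by apply: eq_from_tnth => i; rewrite !tnth_lc; ring.
pose G x := (F x * (expR (pi * sqnorm (lc 1 (- t) x y)))%:E)%E.
transitivity (\int[gauss n]_x G (lc 1 1 x u))%E.
  by apply: eq_integral => x _; rewrite uE /G usE.
rewrite gauss_shift; last 2 first.
- by rewrite /G; msolve2.
- by move=> x; rewrite mule_ge0// lee_fin expR_ge0.
apply: eq_integral => x _; rewrite /G -muleA -EFinM -expRD; congr (_ * (expR _)%:E)%E.
rewrite !sqnorm_lc [dot u x]dotC dot_lcr -sqnormE !mulr2n; ring.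
Qed.

Definition pair_rot n (c s : R) (p : n.-tuple R * n.-tuple R) :=
  (lc c (- s) p.1 p.2, lc s c p.1 p.2).

Let pair_weight n (p : n.-tuple R * n.-tuple R) : R :=
  expR (pi * sqnorm p.1) * expR (pi * sqnorm p.2).

Let pair_shear1 n t (F : n.-tuple R * n.-tuple R -> \bar R) :
  measurable_fun setT F -> (forall x, 0 <= F x)%E ->
  (\int[gauss n \x gauss n]_p (F (lc 1 t p.1 p.2, p.2) * (pair_weight p)%:E) =
   \int[gauss n \x gauss n]_p (F p * (pair_weight p)%:E))%E.
Proof.
move=> mF F0; have e0 x : (0 <= (@pair_weight n x)%:E)%E.
  by rewrite lee_fin mulr_ge0// expR_ge0.
rewrite fubini_tonelli2; last 2 first.
- by rewrite /pair_weight; msolve2.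
- by move=> x; rewrite mule_ge0.
rewrite [RHS]fubini_tonelli2; last 2 first.
- by rewrite /pair_weight; msolve2.
- by move=> x; rewrite mule_ge0.
apply: eq_integral => y _; rewrite /fubini_G /pair_weight/=.
transitivity (\int[gauss n]_x ((F (x, y) * (expR (pi * sqnorm y))%:E) * (expR (pi * sqnorm x))%:E))%E; last first.
  by apply: eq_integral => x _; rewrite EFinM -muleA [X in (_ * X)%E]muleC.
rewrite -(gauss_translation t y (F := fun x => F (x, y) * (expR (pi * sqnorm y))%:E)%E).
- by apply: eq_integral => x _; rewrite EFinM -muleA [X in (_ * X)%E]muleC.
- by msolve2.
- by move=> x; rewrite mule_ge0// lee_fin expR_ge0.
Qed.

Let pair_shear2 n t (F : n.-tuple R * n.-tuple R -> \bar R) :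
  measurable_fun setT F -> (forall x, 0 <= F x)%E ->
  (\int[gauss n \x gauss n]_p (F (p.1, lc 1 t p.2 p.1) * (pair_weight p)%:E) =
   \int[gauss n \x gauss n]_p (F p * (pair_weight p)%:E))%E.
Proof.
move=> mF F0; have e0 x : (0 <= (@pair_weight n x)%:E)%E.
  by rewrite lee_fin mulr_ge0// expR_ge0.
rewrite fubini_tonelli1; last 2 first.
- by rewrite /pair_weight; msolve2.
- by move=> x; rewrite mule_ge0.
rewrite [RHS]fubini_tonelli1; last 2 first.
- by rewrite /pair_weight; msolve2.
- by move=> x; rewrite mule_ge0.
apply: eq_integral => x _; rewrite /fubini_F /pair_weight/=.
transitivity (\int[gauss n]_y ((F (x, y) * (expR (pi * sqnorm x))%:E) * (expR (pi * sqnorm y))%:E))%E; last first.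
  by apply: eq_integral => y _; rewrite EFinM -muleA.
rewrite -(gauss_translation t x (F := fun y => F (x, y) * (expR (pi * sqnorm x))%:E)%E).
- by apply: eq_integral => y _; rewrite EFinM -muleA.
- by msolve2.
- by move=> y; rewrite mule_ge0// lee_fin expR_ge0.
Qed.

Lemma measurable_pair_rot n c s : measurable_fun setT (@pair_rot n c s).
Proof. by rewrite /pair_rot; msolve2. Qed.

Let law_pair_rot0 n (c s : R) : c ^+ 2 + s ^+ 2 = 1 -> c != -1 ->
  has_law (gauss n \x gauss n)%E (@pair_rot n c s) (gauss n \x gauss n)%E.
Proof.
move=> cs1 cN1; have c10 : 1 + c != 0 by rewrite addrC -[1]opprK subr_eq0.
(* A rotation by an angle th is the product of three shears with coefficients - tan(th/2), sin th
   and - tan(th/2), and s / (1 + c) is tan(th/2). *)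
apply: (law_of_shears (w := @pair_weight n)
  (S1 := fun p => (lc 1 (- s / (1 + c)) p.1 p.2, p.2))
  (S2 := fun p => (p.1, lc 1 s p.2 p.1))).
- by rewrite /pair_weight; msolve2.
- by move=> x; rewrite mulr_gt0// expR_gt0.
- by msolve2.
- by msolve2.
- exact: pair_shear1.
- exact: pair_shear2.
- have e1 : 1 + s * (- s / (1 + c)) = c.
    have -> : s * (- s / (1 + c)) = - s ^+ 2 / (1 + c) by ring.
    have -> : s ^+ 2 = (1 - c) * (1 + c) by apply: (addrI (c ^+ 2)); rewrite cs1; ring.
    by rewrite -mulNr mulfK//; ring.
  have e2 : - s = (- s / (1 + c)) * (1 + c) by rewrite mulfVK.
  move: e1 e2; set a := - s / (1 + c); clearbody a => e1 e2 [x y].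
  rewrite /pair_rot/= e2 -e1.
  by congr (_, _); apply: eq_from_tnth => i; rewrite !tnth_lc; ring.
- move=> [x y]; rewrite /pair_weight /pair_rot/= -!expRD; congr expR.
  rewrite -!mulrDr; congr (_ * _); rewrite !sqnorm_lc -[in RHS](mul1r (_ + _)) -cs1 !mulr2n.
  by ring.
Qed.

Lemma law_pair_rot n (c s : R) : c ^+ 2 + s ^+ 2 = 1 ->
  has_law (gauss n \x gauss n)%E (@pair_rot n c s) (gauss n \x gauss n)%E.
Proof.
move=> cs1; have [cN1|] := eqVneq c (-1); last exact: law_pair_rot0.
have s0 : s = 0.
  by apply/eqP; rewrite -sqrf_eq0; apply/eqP; move: cs1; rewrite cN1; lra.
(* The half turn is the square of the quarter turn, to which the shears apply. *)
have -> : @pair_rot n c s = @pair_rot n 0 1 \o @pair_rot n 0 1.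
  apply/funext => -[x y]; rewrite /pair_rot/= cN1 s0.
  by congr (_, _); apply: eq_from_tnth => i; rewrite !tnth_lc; ring.
have l0 : has_law (gauss n \x gauss n)%E (@pair_rot n 0 1) (gauss n \x gauss n)%E.
  by apply: law_pair_rot0; [lra|rewrite eq_sym oppr_eq0 oner_eq0].
exact: (has_law_comp (@measurable_pair_rot n 0 1) l0 l0).
Qed.

Lemma law_fst d1 d2 (T1 : measurableType d1) (T2 : measurableType d2)
  (P1 : probability T1 R) (P2 : probability T2 R) :
  has_law (P1 \x P2)%E fst P1.
Proof.
move=> F mF F0; rewrite (fubini_tonelli1 (fun p => F p.1))//; last by msolve2.
apply: eq_integral => x _; rewrite /fubini_F/= (integral_cst P2 measurableT (F x)).
by rewrite -[RHS]mule1; congr (_ * _)%E; exact: probability_setT.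
Qed.

Definition scale n (r : R) (x : n.-tuple R) : n.-tuple R :=
  [tuple r * tnth x i | i < n].

Lemma tnth_scale n r (x : n.-tuple R) i : tnth (scale r x) i = r * tnth x i.
Proof. by rewrite tnth_mktuple. Qed.

Lemma scaleE n r : @scale n r = (fun x => lc r 0 x x).
Proof.
apply/funext => x; apply: eq_from_tnth => i.
by rewrite tnth_scale tnth_lc mul0r addr0.
Qed.

Lemma measurable_fun_scale d (T : measurableType d) n r (f : T -> n.-tuple R) :
  measurable_fun setT f -> measurable_fun setT (fun x => scale r (f x)).
Proof. by move=> mf; rewrite scaleE; msolve2. Qed.

(** For r <> 0 the vector (a / r, b / r) has length 1, so (a x + b y) / r is the first component of
    a rotated independent pair and has the law of x. For r = 0 both coefficients vanish. *)
Lemma Rgauss_conv n (a b r : R) (f : n.-tuple R -> R) :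
  a ^+ 2 + b ^+ 2 = r ^+ 2 -> measurable_fun setT f ->
  \int[(gauss n \x gauss n)%E]_p f (lc a b p.1 p.2) = \int[gauss n]_x f (scale r x).
Proof.
move=> abr mf.
have [c [s [cs1 ca sb]]] : exists c s, [/\ c ^+ 2 + s ^+ 2 = 1, r * c = a & r * s = - b].
  have [r0|r0] := eqVneq r 0.
    have a0 : a = 0.
      apply/eqP; rewrite -sqrf_eq0; apply/eqP.
      by move: abr (sqr_ge0 a) (sqr_ge0 b); rewrite r0 expr0n/=; lra.
    have b0 : b = 0.
      apply/eqP; rewrite -sqrf_eq0; apply/eqP.
      by move: abr (sqr_ge0 a) (sqr_ge0 b); rewrite r0 expr0n/=; lra.
    by exists 1, 0; rewrite r0 a0 b0 oppr0 !mul0r expr1n expr0n addr0.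
  exists (a / r), (- b / r); split; last 2 first.
  - by rewrite mulrC divfK.
  - by rewrite mulrC divfK.
  by rewrite !exprMn sqrrN -mulrDl abr exprVn divff// sqrf_eq0.
have l : has_law (gauss n \x gauss n)%E (fst \o @pair_rot n c s) (gauss n).
  apply: has_law_comp; [exact: measurable_fst|exact: law_pair_rot|exact: law_fst].
rewrite -(has_law_Rintegral l (f := fun x => f (scale r x))); last first.
  by apply: (measurableT_comp mf); exact: measurable_fun_scale.
apply: eq_Rintegral => -[x y] _; congr f; apply: eq_from_tnth => i.
by rewrite /= tnth_scale !tnth_lc -ca -[b]opprK -sb; ring.
Qed.

End Shears.

(** * Rotations in a coordinate plane *)

Section PlanarRotation.
Context {R : realType}.

Definition addi n (i : 'I_n) (a : R) (z : n.-tuple R) : n.-tuple R :=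
  [tuple if k == i then tnth z k + a else tnth z k | k < n].

Lemma tnth_addi n (i : 'I_n) a (z : n.-tuple R) k :
  tnth (addi i a z) k = if k == i then tnth z k + a else tnth z k.
Proof. by rewrite tnth_mktuple. Qed.

Lemma addi0_cons n a x (t : n.-tuple R) :
  addi ord0 a (cons_tuple x t) = cons_tuple (x + a) t.
Proof.
apply: eq_from_tnth => k; rewrite tnth_addi.
by case: (unliftP ord0 k) => [j|] ->; rewrite ?tnthS ?tnth0.
Qed.

Lemma addi_lift_cons n (j : 'I_n) a x (t : n.-tuple R) :
  addi (lift ord0 j) a (cons_tuple x t) = cons_tuple x (addi j a t).
Proof.
apply: eq_from_tnth => k; rewrite tnth_addi.
case: (unliftP ord0 k) => [l|] ->; rewrite ?tnthS ?tnth0//.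
by rewrite tnth_addi (inj_eq lift_inj).
Qed.

Lemma measurable_fun_addi d (T : measurableType d) n (i : 'I_n)
    (c : T -> R) (f : T -> n.-tuple R) :
  measurable_fun setT c -> measurable_fun setT f ->
  measurable_fun setT (fun x => addi i (c x) (f x)).
Proof.
move=> mc mf; apply/measurable_fun_tnthP => k.
rewrite (_ : _ \o _ = fun x => if k == i then tnth (f x) k + c x else tnth (f x) k).
  by case: (k == i); msolve2.
by apply/funext => x; rewrite /= tnth_addi.
Qed.

(** The displacement [c z] does not depend on the coordinate i, so with the other coordinates frozen
    the map is a translation of a line. *)
Lemma gauss_coordinate_translation n (i : 'I_n) (c : n.-tuple R -> R)
    (F : n.-tuple R -> \bar R) :
  measurable_fun setT c -> (forall a z, c (addi i a z) = c z) ->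
  measurable_fun setT F -> (forall x, 0 <= F x)%E ->
  (\int[gauss n]_z (F (addi i (c z) z) * (expR (pi * sqnorm z))%:E) =
   \int[gauss n]_z (F z * (expR (pi * sqnorm z))%:E))%E.
Proof.
elim: n i c F => [[]//|n IH] i c F mc ci mF F0.
rewrite !ge0_integral_tuple_probS//; last 4 first.
- by msolve2.
- by move=> y; rewrite mule_ge0// lee_fin expR_ge0.
- apply: (emeasurable_funM (f := fun z => F (addi i (c z) z))); last by msolve2.
  apply: (measurableT_comp mF); apply: measurable_fun_addi => //; exact: measurable_id.
- by move=> y; rewrite mule_ge0// lee_fin expR_ge0.
(* For a later coordinate the induction hypothesis applies under the outer integral; for the first
   one, Tonelli makes it the inner integral. *)
case: (unliftP ord0 i) => [j|] ie; rewrite {i}ie in ci *.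
  apply: eq_integral => x _.
  have e t : (expR (pi * sqnorm (cons_tuple x t)))%:E = ((expR (pi * x ^+ 2))%:E * (expR (pi * sqnorm t))%:E)%E.
    by rewrite sqnorm_cons mulrDr expRD EFinM.
  under eq_integral do rewrite addi_lift_cons e muleA.
  under [RHS]eq_integral do rewrite e muleA.
  rewrite (IH j (fun t => c (cons_tuple x t)) (fun t => F (cons_tuple x t) * (expR (pi * x ^+ 2))%:E)%E)//.
  - by msolve2.
  - by move=> a z; rewrite -addi_lift_cons ci.
  - by msolve2.
  - by move=> t; rewrite mule_ge0// lee_fin expR_ge0.
have cE x t : c (cons_tuple x t) = c (cons_tuple 0 t).
  by rewrite -(ci x (cons_tuple 0 t)) addi0_cons add0r.
rewrite (fubini_tonelli (m1 := gauss1) (m2 := gauss n) (fun p => F (addi ord0 (c (cons_tuple p.1 p.2)) (cons_tuple p.1 p.2)) * (expR (pi * sqnorm (cons_tuple p.1 p.2)))%:E)%E)/=; last 2 first.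
- apply: (emeasurable_funM (f := fun p => F (addi ord0 (c (cons_tuple p.1 p.2)) (cons_tuple p.1 p.2)))); last by msolve2.
  by apply: (measurableT_comp mF); apply: measurable_fun_addi; msolve2.
- by move=> p; rewrite mule_ge0// lee_fin expR_ge0.
rewrite [RHS](fubini_tonelli (m1 := gauss1) (m2 := gauss n) (fun p => F (cons_tuple p.1 p.2) * (expR (pi * sqnorm (cons_tuple p.1 p.2)))%:E)%E)/=; last 2 first.
- by msolve2.
- by move=> p; rewrite mule_ge0// lee_fin expR_ge0.
apply: eq_integral => t _.
have e x : (expR (pi * sqnorm (cons_tuple x t)))%:E = ((expR (pi * sqnorm t))%:E * (expR (pi * x ^+ 2))%:E)%E.
  by rewrite sqnorm_cons mulrDr expRD mulrC EFinM.
under eq_integral do rewrite addi0_cons cE e muleA.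
under [RHS]eq_integral do rewrite e muleA.
pose a := c (cons_tuple 0 t).
rewrite (@gauss1_translation _ a (fun x => F (cons_tuple x t) * (expR (pi * sqnorm t))%:E)%E)//.
- by msolve2.
- by move=> x; rewrite mule_ge0// lee_fin expR_ge0.
Qed.

(** [rot_inv] with free parameters in place of cosine and sine, so that its properties follow by
    algebra from c^2 + s^2 = 1. *)
Definition rotc n (i j : 'I_n) (c s : R) (z : n.-tuple R) : n.-tuple R :=
  [tuple if k == i then tnth z i * c - tnth z j * s
         else if k == j then tnth z i * s + tnth z j * c
         else tnth z k | k < n].

Lemma tnth_rotc n (i j : 'I_n) c s (z : n.-tuple R) k :
  tnth (rotc i j c s z) k =
  if k == i then tnth z i * c - tnth z j * s
  else if k == j then tnth z i * s + tnth z j * c else tnth z k.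
Proof. by rewrite tnth_mktuple. Qed.

Lemma big_rotc n (i j : 'I_n) (G : 'I_n -> R -> R) c s (z : n.-tuple R) : i != j ->
  \sum_k G k (tnth (rotc i j c s z) k) =
  \sum_k G k (tnth z k) +
   (G i (tnth z i * c - tnth z j * s) - G i (tnth z i)) +
   (G j (tnth z i * s + tnth z j * c) - G j (tnth z j)).
Proof.
move=> ij; have ji : j != i by rewrite eq_sym.
rewrite (bigD1 i)//= (bigD1 j)//= [in RHS](bigD1 i)//= [in RHS](bigD1 j)//=.
rewrite !tnth_rotc eqxx (negbTE ji) eqxx.
rewrite (eq_bigr (fun k => G k (tnth z k))); last first.
  by move=> k /andP[ki kj]; rewrite tnth_rotc (negbTE ki) (negbTE kj).
by ring.
Qed.

Lemma sqnorm_rotc n (i j : 'I_n) c s (z : n.-tuple R) : i != j ->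
  c ^+ 2 + s ^+ 2 = 1 -> sqnorm (rotc i j c s z) = sqnorm z.
Proof.
move=> ij cs1; rewrite /sqnorm (@big_rotc _ i j (fun _ x => x ^+ 2))//.
rewrite -addrA -[RHS]addr0; congr (_ + _).
transitivity ((c ^+ 2 + s ^+ 2 - 1) * (tnth z i ^+ 2 + tnth z j ^+ 2)); first by ring.
by rewrite cs1 subrr mul0r.
Qed.

Lemma measurable_fun_rotc d (T : measurableType d) n (i j : 'I_n)
    (c s : T -> R) (f : T -> n.-tuple R) :
  measurable_fun setT c -> measurable_fun setT s -> measurable_fun setT f ->
  measurable_fun setT (fun x => rotc i j (c x) (s x) (f x)).
Proof.
move=> mc ms mf; apply/measurable_fun_tnthP => k.
rewrite (_ : _ \o _ = fun x => if k == i then tnth (f x) i * c x - tnth (f x) j * s x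
  else if k == j then tnth (f x) i * s x + tnth (f x) j * c x else tnth (f x) k).
  by case: (k == i); case: (k == j); msolve2.
by apply/funext => x; rewrite /= tnth_rotc.
Qed.

(* A rotation other than [-1] is a product of three shears. *)
Let law_rotc0 n (i j : 'I_n) (c s : R) : i != j -> c ^+ 2 + s ^+ 2 = 1 -> c != -1 ->
  has_law (gauss n) (rotc i j c s) (gauss n).
Proof.
move=> ij cs1 cN1; have c10 : 1 + c != 0 by rewrite addrC -[1]opprK subr_eq0.
have ji : j != i by rewrite eq_sym.
have e1 : 1 + s * (- s / (1 + c)) = c.
  have -> : s * (- s / (1 + c)) = - s ^+ 2 / (1 + c) by ring.
  have -> : s ^+ 2 = (1 - c) * (1 + c) by apply: (addrI (c ^+ 2)); rewrite cs1; ring.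
  by rewrite -mulNr mulfK//; ring.
have e2 : - s = (- s / (1 + c)) * (1 + c) by rewrite mulfVK.
pose a := - s / (1 + c).
have shear (k l : 'I_n) t F : k != l -> measurable_fun setT F -> (forall x, 0 <= F x)%E ->
    (\int[gauss n]_z (F (addi k (t * tnth z l) z) * (expR (pi * sqnorm z))%:E) =
     \int[gauss n]_z (F z * (expR (pi * sqnorm z))%:E))%E.
  move=> kl mF F0.
  apply: (@gauss_coordinate_translation n k (fun z => t * tnth z l) F) => //.
    by msolve2.
  by move=> b z; rewrite tnth_addi eq_sym (negbTE kl).
apply: (law_of_shears (w := fun z => expR (pi * sqnorm z))
  (S1 := fun z => addi i (a * tnth z j) z)
  (S2 := fun z => addi j (s * tnth z i) z)).
- by msolve2.
- by move=> x; exact: expR_gt0.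
- by apply: measurable_fun_addi; msolve2.
- by apply: measurable_fun_addi; msolve2.
- by move=> F; exact: shear.
- by move=> F; exact: shear.
- move: e1 e2; rewrite -/a; clearbody a => e1 e2 z.
  apply: eq_from_tnth => k; rewrite tnth_rotc !tnth_addi !eqxx ?(negbTE ij) ?(negbTE ji).
  have [->|ki] := eqVneq k i.
    by rewrite (negbTE ij) -mulrN e2 -e1; ring.
  by have [->|kj] := eqVneq k j => //; rewrite ?eqxx ?(negbTE ji) -?e1; ring.
- by move=> z; rewrite sqnorm_rotc.
Qed.

Lemma law_rotc n (i j : 'I_n) (c s : R) : i != j -> c ^+ 2 + s ^+ 2 = 1 ->
  has_law (gauss n) (rotc i j c s) (gauss n).
Proof.
move=> ij cs1; have [cN1|] := eqVneq c (-1); last exact: law_rotc0.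
have ji : j != i by rewrite eq_sym.
have s0 : s = 0.
  by apply/eqP; rewrite -sqrf_eq0; apply/eqP; move: cs1; rewrite cN1; lra.
have -> : @rotc n i j c s = @rotc n i j 0 1 \o @rotc n i j 0 1.
  apply/funext => z; apply: eq_from_tnth => k /=.
  rewrite cN1 s0 !tnth_rotc !eqxx ?(negbTE ij) ?(negbTE ji).
  have [_|ki] := eqVneq k i; first by ring.
  by have [_|kj] := eqVneq k j; [ring|].
have l0 : has_law (gauss n) (@rotc n i j 0 1) (gauss n).
  by apply: law_rotc0; [|lra|rewrite eq_sym oppr_eq0 oner_eq0].
apply: (has_law_comp _ l0 l0).
by apply: measurable_fun_rotc; msolve2.
Qed.

End PlanarRotation.

(** * Gaussian moments *)

Section Moments.
Context {R : realType}.

Lemma integrable_gauss1_poly q :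
  (@gauss1 R).-integrable setT (fun x => ((1 + x ^+ 2) ^+ q)%:E).
Proof.
have m1 : measurable_fun setT (fun x : measurableTypeR R => ((1 + x ^+ 2) ^+ q : R)).
  by msolve2.
have p0 (x : R) : 0 <= (1 + x ^+ 2) ^+ q by rewrite exprn_ge0// addr_ge0// sqr_ge0.
apply/integrableP; split; first exact/measurable_EFinP.
under eq_integral do rewrite gee0_abs ?lee_fin//.
rewrite gauss1E; last 2 first.
- exact/measurable_EFinP.
- by move=> x; rewrite lee_fin.
(* The bound is (1 + x^2)^q <= q! exp(1 + x^2). Multiplied by the density this leaves exp((1 - pi)
   x^2), which is at most exp(- x^2) because pi >= 2. *)
pose C : R := q`!%:R * expR 1.
have C0 : 0 <= C by rewrite mulr_ge0// expR_ge0.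
apply: (@le_lt_trans _ _ (\int[lebesgue_measure]_(x in setT) (C%:E * (gauss_fun x)%:E))%E).
  apply: ge0_le_integral => //.
  - by move=> x _; apply: mule_ge0; rewrite lee_fin ?expR_ge0.
  - by msolve2.
  - apply: emeasurable_funM => //; apply/measurable_EFinP.
    exact: measurable_gauss_fun.
  - move=> x _; rewrite -!EFinM lee_fin.
    have h : (1 + x ^+ 2) ^+ q <= q`!%:R * expR (1 + x ^+ 2).
      have y0 : 0 <= 1 + x ^+ 2 by rewrite addr_ge0// sqr_ge0.
      case: (q) => [|k].
        by rewrite expr0 fact0 mul1r -[leLHS]expR0 ler_expR.
      have := expR_ge1Dxn k y0; set E := expR _; set X := _ ^+ _ => e1.
      have f0 : 0 < (k.+1)`!%:R :> R by rewrite ltr0n fact_gt0.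
      by rewrite -ler_pdivrMl// mulrC (le_trans _ e1)// lerDr.
    apply: (@le_trans _ _ (q`!%:R * expR (1 + x ^+ 2) * expR (- pi * x ^+ 2))).
      by rewrite ler_wpM2r// expR_ge0.
    rewrite /C -!mulrA ler_wpM2l// /gauss_fun -!expRD ler_expR.
    rewrite -addrA lerD2l -subr_ge0.
    have -> : - x ^+ 2 - (x ^+ 2 + - pi * x ^+ 2) = (pi - 2) * x ^+ 2 by ring.
    by rewrite mulr_ge0 ?sqr_ge0// subr_ge0 pi_ge2.
rewrite ge0_integralZl//; last 2 first.
- by apply/measurable_EFinP; exact: measurable_gauss_fun.
- by move=> x _; rewrite lee_fin gauss_fun_ge0.
by rewrite integralT_gauss -EFinM ltry.
Qed.

Lemma integrable_gauss_poly n q :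
  (gauss n).-integrable setT (fun z : n.-tuple R => ((1 + sqnorm z) ^+ q)%:E).
Proof.
have m1 k : measurable_fun setT (fun z : k.-tuple R => (1 + sqnorm z) ^+ q).
  by msolve2.
have p0 k (z : k.-tuple R) : 0 <= (1 + sqnorm z) ^+ q.
  by rewrite exprn_ge0// addr_ge0// sqnorm_ge0.
elim: n => [|n IH].
  apply: (@integrable_bounded _ _ _ (gauss 0) (fun z => (1 + sqnorm z) ^+ q) 1) => [|z]; first exact: m1.
  by rewrite /sqnorm big_ord0 addr0 expr1n normr1.
apply: (has_law_integrable_inv (@law_tuple_cons _ gauss1 n)); first exact: m1.
apply: (@integrable_prod _ _ _ _ _ gauss1 (gauss n)
  (fun z => (1 + sqnorm (tuple_cons z)) ^+ q) (fun x => (1 + x ^+ 2) ^+ q)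
  (fun t : n.-tuple R => (1 + sqnorm t) ^+ q)) => //.
- by rewrite /tuple_cons; msolve2.
- exact: integrable_gauss1_poly.
- by move=> x; rewrite exprn_ge0// addr_ge0// sqr_ge0.
- move=> x t /=; rewrite ger0_norm// -exprMn lerXn2r// ?nnegrE.
  + by rewrite addr_ge0// sqnorm_ge0.
  + by rewrite mulr_ge0// addr_ge0// ?sqr_ge0 ?sqnorm_ge0.
  rewrite sqnorm_cons mulrDl !mul1r mulrDr mulr1.
  by have := mulr_ge0 (sqr_ge0 x) (sqnorm_ge0 t); rewrite /=; lra.
Qed.

Lemma Rintegral_gaussS n (f : n.+1.-tuple R -> R) :
  (gauss n.+1).-integrable setT (EFin \o f) ->
  \int[gauss n.+1]_z f z = \int[gauss1]_x \int[gauss n]_t f (cons_tuple x t).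
Proof.
move=> fi; have mf : measurable_fun setT f.
  by apply/measurable_EFinP; exact: measurable_int fi.
rewrite -(has_law_Rintegral (@law_tuple_cons _ gauss1 n))// Rfubini1//.
exact: (has_law_integrable (@law_tuple_cons _ gauss1 n) (@measurable_tuple_cons _ n)).
Qed.

Lemma Rintegral_gauss_vw M N (f : (M + N).-tuple R -> R) :
  (gauss (M + N)).-integrable setT (EFin \o f) ->
  \int[gauss (M + N)]_z f z = \int[gauss M]_v \int[gauss N]_w f (vw v w).
Proof.
move=> fi; have mf : measurable_fun setT f.
  by apply/measurable_EFinP; exact: measurable_int fi.
rewrite -(has_law_Rintegral (@law_vw _ gauss1 M N))// Rfubini1//.
exact: (has_law_integrable (@law_vw _ gauss1 M N) (@measurable_vw _ M N)).
Qed.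

Lemma dot_le n (x y : n.-tuple R) : `|dot x y| <= (sqnorm x + sqnorm y) / 2.
Proof.
rewrite ler_norml; apply/andP; split.
- have := sqnorm_ge0 (lc 1 1 x y); rewrite sqnorm_lc expr1n [_ * _ *+ 2]mulr2n; lra.
- have := sqnorm_ge0 (lc 1 (-1) x y); rewrite sqnorm_lc sqrrN expr1n [_ * _ *+ 2]mulr2n; lra.
Qed.

Lemma dot_leW n (x y : n.-tuple R) : `|dot x y| <= (1 + sqnorm x) * (1 + sqnorm y).
Proof.
apply: (le_trans (dot_le x y)).
have := sqnorm_ge0 x; have := sqnorm_ge0 y; have := mulr_ge0 (sqnorm_ge0 x) (sqnorm_ge0 y).
nra.
Qed.

Lemma integrable_dot n (d : n.-tuple R) q :
  (gauss n).-integrable setT (fun z => (dot d z ^+ q)%:E).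
Proof.
apply: (@integrable_dominated _ _ _ (gauss n) (fun z => dot d z ^+ q)
  (fun z => (1 + sqnorm d) ^+ q * (1 + sqnorm z) ^+ q)).
- by msolve2.
- by apply: (integrableZl measurableT _ (integrable_gauss_poly n q)).
- move=> z; rewrite normrX -exprMn lerXn2r// ?nnegrE//.
    by rewrite mulr_ge0// addr_ge0// sqnorm_ge0.
  exact: dot_leW.
Qed.

Lemma gauss_dot_mean n (d : n.-tuple R) : \int[gauss n]_z dot d z = 0.
Proof.
have md : measurable_fun setT (fun z => dot d z) by msolve2.
have di : (gauss n \x gauss n)%E.-integrable setT (fun p => (dot d p.1)%:E).
  apply: (has_law_integrable (@law_fst _ _ _ _ _ (gauss n) (gauss n)) (f := dot d)) => //.
  exact: (integrable_dot d 1).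
have h1 := @Rgauss_conv _ n 1 0 1 _ (ltac:(lra)) md.
(* The coefficients (-1, 0) express the symmetry of the Gaussian under x -> - x. *)
have h2 := @Rgauss_conv _ n (-1) 0 1 _ (ltac:(lra)) md.
have : \int[gauss n]_z dot d (scale 1 z) = - \int[gauss n]_z dot d (scale 1 z).
  rewrite -{1}h2 -h1 -[RHS]mulN1r -RintegralZl//; last first.
    under eq_fun do rewrite /= dot_lcr mul1r mul0r addr0; exact: di.
  by apply: eq_Rintegral => -[x y] _ /=; rewrite !dot_lcr; ring.
have sc z : scale 1 z = z :> n.-tuple R.
  by apply: eq_from_tnth => i; rewrite tnth_scale mul1r.
have -> : \int[gauss n]_z dot d (scale 1 z) = \int[gauss n]_z dot d z.
  by apply: eq_Rintegral => z _; rewrite sc.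
lra.
Qed.

(** Kept symbolic, since it is a common factor of the two Fisher informations that are compared. *)
Definition gauss_var : R := \int[gauss1]_x x ^+ 2.

Lemma gauss_dot_var n (d : n.-tuple R) :
  \int[gauss n]_z dot d z ^+ 2 = gauss_var * sqnorm d.
Proof.
elim: n d => [|n IH] d.
  under eq_Rintegral do rewrite /dot big_ord0 expr0n/=.
  by rewrite Rintegral_cst// /sqnorm big_ord0 mulr0 mul0r.
case/tupleP: d => a d; rewrite -[[tuple of a :: d]]/(cons_tuple a d).
have x2i : gauss1.-integrable setT (fun x : measurableTypeR R => (x ^+ 2)%:E).
  apply: (@integrable_dominated _ _ _ gauss1 (fun x => x ^+ 2) (fun x : R => (1 + x ^+ 2) ^+ 1)).
  - by msolve2.
  - exact: integrable_gauss1_poly.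
  - by move=> x; rewrite expr1 ger0_norm ?sqr_ge0// lerDr.
rewrite Rintegral_gaussS; last exact: integrable_dot.
transitivity (\int[gauss1]_x (a ^+ 2 * x ^+ 2 + gauss_var * sqnorm d)).
  apply: eq_Rintegral => x _; rewrite -IH.
  have ic : (gauss n).-integrable setT (fun t : n.-tuple R => ((a * x) ^+ 2)%:E).
    by apply: (@integrable_bounded _ _ _ (gauss n) _ `|(a * x) ^+ 2|).
  have id1 : (gauss n).-integrable setT (fun t => (2 * (a * x) * dot d t)%:E).
    exact: (integrableZl measurableT _ (integrable_dot d 1)).
  have i1 : (gauss n).-integrable setT (fun t => ((a * x) ^+ 2 + 2 * (a * x) * dot d t)%:E).
    exact: (integrableD measurableT ic id1).
  transitivity (\int[gauss n]_t (((a * x) ^+ 2 + 2 * (a * x) * dot d t) + dot d t ^+ 2)).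
    by apply: eq_Rintegral => t _; rewrite dot_cons; ring.
  rewrite RintegralD//; last exact: integrable_dot.
  congr (_ + _).
  rewrite RintegralD// RintegralZl//; last exact: (integrable_dot d 1).
  by rewrite gauss_dot_mean mulr0 addr0 Rintegral_prob_cst exprMn.
rewrite RintegralD//; last 2 first.
- exact: (integrableZl measurableT _ x2i).
- exact: (@integrable_bounded _ _ _ gauss1 _ `|gauss_var * sqnorm d|).
rewrite RintegralZl// Rintegral_prob_cst sqnorm_cons /gauss_var; ring.
Qed.

End Moments.

Section RealBounds.
Context {R : realType}.

(** The factor exp t on the right is deliberate: in the application it is the density of a
    translated Gaussian, so the bound can be integrated exactly. The starting point is exp(t) (1 -
    t) <= 1. *)
Lemma expR_taylor1 (t : R) : `|expR t - 1 - t| <= t ^+ 2 * (1 + expR t).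
Proof.
have e1 := expR_ge1Dx t.
rewrite ger0_norm; last by lra.
have e2 : expR t * (1 - t) <= 1.
  have := expR_ge1Dx (- t).
  rewrite -(ler_pM2l (expR_gt0 t)) -expRD subrr expR0; lra.
have e0 := expR_gt0 t.
have : expR t - 1 - t <= t * (expR t - 1) by lra.
move=> /le_trans; apply.
have [t0|t0] := leP 0 t.
  have : t * (expR t - 1) <= t * (t * expR t) by rewrite ler_wpM2l//; lra.
  have := sqr_ge0 t; nra.
have : (- t) * (1 - expR t) <= (- t) * (- t) by rewrite ler_wpM2l//; lra.
have := mulr_ge0 (sqr_ge0 t) (ltW e0); nra.
Qed.

Lemma le_normr_Rintegral_dominated d (T : measurableType d)
    (P : {measure set T -> \bar R}) (f g : T -> R) :
  measurable_fun setT f -> P.-integrable setT (EFin \o g) ->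
  (forall x, `|f x| <= g x) -> `|\int[P]_x f x| <= \int[P]_x g x.
Proof.
move=> mf gi fg.
have fi := integrable_dominated mf gi fg.
apply: (le_trans (le_normr_Rintegral measurableT fi)).
apply: le_Rintegral => //.
apply: (integrable_dominated (g := g)) => //.
- by msolve2.
- by move=> x; rewrite normr_id.
Qed.

Lemma le_normr_Rintegral_bounded d (T : measurableType d)
    (P : probability T R) (f : T -> R) C :
  measurable_fun setT f -> (forall x, `|f x| <= C) -> `|\int[P]_x f x| <= C.
Proof.
move=> mf fC; rewrite -[leRHS](Rintegral_prob_cst P).
apply: le_normr_Rintegral_dominated => //.
by apply: (@integrable_bounded _ _ _ P _ `|C|).
Qed.

Lemma Rintegral_between d (T : measurableType d) (P : probability T R)
    (f : T -> R) a b : measurable_fun setT f -> (forall x, a <= f x <= b) ->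
  a <= \int[P]_x f x <= b.
Proof.
move=> mf fab.
have ci c : P.-integrable setT (EFin \o (fun _ : T => c)).
  by apply: (@integrable_bounded _ _ _ P _ `|c|).
have fi : P.-integrable setT (EFin \o f).
  apply: (@integrable_bounded _ _ _ P _ (`|a| + `|b|)) => // x.
  have /andP[af fb] := fab x; rewrite ler_norml.
  have := ler_norm b; have := ler_norm (- a); rewrite normrN.
  by have := normr_ge0 a; have := normr_ge0 b; lra.
apply/andP; split.
- rewrite -[leLHS](Rintegral_prob_cst P); apply: le_Rintegral => // x _.
  by have /andP[] := fab x.
- rewrite -[leRHS](Rintegral_prob_cst P); apply: le_Rintegral => // x _.
  by have /andP[] := fab x.
Qed.

Lemma Rintegral_sum d (T : measurableType d) (P : {measure set T -> \bar R})
    (I : Type) (r : seq I) (f : I -> T -> R) :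
  (forall i, P.-integrable setT (EFin \o f i)) ->
  P.-integrable setT (fun x => (\sum_(i <- r) f i x)%:E) /\
  \int[P]_x (\sum_(i <- r) f i x) = \sum_(i <- r) \int[P]_x f i x.
Proof.
move=> fi; elim: r => [|i r [IH1 IH2]].
  rewrite big_nil; split; last first.
    by under eq_Rintegral do rewrite big_nil; rewrite /Rintegral integral0.
  by under eq_fun do rewrite big_nil; exact: integrable0.
split; last first.
  by under eq_Rintegral do rewrite big_cons; rewrite RintegralD// IH2 big_cons.
under eq_fun do rewrite big_cons.
exact: (integrableD measurableT (fi i) IH1).
Qed.

End RealBounds.

(** * The heat flow *)

Section Heat.
Context {R : realType}.

Lemma Rgauss_shift n (u : n.-tuple R) (f : n.-tuple R -> R) :
  measurable_fun setT f ->
  \int[gauss n]_x f (lc 1 1 x u) =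
  \int[gauss n]_x (f x * expR (2 * pi * dot u x - pi * sqnorm u)).
Proof.
move=> mf; congr fine; rewrite integralE [RHS]integralE.
have mF : measurable_fun setT (EFin \o f) by exact/measurable_EFinP.
have pE (a b : R) : 0 <= b -> maxe (a%:E * b%:E)%E 0%E = (maxe a%:E 0 * b%:E)%E.
  by move=> b0; rewrite maxe_pMl ?lee_fin// mul0e.
congr (_ - _)%E.
- transitivity (\int[gauss n]_x (EFin \o f)^\+ (lc 1 1 x u)%R)%E.
    by apply: eq_integral => x _; rewrite !funeposE.
  rewrite gauss_shift//; last exact: measurable_funepos.
  apply: eq_integral => x _; rewrite !funeposE EFinM.
  by rewrite pE// expR_ge0.
- transitivity (\int[gauss n]_x (EFin \o f)^\- (lc 1 1 x u)%R)%E.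
    by apply: eq_integral => x _; rewrite !funenegE.
  rewrite gauss_shift//; last exact: measurable_funeneg.
  apply: eq_integral => x _; rewrite !funenegE EFinM -mulNe -EFinN.
  by rewrite pE// expR_ge0.
Qed.

Lemma integrable_gauss_shift n (u : n.-tuple R) (f : n.-tuple R -> R) :
  measurable_fun setT f ->
  (gauss n).-integrable setT (fun x => (f (lc 1 1 x u))%:E) ->
  (gauss n).-integrable setT
    (fun x => (f x * expR (2 * pi * dot u x - pi * sqnorm u))%:E).
Proof.
move=> mf /integrableP[_ fi]; apply/integrableP; split.
  by msolve2.
move: fi; rewrite (@gauss_shift _ _ u (fun x => `|(f x)%:E|%E))//; last by apply: measurableT_comp => //; msolve2.
congr (_ < _)%E; apply: eq_integral => x _.
by rewrite EFinM abseM [X in _ = (_ * X)%E]gee0_abs// lee_fin expR_ge0.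
Qed.

Definition heat n (H : n.-tuple R -> R) (c : R) (x : n.-tuple R) : R :=
  \int[gauss n]_z H (lc 1 c x z).

(* The gradient of [heat H c], by Gaussian integration by parts. *)
Definition hgrad n (H : n.-tuple R -> R) (c : R) (x : n.-tuple R) : n.-tuple R :=
  [tuple 2 * pi / c * \int[gauss n]_z (H (lc 1 c x z) * tnth z i) | i < n].

Section HeatBounded.
Context n (H : n.-tuple R -> R) (K : R).
Hypotheses (mH : measurable_fun setT H) (HK : forall x, `|H x| <= K).

Let K0 : 0 <= K.
Proof. exact: le_trans (normr_ge0 _) (HK [tuple 0 | i < n]). Qed.

Lemma measurable_heat c : measurable_fun setT (heat H c).
Proof. by rewrite /heat; msolve2. Qed.

Lemma integrable_heat_dot c x y :
  (gauss n).-integrable setT (fun z => (H (lc 1 c x z) * dot y z)%:E).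
Proof.
apply: (@integrable_dominated _ _ _ (gauss n) (fun z => H (lc 1 c x z) * dot y z)
  (fun z => K * ((1 + sqnorm y) * (1 + sqnorm z) ^+ 1))).
- by msolve2.
- exact: (integrableZl measurableT K (integrableZl measurableT (1 + sqnorm y) (integrable_gauss_poly n 1))).
- by move=> z; rewrite normrM ler_pM// expr1 dot_leW.
Qed.

Lemma hgrad_dot c x y :
  dot (hgrad H c x) y = 2 * pi / c * \int[gauss n]_z (H (lc 1 c x z) * dot y z).
Proof.
have e i z : dot [tuple (i == j)%:R | j < n] z = tnth z i.
  rewrite /dot (bigD1 i)//= tnth_mktuple eqxx mul1r big1 ?addr0// => j ji.
  by rewrite tnth_mktuple eq_sym (negbTE ji) mul0r.
have ii i : (gauss n).-integrable setT (fun z => (H (lc 1 c x z) * tnth z i)%:E).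
  by have := integrable_heat_dot c x [tuple (i == j)%:R | j < n]; under eq_fun do rewrite e.
transitivity (2 * pi / c * \sum_(i < n) \int[gauss n]_z (tnth y i * (H (lc 1 c x z) * tnth z i))).
  rewrite /dot mulr_sumr; apply: eq_bigr => i _.
  rewrite tnth_mktuple RintegralZl//; last exact: ii.
  by rewrite [tnth y i * _]mulrC mulrA.
congr (_ * _).
have [_] := @Rintegral_sum _ _ _ (gauss n) _ (index_enum 'I_n)
  (fun i z => tnth y i * (H (lc 1 c x z) * tnth z i)) (fun i => integrableZl measurableT _ (ii i)).
move=> /= <-; apply: eq_Rintegral => z _; rewrite /dot mulr_sumr.
by apply: eq_bigr => i _; rewrite mulrCA.
Qed.


(** Independent noises of sizes s and c add up to a noise of size c'. *)
Lemma heat_semigroup s c c' x : s ^+ 2 + c ^+ 2 = c' ^+ 2 ->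
  \int[gauss n]_y heat H c (lc 1 s x y) = heat H c' x.
Proof.
move=> scc'; rewrite /heat.
have mf : measurable_fun setT (fun w => H (lc 1 1 x w)) by msolve2.
have := Rgauss_conv scc' mf.
have -> : \int[gauss n]_w H (lc 1 1 x (scale c' w)) = \int[gauss n]_z H (lc 1 c' x z).
  apply: eq_Rintegral => z _; congr H; apply: eq_from_tnth => i.
  by rewrite !tnth_lc tnth_scale; ring.
move=> <-; rewrite Rfubini1/=; last first.
  by apply: (@integrable_bounded_prod _ _ _ _ _ (gauss n) (gauss n) _ K) => //; msolve2.
apply: eq_Rintegral => y _; apply: eq_Rintegral => z _; congr H.
by apply: eq_from_tnth => i; rewrite !tnth_lc; ring.
Qed.

(** With U = s^2 |y|^2 / c^2 the Taylor remainder integrates to at most K times 8 pi^2 [gauss_var] U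
    + pi U + 2 pi^2 U^2; then c^2 >= delta and s <= 1 give the two quotients. *)
Definition taylor_const (delta : R) : R :=
  (8 * pi ^+ 2 * gauss_var + pi) / delta + 2 * pi ^+ 2 / delta ^+ 2.

(** [H] need not be continuous. With u = (s / c) y the displacement s y becomes the density exp(t z)
    of the noise, and the function expanded is the exponential: its first-order term produces
    [hgrad], and [expR_taylor1] bounds the rest. *)
Lemma heat_taylor (delta c s : R) x y :
  0 < delta -> delta <= c ^+ 2 -> 0 < c -> 0 <= s <= 1 ->
  `|heat H c (lc 1 s x y) - heat H c x - s * dot (hgrad H c x) y| <=
  K * (taylor_const delta * s ^+ 2 * (1 + sqnorm y) ^+ 2).
Proof.
move=> d0 dc c0 /andP[s0 s1].
have c00 : c != 0 by rewrite gt_eqF.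
pose u := scale (s / c) y.
have udot z : dot u z = s / c * dot y z.
  by rewrite /dot mulr_sumr; apply: eq_bigr => i _; rewrite tnth_scale mulrA.
have um : sqnorm u = (s / c) ^+ 2 * sqnorm y.
  by rewrite /sqnorm mulr_sumr; apply: eq_bigr => i _; rewrite tnth_scale exprMn.
pose t z := 2 * pi * dot u z - pi * sqnorm u.
pose h z := H (lc 1 c x z).
have mh : measurable_fun setT h by rewrite /h; msolve2.
have hK z : `|h z| <= K by exact: HK.
have E1 : heat H c (lc 1 s x y) = \int[gauss n]_z (h z * expR (t z)).
  rewrite -Rgauss_shift//; apply: eq_Rintegral => z _; congr H.
  apply: eq_from_tnth => i; rewrite !tnth_lc tnth_scale; field.
  exact: c00.
have E2 : s * dot (hgrad H c x) y = \int[gauss n]_z (h z * (2 * pi * dot u z)).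
  rewrite hgrad_dot.
  transitivity (\int[gauss n]_z (2 * pi * (s / c) * (h z * dot y z))).
    by rewrite RintegralZl//; [ring|exact: integrable_heat_dot].
  by apply: eq_Rintegral => z _; rewrite udot; ring.
have ihc : (gauss n).-integrable setT (EFin \o h).
  exact: (@integrable_bounded _ _ _ (gauss n) _ K).
have iexp : (gauss n).-integrable setT (fun z => (h z * expR (t z))%:E).
  apply: integrable_gauss_shift => //.
  apply: (@integrable_bounded _ _ _ (gauss n) (fun z => h (lc 1 1 z u)) K) => //.
  by msolve2.
have idot : (gauss n).-integrable setT (fun z => (h z * (2 * pi * dot u z))%:E).
  have := integrableZl measurableT (2 * pi * (s / c)) (integrable_heat_dot c x y).
  by congr (_.-integrable _ _); apply/funext => z; rewrite -EFinM udot; congr (_%:E); rewrite /h; ring.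
have ib : (gauss n).-integrable setT (fun z => (h z * expR (t z) - h z)%:E).
  exact: (integrableB measurableT iexp ihc).
rewrite E1 E2 /heat -/h -(RintegralB measurableT iexp ihc) -(RintegralB measurableT ib idot).
pose a z := (2 * pi * dot u z) ^+ 2.
pose g z := K * (t z ^+ 2 + t z ^+ 2 * expR (t z) + pi * sqnorm u).
have t2 z : t (lc 1 1 z u) = 2 * pi * dot u z + pi * sqnorm u.
  by rewrite /t dot_lcr -sqnormE; ring.
have mt : measurable_fun setT t by rewrite /t; msolve2.
have it2p (e : R) : (gauss n).-integrable setT (fun z => ((2 * pi * dot u z + e * (pi * sqnorm u)) ^+ 2)%:E).
  set b := e * _.
  apply: (@integrable_dominated _ _ _ (gauss n) _
    (fun z => 2 * (2 * pi) ^+ 2 * dot u z ^+ 2 + 2 * b ^+ 2)).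
  - by msolve2.
  - have i1 := integrableZl measurableT (2 * (2 * pi) ^+ 2) (integrable_dot u 2).
    have i2 : (gauss n).-integrable setT (fun z : n.-tuple R => (2 * b ^+ 2)%:E).
      exact: (@integrable_bounded _ _ _ (gauss n) _ `|2 * b ^+ 2|).
    exact: (integrableD measurableT i1 i2).
  - move=> z; rewrite ger0_norm ?sqr_ge0//.
    have -> : 2 * (2 * pi) ^+ 2 * dot u z ^+ 2 = 2 * (2 * pi * dot u z) ^+ 2 by ring.
    by have := sqr_ge0 (2 * pi * dot u z - b); nra.
have it2 : (gauss n).-integrable setT (fun z => (t z ^+ 2)%:E).
  by have := it2p (-1); under eq_fun do rewrite mulN1r.
have it2e : (gauss n).-integrable setT (fun z => (t z ^+ 2 * expR (t z))%:E).
  apply: (@integrable_gauss_shift _ _ (fun z => t z ^+ 2)); first by msolve2.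
  by have := it2p 1; under eq_fun do rewrite mul1r -t2.
have ic r : (gauss n).-integrable setT (fun z : n.-tuple R => r%:E).
  exact: (@integrable_bounded _ _ _ (gauss n) _ `|r|).
have isum : (gauss n).-integrable setT (fun z => (t z ^+ 2 + t z ^+ 2 * expR (t z))%:E).
  exact: (integrableD measurableT it2 it2e).
have isum3 : (gauss n).-integrable setT (fun z => (t z ^+ 2 + t z ^+ 2 * expR (t z) + pi * sqnorm u)%:E).
  exact: (integrableD measurableT isum (ic _)).
apply: (@le_trans _ _ (\int[gauss n]_z g z)).
  apply: le_normr_Rintegral_dominated.
  - by msolve2.
  - exact: (integrableZl measurableT _ isum3).
  - move=> z; rewrite /g.
    have -> : h z * expR (t z) - h z - h z * (2 * pi * dot u z) =
      h z * ((expR (t z) - 1 - t z) - pi * sqnorm u) by rewrite /t; ring.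
    rewrite normrM ler_pM//.
    apply: (le_trans (ler_normB _ _)); apply: lerD.
      by apply: (le_trans (expR_taylor1 _)); rewrite mulrDr mulr1.
    by rewrite ger0_norm// mulr_ge0 ?pi_ge0// sqnorm_ge0.
rewrite /g RintegralZl//; apply: ler_wpM2l => //.
have -> := RintegralD measurableT isum (ic (pi * sqnorm u)).
have -> := RintegralD measurableT it2 it2e.
rewrite Rintegral_prob_cst.
(* Undoing the translation removes exp t and flips the sign of the constant in t, so that the cross
   terms of the two squares cancel below. *)
have -> : \int[gauss n]_z (t z ^+ 2 * expR (t z)) = \int[gauss n]_z (2 * pi * dot u z + pi * sqnorm u) ^+ 2.
  rewrite -(@Rgauss_shift _ u (fun z => t z ^+ 2)); last by msolve2.
  by apply: eq_Rintegral => z _; rewrite t2.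
have it2' : (gauss n).-integrable setT (fun z => ((2 * pi * dot u z + pi * sqnorm u) ^+ 2)%:E).
  by have := it2p 1; under eq_fun do rewrite mul1r.
rewrite -RintegralD//.
have -> : \int[gauss n]_z (t z ^+ 2 + (2 * pi * dot u z + pi * sqnorm u) ^+ 2) =
    8 * pi ^+ 2 * gauss_var * sqnorm u + 2 * pi ^+ 2 * sqnorm u ^+ 2.
  transitivity (\int[gauss n]_z (8 * pi ^+ 2 * dot u z ^+ 2 + 2 * pi ^+ 2 * sqnorm u ^+ 2)).
    by apply: eq_Rintegral => z _; rewrite /t; ring.
  have j1 : (gauss n).-integrable setT (EFin \o (fun z => 8 * pi ^+ 2 * dot u z ^+ 2)).
    exact: (integrableZl measurableT _ (integrable_dot u 2)).
  have -> := RintegralD measurableT j1 (ic (2 * pi ^+ 2 * sqnorm u ^+ 2)).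
  rewrite RintegralZl//; last exact: integrable_dot.
  by rewrite gauss_dot_var Rintegral_prob_cst; ring.
have m0 := sqnorm_ge0 y; set m := sqnorm y in um m0 *.
have um0 := sqnorm_ge0 u; set U := sqnorm u in um um0 *.
have UB : U <= s ^+ 2 * (m / delta).
  have -> : U = s ^+ 2 * (m / c ^+ 2) by rewrite um expr_div_n mulrAC mulrA.
  apply: ler_wpM2l; first exact: sqr_ge0.
  by apply: ler_wpM2l => //; rewrite lef_pV2// posrE exprn_gt0.
have pi0 : 0 < (pi : R) := pi_gt0 R.
have v0 : 0 <= (gauss_var : R) by apply: Rintegral_ge0 => x' _; exact: sqr_ge0.
have md0 : 0 <= m / delta by rewrite divr_ge0// ltW.
have s20 := sqr_ge0 s; have s21 : s ^+ 2 <= 1 by rewrite expr_le1.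
have U2B : U ^+ 2 <= s ^+ 2 * (m / delta) ^+ 2.
  apply: (@le_trans _ _ ((s ^+ 2 * (m / delta)) ^+ 2)).
    by rewrite lerXn2r// nnegrE mulr_ge0.
  by rewrite exprMn ler_wpM2r ?sqr_ge0// expr2 ler_piMr.
set A := 8 * pi ^+ 2 * gauss_var; set B := 2 * pi ^+ 2.
have pi20 : 0 <= (pi : R) ^+ 2 := sqr_ge0 _.
have A0 : 0 <= A by apply: mulr_ge0 => //; apply: mulr_ge0.
have B0 : 0 <= B by apply: mulr_ge0.
have -> : taylor_const delta * s ^+ 2 * (1 + m) ^+ 2 =
   (A + pi) * (s ^+ 2 * ((1 + m) ^+ 2 / delta)) + B * (s ^+ 2 * ((1 + m) ^+ 2 / delta ^+ 2)).
  by rewrite /taylor_const -/A -/B; ring.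
have -> : A * U + B * U ^+ 2 + pi * U = (A + pi) * U + B * U ^+ 2 by ring.
have dV0 : 0 <= delta^-1 by rewrite invr_ge0 ltW.
apply: lerD; apply: ler_wpM2l => //.
- by rewrite addr_ge0// ltW.
- apply: (le_trans UB); apply: ler_wpM2l => //; apply: ler_wpM2r => //.
  by have := sqr_ge0 m; nra.
- apply: (le_trans U2B); apply: ler_wpM2l => //; rewrite expr_div_n.
  apply: ler_wpM2r; first by rewrite invr_ge0 sqr_ge0.
  by nra.
Qed.

End HeatBounded.
End Heat.

(** * Entropy increments along the interpolation *)

Section EntropyFunction.
Context {R : realType}.

Definition xlnx (x : R) : R := x * ln x.

(** The difference of the two sides has derivative (x - 1)^3 / x, which has the sign of x - 1, and
    it vanishes at 1, its minimum. A Taylor polynomial of odd order thus bounds ln on the whole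
    half-line. *)
Lemma ln_le_cubic (y : R) : 0 < y ->
  ln y <= (y - 1) - (y - 1) ^+ 2 / 2 + (y - 1) ^+ 3 / 3.
Proof.
move=> y0.
pose F (x : R) : R := (x - 1) - (x - 1) ^+ 2 / 2 + (x - 1) ^+ 3 / 3 - ln x.
pose dF (x : R) : R := (x - 1) ^+ 3 / x.
have dFE (x : R) : 0 < x -> is_derive x 1 F (dF x).
  move=> x0; have dln := is_derive1_ln x0.
  apply: is_derive_eq; rewrite /dF /GRing.scale/=.
  by field; rewrite gt_eqF.
have F1 : F 1 = 0 by rewrite /F subrr ln1 !expr0n/= !mul0r; ring.
suff : 0 <= F y - F 1 by rewrite F1 /F; lra.
have cF a b : 0 < a -> {within `[a, b], continuous F}.
  move=> a0; apply: derivable_within_continuous => x; rewrite in_itv/= => /andP[ax _].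
  by have [] := dFE x (lt_le_trans a0 ax).
have [y1|y1|->] := ltgtP y 1.
- have dy x : x \in `]y, 1[ -> is_derive x 1 F (dF x).
    by rewrite in_itv/= => /andP[yx _]; apply: dFE; exact: lt_trans yx.
  have [c] := MVT y1 dy (cF _ _ y0).
  rewrite in_itv/= => /andP[yc c1] E.
  have c0 : 0 < c by exact: lt_trans yc.
  have -> : F y - F 1 = (1 - c) ^+ 3 / c * (1 - y).
    by rewrite -opprB E /dF; ring.
  by rewrite mulr_ge0 ?subr_ge0 ?(ltW y1)// divr_ge0 ?(ltW c0)// exprn_ge0// subr_ge0 ltW.
- have dy x : x \in `]1, y[ -> is_derive x 1 F (dF x).
    by rewrite in_itv/= => /andP[yx _]; apply: dFE; exact: lt_trans yx.
  have [c] := MVT y1 dy (cF _ _ ltr01).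
  rewrite in_itv/= => /andP[c1 yc] E.
  have c0 : 0 < c by exact: lt_trans c1.
  rewrite E /dF mulr_ge0 ?subr_ge0 ?(ltW y1)// divr_ge0 ?(ltW c0)//.
  by rewrite exprn_ge0// subr_ge0 ltW.
- by rewrite subrr.
Qed.

(** [ln_le_cubic] at a / b bounds the remainder from above; at b / a, where the logarithm changes
    sign, it bounds it from below. *)
Lemma xlnx_taylor (eps K a b : R) : 0 < eps -> eps <= a <= K -> eps <= b <= K ->
  `|xlnx a - xlnx b - (1 + ln b) * (a - b) - (a - b) ^+ 2 / (2 * b)| <=
  K ^+ 2 / eps ^+ 4 * `|a - b| ^+ 3.
Proof.
move=> e0 /andP[ea aK] /andP[eb bK].
have a0 : 0 < a by lra.
have b0 : 0 < b by lra.
have K0 : 0 < K by lra.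
have an : a != 0 by rewrite gt_eqF.
have bn : b != 0 by rewrite gt_eqF.
have lnab : ln a = ln b + ln (a / b).
  by rewrite lnM ?posrE ?invr_gt0// lnV ?posrE//; ring.
have E : xlnx a - xlnx b - (1 + ln b) * (a - b) = a * ln (a / b) - (a - b).
  by rewrite /xlnx lnab; ring.
have up := ln_le_cubic (divr_gt0 a0 b0).
have lo := ln_le_cubic (divr_gt0 b0 a0).
have lnba : ln (b / a) = - ln (a / b).
  by rewrite !lnM ?posrE ?invr_gt0// !lnV ?posrE//; ring.
rewrite lnba in lo.
pose d := a - b.
have upE : a * ln (a / b) - (a - b) - (a - b) ^+ 2 / (2 * b) <=
    (- d ^+ 3 / 6 + d ^+ 4 / (3 * b)) / b ^+ 2.
  have /(ler_wpM2l (ltW a0)) := up.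
  have -> : a * (a / b - 1 - (a / b - 1) ^+ 2 / 2 + (a / b - 1) ^+ 3 / 3) =
    (a - b) + (a - b) ^+ 2 / (2 * b) + (- d ^+ 3 / 6 + d ^+ 4 / (3 * b)) / b ^+ 2.
    by rewrite /d; field.
  lra.
have loE : (- d ^+ 3 / 2 + d ^+ 3 * b / (3 * a)) / (b * a) <=
  a * ln (a / b) - (a - b) - (a - b) ^+ 2 / (2 * b).
  have /(ler_wpM2l (ltW a0)) := lo.
  have -> : a * (b / a - 1 - (b / a - 1) ^+ 2 / 2 + (b / a - 1) ^+ 3 / 3) =
    - ((a - b) + (a - b) ^+ 2 / (2 * b) + (- d ^+ 3 / 2 + d ^+ 3 * b / (3 * a)) / (b * a)).
    by rewrite /d; field; rewrite an bn.
  lra.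
rewrite E; set X := _ - _ - _ in upE loE *.
(* L bounds the ratios b / a and |a - b| / b. Since L >= 1, both 1/2 + L/3 and 1/6 + L/3 are at most
   L^2, and L^2 / eps^2 is the announced K^2 / eps^4. *)
pose L := K / eps.
have L1 : 1 <= L by rewrite /L ler_pdivlMr// mul1r; lra.
have D0 := normr_ge0 d; set D := `|d| in D0.
have D30 : 0 <= D ^+ 3 by rewrite exprn_ge0.
have d3 : `|d ^+ 3| <= D ^+ 3 by rewrite normrX.
have d4 : d ^+ 4 = D ^+ 3 * D.
  by rewrite -exprSr /D -normrX ger0_norm// (_ : 4 = 2 * 2)%N// exprM sqr_ge0.
have DK : D <= K by rewrite /D /d ler_norml; apply/andP; split; lra.
have le_ratio (x y : R) : 0 <= x <= K -> eps <= y -> x / y <= L.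
  move=> /andP[x0 xK] ey; apply: ler_pM => //; first by rewrite invr_ge0; lra.
  by rewrite lef_pV2// posrE; lra.
have den (u v g : R) : 0 <= g -> g <= L ^+ 2 -> eps <= u -> eps <= v ->
    forall nu, nu <= D ^+ 3 * g -> nu / (u * v) <= K ^+ 2 / eps ^+ 4 * D ^+ 3.
  move=> g0 gL eu ev nu nug.
  have -> : K ^+ 2 / eps ^+ 4 * D ^+ 3 = (D ^+ 3 * L ^+ 2) / (eps * eps).
    by rewrite /L; field; rewrite gt_eqF.
  have uv0 : 0 < (u * v)^-1 by rewrite invr_gt0 mulr_gt0//; lra.
  apply: (@le_trans _ _ ((D ^+ 3 * L ^+ 2) / (u * v))).
    by rewrite ler_pM2r// (le_trans nug)// ler_wpM2l.
  apply: ler_wpM2l; first by rewrite mulr_ge0// sqr_ge0.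
  rewrite lef_pV2 ?posrE ?mulr_gt0//; try lra.
  by apply: ler_pM => //; lra.
rewrite ler_norml; apply/andP; split.
- rewrite lerNl; apply: (@le_trans _ _ ((d ^+ 3 / 2 - d ^+ 3 * b / (3 * a)) / (b * a))).
    rewrite lerNl; apply: le_trans loE.
    by rewrite -mulNr; apply: ler_wpM2r; [rewrite invr_ge0 mulr_ge0 ?ltW|lra].
  apply: (den _ _ (1 / 2 + L / 3)) => //; [lra|nra|].
  have : b / a <= L by apply: le_ratio => //; lra.
  have ba0 : 0 <= b / a by rewrite divr_ge0 ?ltW.
  have -> : d ^+ 3 / 2 - d ^+ 3 * b / (3 * a) = d ^+ 3 * (1 / 2 - (b / a) / 3).
    by field.
  move=> baL; apply: (le_trans (ler_norm _)); rewrite normrM.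
  by apply: ler_pM => //; rewrite ler_norml; apply/andP; split; lra.
- apply: (le_trans upE); rewrite expr2.
  apply: (den _ _ (1 / 6 + L / 3)) => //; [lra|nra|].
  have : D / b <= L by apply: le_ratio => //; rewrite D0.
  have -> : - d ^+ 3 / 6 + d ^+ 4 / (3 * b) = - d ^+ 3 / 6 + D ^+ 3 * ((D / b) / 3).
    by rewrite d4; field.
  move=> DbL; rewrite mulrDr; apply: lerD.
    by move: d3; rewrite ler_norml => /andP[]; lra.
  by apply: ler_wpM2l => //; lra.
Qed.

(** Cauchy-Schwarz by duality: I^2 / B = 2 t I - t^2 B for t = I / B, while 2 t e - t^2 b <= e^2 / b
    holds pointwise for every t. *)
Lemma sqr_Rintegral_div_le d (T : measurableType d) (P : probability T R)
    (e b : T -> R) (eps K : R) :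
  measurable_fun setT e -> measurable_fun setT b ->
  0 < eps -> 0 <= K -> (forall x, eps <= b x <= K) -> (forall x, `|e x| <= K) ->
  (\int[P]_x e x) ^+ 2 / \int[P]_x b x <= \int[P]_x (e x ^+ 2 / b x).
Proof.
move=> me mb e0 K0 bb ee.
have b0 x : 0 < b x by have /andP[h _] := bb x; exact: lt_le_trans h.
have mbV := measurable_fun_inv mb b0.
have ie : P.-integrable setT (EFin \o e) by exact: (@integrable_bounded _ _ _ P _ K).
have ib : P.-integrable setT (EFin \o b).
  apply: (@integrable_bounded _ _ _ P _ K) => // x; rewrite gtr0_norm//.
  by have /andP[] := bb x.
have iq : P.-integrable setT (EFin \o (fun x => e x ^+ 2 / b x)).
  apply: (@integrable_bounded _ _ _ P _ (K ^+ 2 / eps)); first by msolve2.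
  move=> x; rewrite normrM normrX [`|(b x)^-1|]ger0_norm ?invr_ge0 ?(ltW (b0 _))//.
  apply: ler_pM => //; rewrite ?exprn_ge0 ?invr_ge0 ?(ltW (b0 _))//.
    by rewrite lerXn2r// nnegrE.
  by rewrite lef_pV2 ?posrE//; have /andP[] := bb x.
have /andP[Be _] : eps <= \int[P]_x b x <= K by exact: Rintegral_between.
set B := \int[P]_x b x in Be *; set I := \int[P]_x e x.
have B0 : 0 < B by exact: lt_le_trans Be.
pose t := I / B.
have -> : I ^+ 2 / B = 2 * t * I - t ^+ 2 * B by rewrite /t; field; rewrite gt_eqF.
have i1 : P.-integrable setT (EFin \o (fun x => 2 * t * e x)).
  exact: (integrableZl measurableT _ ie).
have i2 : P.-integrable setT (EFin \o (fun x => t ^+ 2 * b x)).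
  exact: (integrableZl measurableT _ ib).
rewrite /I /B -!RintegralZl// -(RintegralB measurableT i1 i2).
apply: le_Rintegral => //; first exact: (integrableB measurableT i1 i2).
move=> x _; rewrite ler_pdivlMr//.
by have := sqr_ge0 (e x - t * b x); nra.
Qed.

End EntropyFunction.

Section QuadraticReplacement.
Context {R : realType}.

(** The first summand pays for replacing an increment by its linear part in the quadratic term, the
    second for the cubic remainder of [xlnx_taylor]. *)
Definition step_const (eps K A B : R) : R :=
  A * (2 * B + A) / (2 * eps) + K ^+ 2 / eps ^+ 4 * (A + B) ^+ 3.

(** [e] is the true increment and [s * l] its linear part. The difference of their squares factors
    into a term of order s^2 and one of order s; since V >= 1, all powers of V can be raised to
    V^3. *)
Lemma quadratic_replacement (eps A B s V e l b : R) :
  0 < eps -> 0 <= A -> 0 <= B -> 0 <= s <= 1 -> 1 <= V -> eps <= b ->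
  `|e - s * l| <= A * s ^+ 2 * V -> `|l| <= B * V ->
  [/\ `|e ^+ 2 / (2 * b) - s ^+ 2 * (l ^+ 2 / (2 * b))| <=
        A * (2 * B + A) / (2 * eps) * s ^+ 3 * V ^+ 3,
      `|e| <= (A + B) * s * V &
      `|e| ^+ 3 <= (A + B) ^+ 3 * s ^+ 3 * V ^+ 3].
Proof.
move=> e0 A0 B0 /andP[s0 s1] V1 eb h1 h2.
have V0 : 0 <= V by lra.
have s2 : s ^+ 2 <= s by rewrite expr2 ler_piMr.
have AsV : A * s ^+ 2 * V <= A * s * V.
  by rewrite ler_wpM2r// ler_wpM2l.
have sl : `|s * l| <= B * s * V.
  by rewrite normrM ger0_norm// [B * s]mulrC -mulrA ler_wpM2l.
have he : `|e| <= (A + B) * s * V.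
  have := ler_normD (e - s * l) (s * l); rewrite subrK => /le_trans; apply.
  by move: (lerD h1 sl); lra.
split => //; last first.
  rewrite -!exprMn lerXn2r// ?nnegrE.
  by rewrite mulr_ge0// mulr_ge0// addr_ge0.
have -> : e ^+ 2 / (2 * b) - s ^+ 2 * (l ^+ 2 / (2 * b)) =
    (e - s * l) * (e - s * l + 2 * (s * l)) / (2 * b) by ring.
have b0 : 0 < b by lra.
rewrite normrM [`|(2 * b)^-1|]ger0_norm; last by rewrite invr_ge0 mulr_ge0// ltW.
have -> : A * (2 * B + A) / (2 * eps) * s ^+ 3 * V ^+ 3 =
  (A * s ^+ 2 * V) * ((2 * B + A) * s * V) * V / (2 * eps) by ring.
apply: ler_pM => //.
- by rewrite invr_ge0 mulr_ge0// ltW.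
- apply: (@le_trans _ _ (A * s ^+ 2 * V * ((2 * B + A) * s * V))); last first.
    rewrite ler_peMr// mulr_ge0// ?mulr_ge0 ?exprn_ge0//.
    by rewrite addr_ge0// mulr_ge0.
  rewrite normrM; apply: ler_pM => //.
  apply: (le_trans (ler_normD _ _)); rewrite normrM [`|2|]ger0_norm//.
  by move: (le_trans h1 AsV) sl; lra.
- by rewrite lef_pV2 ?posrE ?mulr_gt0// ler_pM2l.
Qed.

(** The term linear in a - b stays next to [xlnx]: it is centred with respect to the noise and
    disappears on integration. *)
Lemma xlnx_step (eps K A B s V a b l : R) :
  0 < eps -> 0 <= A -> 0 <= B -> 0 <= s <= 1 -> 1 <= V ->
  eps <= a <= K -> eps <= b <= K ->
  `|a - b - s * l| <= A * s ^+ 2 * V -> `|l| <= B * V ->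
  s ^+ 2 * (l ^+ 2 / (2 * b)) - step_const eps K A B * s ^+ 3 * V ^+ 3 <=
  xlnx a - xlnx b - (1 + ln b) * (a - b).
Proof.
move=> e0 A0 B0 s01 V1 ha hb h1 h2.
have eb : eps <= b by case/andP: hb.
have [q1 _ q3] := quadratic_replacement e0 A0 B0 s01 V1 eb h1 h2.
have t1 := xlnx_taylor e0 ha hb.
have C0 : 0 <= K ^+ 2 / eps ^+ 4 by rewrite divr_ge0 ?exprn_ge0//; [case/andP: ha => ? ?; lra|lra].
have q4 := ler_wpM2l C0 q3.
move: t1 q1; rewrite !ler_norml /step_const => /andP[t1 _] /andP[q1 _].
lra.
Qed.

End QuadraticReplacement.

Section Increment.
Context {R : realType} (n : nat) (H : n.-tuple R -> R) (eps K delta : R).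
Hypotheses (mH : measurable_fun setT H) (e0 : 0 < eps)
  (HeK : forall x, eps <= H x <= K) (d0 : 0 < delta).
Variables (c c' s t : R).
Hypotheses (c0 : 0 < c) (c1 : c <= 1) (dc : delta <= c ^+ 2)
  (s01 : 0 <= s <= 1) (scc' : s ^+ 2 + c ^+ 2 = c' ^+ 2).

(** One polynomial that dominates both the linear forms and the Taylor remainder, and whose powers
    are all Gaussian integrable. *)
Definition weight m (z : m.-tuple R) : R := (1 + sqnorm z) ^+ 2.

Definition weight_mean m : R := \int[gauss m]_z weight z.

Lemma weight_ge1 m (z : m.-tuple R) : 1 <= weight z.
Proof. by rewrite /weight exprn_ege1// lerDl sqnorm_ge0. Qed.

Lemma integrable_weightX m q : (gauss m).-integrable setT (fun z => (weight z ^+ q)%:E).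
Proof.
by rewrite /weight; under eq_fun do rewrite -exprM; exact: integrable_gauss_poly.
Qed.

Lemma measurable_fun_weight d (T : measurableType d) m (f : T -> m.-tuple R) :
  measurable_fun setT f -> measurable_fun setT (fun x => weight (f x)).
Proof. by move=> mf; rewrite /weight; msolve2. Qed.

Lemma weight_mean_ge0 m : 0 <= weight_mean m.
Proof. by apply: Rintegral_ge0 => z _; exact: le_trans ler01 (weight_ge1 z). Qed.

Lemma HK_norm x : `|H x| <= K.
Proof. by have /andP[h1 h2] := HeK x; rewrite ger0_norm// (le_trans (ltW e0)). Qed.

Lemma K_gt0 : 0 < K.
Proof. by have /andP[h1 h2] := HeK [tuple 0 | i < n]; exact: lt_le_trans (le_trans h1 h2). Qed.

Lemma heat_between r x : eps <= heat H r x <= K.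
Proof. by apply: Rintegral_between => //; msolve2. Qed.

Lemma heat_norm r x : `|heat H r x| <= K.
Proof.
have /andP[h1 h2] := heat_between r x.
by rewrite ger0_norm// (le_trans (ltW e0)).
Qed.

(** The 1 accounts for the Taylor remainder at y and [weight_mean] for its average over y, which
    enters when [heat H c] is replaced by its mean [heat H c']. *)
Definition incr_const1 : R := K * taylor_const delta * (1 + weight_mean n).
Definition incr_const2 : R := 2 * pi / delta * K * \int[gauss n]_z (1 + sqnorm z).

Lemma taylor_const_ge0 : 0 <= taylor_const delta.
Proof.
have pi0 : 0 < (pi : R) := pi_gt0 R.
have v0 : 0 <= (gauss_var : R) by apply: Rintegral_ge0 => x' _; exact: sqr_ge0.
rewrite /taylor_const addr_ge0// divr_ge0 ?(ltW d0) ?sqr_ge0//.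
- apply: addr_ge0; last exact: ltW.
  by apply: mulr_ge0 => //; apply: mulr_ge0 => //; exact: sqr_ge0.
- by apply: mulr_ge0 => //; exact: sqr_ge0.
Qed.

Lemma incr_const1_ge0 : 0 <= incr_const1.
Proof.
rewrite mulr_ge0 ?addr_ge0 ?weight_mean_ge0// mulr_ge0 ?(ltW K_gt0)//.
exact: taylor_const_ge0.
Qed.

Lemma incr_const2_ge0 : 0 <= incr_const2.
Proof.
rewrite /incr_const2 mulr_ge0//; last first.
  by apply: Rintegral_ge0 => z _; rewrite addr_ge0// sqnorm_ge0.
by rewrite mulr_ge0 ?(ltW K_gt0)// divr_ge0 ?(ltW d0)// mulr_ge0// pi_ge0.
Qed.

(** The factor 1 / c in [hgrad] is at most 1 / delta because delta <= c^2 <= c. *)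
Lemma hgrad_dot_le x y : `|dot (hgrad H c x) y| <= incr_const2 * weight y.
Proof.
rewrite (hgrad_dot mH HK_norm) normrM.
have ipc : 0 <= 2 * pi / c by rewrite divr_ge0 ?(ltW c0)// mulr_ge0// pi_ge0.
have cd : c^-1 <= delta^-1.
  rewrite lef_pV2 ?posrE//; apply: (le_trans dc).
  by rewrite expr2 ler_piMr// ltW.
rewrite ger0_norm// /incr_const2; set m := \int[gauss n]_z (1 + sqnorm z).
have pi0 : 0 <= 2 * (pi : R) by rewrite mulr_ge0// pi_ge0.
have m0 : 0 <= m by apply: Rintegral_ge0 => z _; rewrite addr_ge0// sqnorm_ge0.
have -> : 2 * pi / delta * K * m * weight y = 2 * pi / delta * (K * m * weight y) by ring.
apply: ler_pM => //; first by rewrite ler_wpM2l.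
apply: (@le_trans _ _ (\int[gauss n]_z (K * (1 + sqnorm y) * (1 + sqnorm z)))).
  apply: le_normr_Rintegral_dominated.
  - by msolve2.
  - exact: (integrableZl measurableT _ (integrable_gauss_poly n 1)).
  - move=> z; rewrite normrM -mulrA; apply: ler_pM => //; first exact: HK_norm.
    exact: dot_leW.
rewrite RintegralZl//; last exact: (integrable_gauss_poly n 1).
rewrite mulrAC ler_wpM2l//; first by rewrite mulr_ge0// ltW// K_gt0.
by rewrite /weight expr2 ler_peMr ?addr_ge0 ?sqnorm_ge0// lerDl sqnorm_ge0.
Qed.

(** The base value is [heat H c' x], the exact mean of the displaced values, so that increments are
    centred. It differs from [heat H c x] by an average of Taylor remainders only, the linear term
    having mean zero. *)
Lemma heat_incr x y :
  `|heat H c (lc 1 s x y) - heat H c' x - s * dot (hgrad H c x) y| <=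
  incr_const1 * s ^+ 2 * weight y.
Proof.
have T y' := heat_taylor mH HK_norm x y' d0 dc c0 s01.
pose k := K * taylor_const delta * s ^+ 2.
have k0 : 0 <= k.
  by rewrite mulr_ge0 ?sqr_ge0// mulr_ge0 ?taylor_const_ge0// ltW// K_gt0.
have T' y' : `|heat H c (lc 1 s x y') - heat H c x - s * dot (hgrad H c x) y'| <= k * weight y'.
  by apply: (le_trans (T y')); rewrite /k /weight !mulrA.
have mh : measurable_fun setT (heat H c) by exact: measurable_heat.
have hb : `|heat H c' x - heat H c x| <= k * weight_mean n.
  rewrite -(heat_semigroup mH HK_norm x scc').
  have i1 : (gauss n).-integrable setT (EFin \o (fun y' => heat H c (lc 1 s x y') - heat H c x)).
    apply: (@integrable_bounded _ _ _ (gauss n) _ (K + K)); first by msolve2.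
    by move=> z; rewrite (le_trans (ler_normB _ _))// lerD// heat_norm.
  have i2 : (gauss n).-integrable setT (EFin \o (fun y' => s * dot (hgrad H c x) y')).
    exact: (integrableZl measurableT _ (integrable_dot (hgrad H c x) 1)).
  have -> : \int[gauss n]_y0 heat H c (lc 1 s x y0) - heat H c x =
     \int[gauss n]_y' (heat H c (lc 1 s x y') - heat H c x - s * dot (hgrad H c x) y').
    rewrite (RintegralB measurableT i1 i2) RintegralZl//; last exact: (integrable_dot _ 1).
    rewrite gauss_dot_mean mulr0 subr0 RintegralB ?Rintegral_prob_cst//.
      apply: (@integrable_bounded _ _ _ (gauss n) _ K); first by msolve2.
      by move=> z; exact: heat_norm.
    exact: (@integrable_bounded _ _ _ (gauss n) _ `|heat H c x|).
  rewrite -RintegralZl//; last exact: (integrable_weightX n 1).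
  apply: le_normr_Rintegral_dominated => //; first by msolve2.
  exact: (integrableZl measurableT _ (integrable_weightX n 1)).
have -> : heat H c (lc 1 s x y) - heat H c' x - s * dot (hgrad H c x) y =
  (heat H c (lc 1 s x y) - heat H c x - s * dot (hgrad H c x) y) - (heat H c' x - heat H c x).
  by ring.
apply: (le_trans (ler_normB _ _)); apply: (le_trans (lerD (T' y) hb)).
have -> : incr_const1 * s ^+ 2 * weight y = k * weight y + (k * weight_mean n) * weight y.
  by rewrite /incr_const1 /k; ring.
rewrite lerD2l ler_peMr ?weight_ge1//.
by rewrite mulr_ge0// weight_mean_ge0.
Qed.

End Increment.

Section XlnxFacts.
Context {R : realType}.

Lemma xlnx_ge (x : R) : 0 <= x -> x - 1 <= xlnx x.
Proof.
rewrite le_eqVlt => /predU1P[<-|x0]; first by rewrite /xlnx mul0r; lra.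
have h : 1 + ln x^-1 <= x^-1.
  by rewrite -[leRHS]lnK ?posrE ?invr_gt0// expR_ge1Dx.
rewrite lnV ?posrE// in h; have /(ler_wpM2l (ltW x0)) := h.
by rewrite divff ?gt_eqF// /xlnx; lra.
Qed.

Lemma xlnx_le (x : R) : 0 <= x -> xlnx x <= x * (x - 1).
Proof.
rewrite le_eqVlt => /predU1P[<-|x0]; first by rewrite /xlnx !mul0r.
have h : 1 + ln x <= x by rewrite -[leRHS]lnK ?posrE// expR_ge1Dx.
by apply: ler_wpM2l; lra.
Qed.

Lemma xlnx_norm (eps K x : R) : 0 < eps -> eps <= x <= K -> `|xlnx x| <= K ^+ 2 + 1.
Proof.
move=> e0 /andP[ex xK]; have x0 : 0 <= x by lra.
have := xlnx_ge x0; have := xlnx_le x0; rewrite ler_norml.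
have : x * (x - 1) <= K ^+ 2 by nra.
have := sqr_ge0 K; lra.
Qed.

Lemma measurable_fun_xlnx d (T : measurableType d) (f : T -> R) :
  measurable_fun setT f -> measurable_fun setT (fun x => xlnx (f x)).
Proof. by move=> mf; rewrite /xlnx; msolve2. Qed.

Lemma measurable_fun_heat d (T : measurableType d) n (H : n.-tuple R -> R) c
    (f : T -> n.-tuple R) : measurable_fun setT H -> measurable_fun setT f ->
  measurable_fun setT (fun x => heat H c (f x)).
Proof. by move=> mH mf; rewrite /heat; msolve2. Qed.

Lemma measurable_fun_hgrad d (T : measurableType d) n (H : n.-tuple R -> R) c
    (f : T -> n.-tuple R) : measurable_fun setT H -> measurable_fun setT f ->
  measurable_fun setT (fun x => hgrad H c (f x)).
Proof.
move=> mH mf; apply/measurable_fun_tnthP => i.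
rewrite (_ : _ \o _ = fun x => 2 * pi / c * \int[gauss n]_z (H (lc 1 c (f x) z) * tnth z i)).
  by msolve2.
by apply/funext => x; rewrite /= tnth_mktuple.
Qed.

End XlnxFacts.

Ltac mstep3 :=
  cbv beta;
  lazymatch goal with
  | |- measurable_fun _ (scale ?r) =>
      apply: (@measurable_fun_scale _ _ _ _ r id)
  | |- measurable_fun _ (lc ?a ?b ?x) =>
      refine (@measurable_fun_lc _ _ _ _ a b (fun=> x) (fun y => y) _ _)
  | |- measurable_fun _ (vw ?x) =>
      refine (@measurable_fun_vw _ _ _ _ _ (fun=> x) (fun y => y) _ _)
  | |- measurable_fun _ (dot ?x) =>
      refine (@measurable_fun_dot _ _ _ _ (fun=> x) (fun y => y) _ _)
  | |- measurable_fun _ (heat ?H ?c) => apply: measurable_heat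
  | |- measurable_fun _ id => exact: measurable_id
  | |- measurable_fun _ (fun x => scale ?r (@?f x)) =>
      apply: measurable_fun_scale
  | |- measurable_fun _ (fun x => xlnx (@?f x)) =>
      apply: measurable_fun_xlnx
  | |- measurable_fun _ (fun x => weight (@?f x)) =>
      apply: measurable_fun_weight
  | |- measurable_fun _ (fun x => heat ?H ?c (@?f x)) =>
      apply: measurable_fun_heat
  | |- measurable_fun _ (fun x => hgrad ?H ?c (@?f x)) =>
      apply: measurable_fun_hgrad
  | |- measurable_fun _ (fun x => ((@?f x))^-1%R) =>
      apply: measurable_fun_inv
  | |- _ => mstep2
  end.
Ltac msolve3 := repeat mstep3.

(** * Entropy growth of the noisy function, from below *)

Section LowerStep.
Context {R : realType} (n : nat) (H : n.-tuple R -> R) (eps K delta : R).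
Hypotheses (mH : measurable_fun setT H) (e0 : 0 < eps)
  (HeK : forall x, eps <= H x <= K) (d0 : 0 < delta).
Variables (c c' s t t' : R).
Hypotheses (c0 : 0 < c) (c1 : c <= 1) (dc : delta <= c ^+ 2)
  (s01 : 0 <= s <= 1) (scc' : s ^+ 2 + c ^+ 2 = c' ^+ 2)
  (stt' : t ^+ 2 + s ^+ 2 = t' ^+ 2).

(** The mean over y of (grad b . y)^2 / (2 b), a Fisher information density. The gradient is taken
    at noise c and the denominator at noise c', as the expansion around the mean delivers them. *)
Definition fisher (z : n.-tuple R) : R :=
  gauss_var * sqnorm (hgrad H c (scale t z)) / (2 * heat H c' (scale t z)).

Let A := incr_const1 n K delta.
Let B := incr_const2 n K delta.

Definition lower_const : R := step_const eps K A B * \int[gauss n]_z (weight z ^+ 3).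

Let a z y := heat H c (lc t s z y).
Let b z := heat H c' (scale t z).
Let D z := hgrad H c (scale t z).

Lemma lc_scale m r1 r2 (x y : m.-tuple R) : lc 1 r1 (scale r2 x) y = lc r2 r1 x y.
Proof. by apply: eq_from_tnth => i; rewrite !tnth_lc tnth_scale; ring. Qed.

Let ab z y : eps <= a z y <= K. Proof. exact: (heat_between mH HeK). Qed.
Let bb z : eps <= b z <= K. Proof. exact: (heat_between mH HeK). Qed.
Let b2 z : 0 < 2 * b z.
Proof. by rewrite mulr_gt0//; have /andP[h _] := bb z; exact: lt_le_trans h. Qed.

Let ma : measurable_fun setT (fun p : n.-tuple R * n.-tuple R => a p.1 p.2).
Proof. by rewrite /a; msolve3. Qed.

Let mb : measurable_fun setT b. Proof. by rewrite /b; msolve3. Qed.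

Let mD : measurable_fun setT D. Proof. by rewrite /D; msolve3. Qed.

Lemma measurable_fisher : measurable_fun setT fisher.
Proof. by rewrite /fisher; msolve3. Qed.

Let incr z y : `|a z y - b z - s * dot (D z) y| <= A * s ^+ 2 * weight y.
Proof.
rewrite /a -lc_scale.
exact: (heat_incr mH e0 HeK d0 c0 dc s01 scc').
Qed.

Let Dle z y : `|dot (D z) y| <= B * weight y.
Proof. exact: (hgrad_dot_le mH e0 HeK d0 c0 c1 dc). Qed.

Let A0 : 0 <= A. Proof. exact: (incr_const1_ge0 e0 HeK d0). Qed.
Let B0 : 0 <= B. Proof. exact: (incr_const2_ge0 e0 HeK d0). Qed.

Lemma fisher_ge0 z : 0 <= fisher z.
Proof.
rewrite /fisher divr_ge0 ?(ltW (b2 z))// mulr_ge0 ?sqnorm_ge0//.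
by apply: Rintegral_ge0 => x _; exact: sqr_ge0.
Qed.

Lemma gauss_var_hgrad_le z :
  gauss_var * sqnorm (D z) <= B ^+ 2 * \int[gauss n]_y (weight y ^+ 2).
Proof.
rewrite -gauss_dot_var -RintegralZl//; last exact: integrable_weightX.
apply: le_Rintegral => //.
- exact: integrable_dot.
- exact: (integrableZl measurableT _ (integrable_weightX n 2)).
- move=> y _; rewrite -exprMn -[leLHS]ger0_norm ?sqr_ge0// normrX lerXn2r// ?nnegrE.
  exact: le_trans (Dle z y).
Qed.

Lemma fisher_le z : `|fisher z| <= (B ^+ 2 * \int[gauss n]_y (weight y ^+ 2)) / (2 * eps).
Proof.
rewrite ger0_norm ?fisher_ge0// /fisher; apply: ler_pM.
- rewrite mulr_ge0 ?sqnorm_ge0//.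
  by apply: Rintegral_ge0 => x _; exact: sqr_ge0.
- by rewrite invr_ge0 (ltW (b2 z)).
- exact: gauss_var_hgrad_le.
- have h2 : 0 < 2 * eps by rewrite mulr_gt0.
  have /andP[h3 _] := bb z; have b2z := b2 z; rewrite /b in h3 b2z.
  by rewrite lef_pV2// ler_pM2l.
Qed.

(** t' z has the law of t z + s y. For fixed z this makes [a z y] a random variable in y with mean
    [b z], and [xlnx_step] bounds its entropy excess over [b z] from below. *)
Lemma lower_step :
  s ^+ 2 * \int[gauss n]_z fisher z - lower_const * s ^+ 3 <=
  \int[gauss n]_z xlnx (heat H c (scale t' z)) -
  \int[gauss n]_z xlnx (heat H c' (scale t z)).
Proof.
have i1 : (gauss n).-integrable setT (EFin \o fisher).
  exact: (integrable_bounded _ measurable_fisher fisher_le).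
have ixb : (gauss n).-integrable setT (EFin \o (fun z => xlnx (b z))).
  apply: (@integrable_bounded _ _ _ (gauss n) _ (K ^+ 2 + 1)); first by msolve3.
  by move=> z; exact: xlnx_norm (bb z).
have mxa : measurable_fun setT (fun p : n.-tuple R * n.-tuple R => xlnx (a p.1 p.2)).
  exact: measurable_fun_xlnx.
have mxa1 z : measurable_fun setT (fun y => xlnx (a z y)).
  by rewrite /a; msolve3.
have ixa z : (gauss n).-integrable setT (EFin \o (fun y => xlnx (a z y))).
  apply: (@integrable_bounded _ _ _ (gauss n) _ (K ^+ 2 + 1)) => // y.
  exact: xlnx_norm (ab z y).
have ixxa : (gauss n).-integrable setT (EFin \o (fun z => \int[gauss n]_y xlnx (a z y))).
  apply: (@integrable_bounded _ _ _ (gauss n) _ (K ^+ 2 + 1)).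
    by rewrite /a; msolve3.
  move=> z; apply: le_normr_Rintegral_bounded => // y.
  exact: xlnx_norm (ab z y).
have E : \int[gauss n]_z xlnx (heat H c (scale t' z)) = \int[gauss n]_z \int[gauss n]_y xlnx (a z y).
  rewrite -(@Rgauss_conv _ n t s t' (fun x => xlnx (heat H c x)))//; last by msolve3.
  rewrite (Rfubini1 (f := fun p => xlnx (a p.1 p.2)))//.
  apply: (@integrable_bounded_prod _ _ _ _ _ (gauss n) (gauss n) _ (K ^+ 2 + 1)) => //.
  by move=> p; exact: xlnx_norm (ab p.1 p.2).
have ic (r : R) : (gauss n).-integrable setT (EFin \o (fun _ => r)).
  exact: (@integrable_bounded _ _ _ (gauss n) _ `|r|).
have is1 : (gauss n).-integrable setT (EFin \o (fun z => s ^+ 2 * fisher z)).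
  exact: (integrableZl measurableT _ i1).
rewrite E -(RintegralB measurableT ixxa ixb) -RintegralZl//.
rewrite -[lower_const * _](Rintegral_prob_cst (gauss n)) -(RintegralB measurableT is1 (ic _)).
apply: le_Rintegral => //.
- exact: (integrableB measurableT is1 (ic _)).
- exact: (integrableB measurableT ixxa ixb).
move=> z _.
have ia : (gauss n).-integrable setT (EFin \o (a z)).
  apply: (@integrable_bounded _ _ _ (gauss n) _ K); first by rewrite /a; msolve3.
  by move=> y; exact: (heat_norm mH e0 HeK).
have iab : (gauss n).-integrable setT (EFin \o (fun y => a z y - b z)).
  exact: (integrableB measurableT ia (ic (b z))).
have iabl : (gauss n).-integrable setT (EFin \o (fun y => (1 + ln (b z)) * (a z y - b z))).
  exact: (integrableZl measurableT _ iab).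
have ixab : (gauss n).-integrable setT (EFin \o (fun y => xlnx (a z y) - xlnx (b z))).
  exact: (integrableB measurableT (ixa z) (ic (xlnx (b z)))).
(* As [a z] has mean [b z], the linear term may be subtracted without changing the value. *)
have -> : \int[gauss n]_y xlnx (a z y) - xlnx (b z) =
    \int[gauss n]_y (xlnx (a z y) - xlnx (b z) - (1 + ln (b z)) * (a z y - b z)).
  rewrite (RintegralB measurableT ixab iabl) (RintegralB measurableT (ixa z) (ic _)).
  rewrite RintegralZl// (RintegralB measurableT ia (ic _)) !Rintegral_prob_cst.
  have -> : \int[gauss n]_y a z y = b z.
    rewrite /b -(heat_semigroup mH (HK_norm e0 HeK) _ scc').
    by apply: eq_Rintegral => y _; rewrite lc_scale.
  by rewrite subrr mulr0 subr0.
have iw : (gauss n).-integrable setT (EFin \o (fun y : n.-tuple R => step_const eps K A B * s ^+ 3 * weight y ^+ 3)).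
  exact: (integrableZl measurableT _ (integrable_weightX n 3)).
pose ell y := s ^+ 2 * (dot (D z) y ^+ 2 / (2 * b z)).
have il : (gauss n).-integrable setT (EFin \o ell).
  have := integrableZl measurableT (s ^+ 2 / (2 * b z)) (integrable_dot (D z) 2).
  congr (_.-integrable _ _); apply/funext => y; rewrite /ell /= -EFinM; congr (_%:E).
  ring.
have -> : s ^+ 2 * fisher z - lower_const * s ^+ 3 =
    \int[gauss n]_y (ell y - step_const eps K A B * s ^+ 3 * weight y ^+ 3).
  rewrite (RintegralB measurableT il iw) RintegralZl//; last exact: integrable_weightX.
  rewrite /lower_const; congr (_ - _); last by ring.
  transitivity (\int[gauss n]_y (s ^+ 2 / (2 * b z) * dot (D z) y ^+ 2)).
    rewrite RintegralZl//; last exact: integrable_dot.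
    by rewrite gauss_dot_var /fisher -/(D z) -/(b z); ring.
  by apply: eq_Rintegral => y _; rewrite /ell; ring.
apply: le_Rintegral => //.
- exact: (integrableB measurableT il iw).
- exact: (integrableB measurableT ixab iabl).
move=> y _; rewrite /ell.
exact: (xlnx_step e0 A0 B0 s01 (weight_ge1 y) (ab z y) (bb z) (incr z y) (Dle z y)).
Qed.

End LowerStep.

Section Blocks.
Context {R : realType} (M N : nat).
Implicit Types (v y : M.-tuple R) (w : N.-tuple R) (z : (M + N).-tuple R).

Definition projQ z : N.-tuple R := [tuple tnth z (rshift M i) | i < N].

Lemma tnth_vwl v w i : tnth (vw v w) (lshift N i) = tnth v i.
Proof. exact: tnth_lshift. Qed.

Lemma tnth_vwr v w i : tnth (vw v w) (rshift M i) = tnth w i.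
Proof. exact: tnth_rshift. Qed.

Lemma projP_vw v w : projP (vw v w) = v.
Proof. by apply: eq_from_tnth => i; rewrite tnth_mktuple tnth_vwl. Qed.

Lemma lc_vw a b v w v' w' : lc a b (vw v w) (vw v' w') = vw (lc a b v v') (lc a b w w').
Proof.
apply: eq_from_tnth => i; rewrite tnth_lc.
by case: (split_ordP i) => j ->; rewrite ?tnth_vwl ?tnth_vwr tnth_lc.
Qed.

Lemma scale_vw r v w : scale r (vw v w) = vw (scale r v) (scale r w).
Proof.
apply: eq_from_tnth => i; rewrite tnth_scale.
by case: (split_ordP i) => j ->; rewrite ?tnth_vwl ?tnth_vwr tnth_scale.
Qed.

Lemma dot_vwr z v w : dot z (vw v w) = dot (projP z) v + dot (projQ z) w.
Proof.
rewrite /dot big_split_ord; congr (_ + _); apply: eq_bigr => i _.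
  by rewrite tnth_vwl tnth_mktuple.
by rewrite tnth_vwr tnth_mktuple.
Qed.

Lemma sqnorm_vw v w : sqnorm (vw v w) = sqnorm v + sqnorm w.
Proof.
rewrite /sqnorm big_split_ord; congr (_ + _); apply: eq_bigr => i _.
  by rewrite tnth_vwl.
by rewrite tnth_vwr.
Qed.

Lemma sqnorm_split z : sqnorm z = sqnorm (projP z) + sqnorm (projQ z).
Proof.
rewrite /sqnorm big_split_ord; congr (_ + _); apply: eq_bigr => i _.
  by rewrite tnth_mktuple.
by rewrite tnth_mktuple.
Qed.

Lemma weight_vw v w : weight (vw v w) <= weight v * weight w.
Proof.
have v0 := sqnorm_ge0 v; have w0 := sqnorm_ge0 w.
rewrite /weight sqnorm_vw -exprMn lerXn2r// ?nnegrE.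
- by rewrite !addr_ge0.
- by rewrite mulr_ge0// addr_ge0.
- have := mulr_ge0 v0 w0; lra.
Qed.

Lemma measurable_fun_projP d (T : measurableType d) (f : T -> (M + N).-tuple R) :
  measurable_fun setT f -> measurable_fun setT (fun x => projP (f x)).
Proof.
move=> mf; apply/measurable_fun_tnthP => i.
rewrite (_ : _ \o _ = fun x => tnth (f x) (lshift N i)); first by msolve3.
by apply/funext => x; rewrite /= tnth_mktuple.
Qed.

End Blocks.

(** * Entropy growth of the marginal, from above *)

Section UpperStep.
Context {R : realType} (M N : nat) (H : (M + N).-tuple R -> R) (eps K delta : R).
Hypotheses (mH : measurable_fun setT H) (e0 : 0 < eps)
  (HeK : forall x, eps <= H x <= K) (d0 : 0 < delta).
Variables (c c' s t t' : R).
Hypotheses (c0 : 0 < c) (c1 : c <= 1) (dc : delta <= c ^+ 2)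
  (s01 : 0 <= s <= 1) (scc' : s ^+ 2 + c ^+ 2 = c' ^+ 2)
  (stt' : t ^+ 2 + s ^+ 2 = t' ^+ 2).

Definition fisherP (z : (M + N).-tuple R) : R :=
  gauss_var * sqnorm (projP (hgrad H c (scale t z))) / (2 * heat H c' (scale t z)).

(** The second block of the noise increment is integrated out, and by [weight_vw] its weight becomes
    the factor [weight_mean N]. *)
Let A := incr_const1 (M + N) K delta * weight_mean N.
Let B := incr_const2 (M + N) K delta.

Definition upper_const : R := step_const eps K A B * \int[gauss M]_y (weight y ^+ 3).

Let a z y := heat H c (lc t s z y).
Let b z := heat H c' (scale t z).
Let D z := hgrad H c (scale t z).

Let ab z y : eps <= a z y <= K. Proof. exact: (heat_between mH HeK). Qed.
Let bb z : eps <= b z <= K. Proof. exact: (heat_between mH HeK). Qed.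
Let b2 z : 0 < 2 * b z.
Proof. by rewrite mulr_gt0//; have /andP[h _] := bb z; exact: lt_le_trans h. Qed.
Let an z y : `|a z y| <= K. Proof. exact: (heat_norm mH e0 HeK). Qed.
Let bn z : `|b z| <= K. Proof. exact: (heat_norm mH e0 HeK). Qed.
Let K0 : 0 < K. Proof. exact: (K_gt0 e0 HeK). Qed.

Let ma : measurable_fun setT (fun p : (M + N).-tuple R * (M + N).-tuple R => a p.1 p.2).
Proof. by rewrite /a; msolve3. Qed.

Let mb : measurable_fun setT b. Proof. by rewrite /b; msolve3. Qed.

Let mD1 : measurable_fun setT (fun z => projP (D z)).
Proof. by apply: measurable_fun_projP; rewrite /D; msolve3. Qed.

Let A0 : 0 <= A.
Proof. by rewrite mulr_ge0 ?weight_mean_ge0// (incr_const1_ge0 e0 HeK d0). Qed.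
Let B0 : 0 <= B. Proof. exact: (incr_const2_ge0 e0 HeK d0). Qed.

(** The noise increment is split as (y, y'), and its second-block part y' is averaged before the
    marginal over w is taken. *)
Let ea v w y : R := \int[gauss N]_y' a (vw v w) (vw y y').

Let mea : measurable_fun setT (fun p : M.-tuple R * (N.-tuple R * M.-tuple R) => ea p.1 p.2.1 p.2.2).
Proof.
rewrite /ea.
apply: (@measurable_partial_Rintegral _ _ _ _ _ _ (fun q : (M.-tuple R * (N.-tuple R * M.-tuple R)) * N.-tuple R =>
  a (vw q.1.1 q.1.2.1) (vw q.1.2.2 q.2))).
by rewrite /a; msolve3.
Qed.

Let eab v w y : eps <= ea v w y <= K.
Proof.
apply: Rintegral_between => [|y']; last exact: ab.
by rewrite /a; msolve3.
Qed.

Let ean v w y : `|ea v w y| <= K.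
Proof.
apply: le_normr_Rintegral_bounded => [|y']; last exact: an.
by rewrite /a; msolve3.
Qed.

(** Averaging over y' kills the second-block part of the linear term. This is how [projP] of the
    gradient, and not the full gradient, comes to control the marginal. *)
Let einc v w y : `|ea v w y - b (vw v w) - s * dot (projP (D (vw v w))) y| <=
  A * s ^+ 2 * weight y.
Proof.
set z := vw v w.
have iN (f : N.-tuple R -> R) C : measurable_fun setT f -> (forall x, `|f x| <= C) ->
    (gauss N).-integrable setT (EFin \o f).
  by move=> mf fC; exact: (@integrable_bounded _ _ _ (gauss N) _ C).
have ic (r : R) : (gauss N).-integrable setT (EFin \o (fun _ => r)).
  exact: (iN _ `|r|).
have may : measurable_fun setT (fun y' => a z (vw y y')) by rewrite /a; msolve3.
have ia : (gauss N).-integrable setT (EFin \o (fun y' => a z (vw y y'))).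
  by apply: (iN _ K) => // y'; exact: an.
have iab : (gauss N).-integrable setT (EFin \o (fun y' => a z (vw y y') - b z)).
  exact: (integrableB measurableT ia (ic (b z))).
have id1 : (gauss N).-integrable setT (EFin \o (fun y' => s * dot (projQ (D z)) y')).
  exact: (integrableZl measurableT _ (integrable_dot (projQ (D z)) 1)).
have id : (gauss N).-integrable setT (EFin \o (fun y' => s * dot (projP (D z)) y + s * dot (projQ (D z)) y')).
  exact: (integrableD measurableT (ic _) id1).
have -> : ea v w y - b z - s * dot (projP (D z)) y =
    \int[gauss N]_y' (a z (vw y y') - b z - s * dot (D z) (vw y y')).
  transitivity (\int[gauss N]_y' (a z (vw y y') - b z - (s * dot (projP (D z)) y + s * dot (projQ (D z)) y'))).
    rewrite (RintegralB measurableT iab id) (RintegralB measurableT ia (ic _)).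
    have m0 : \int[gauss N]_y' (s * dot (projQ (D z)) y') = 0.
      by rewrite RintegralZl ?gauss_dot_mean ?mulr0//; exact: (integrable_dot _ 1).
    by rewrite (RintegralD measurableT (ic _) id1) m0 addr0 !Rintegral_prob_cst.
  by apply: eq_Rintegral => y' _; rewrite dot_vwr mulrDr.
pose C := incr_const1 (M + N) K delta * s ^+ 2 * weight y.
have C0 : 0 <= C.
  rewrite mulr_ge0 ?(le_trans ler01 (weight_ge1 _))// mulr_ge0 ?sqr_ge0//.
  exact: (incr_const1_ge0 e0 HeK d0).
apply: (@le_trans _ _ (\int[gauss N]_y' (C * weight y'))).
  apply: le_normr_Rintegral_dominated.
  - by rewrite /a; msolve3.
  - exact: (integrableZl measurableT _ (integrable_weightX N 1)).
  - move=> y'; rewrite /a -lc_scale.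
    apply: (le_trans (heat_incr mH e0 HeK d0 c0 dc s01 scc' _ _)).
    rewrite /C -[leRHS]mulrA ler_wpM2l ?weight_vw//.
    by rewrite mulr_ge0 ?sqr_ge0// (incr_const1_ge0 e0 HeK d0).
rewrite RintegralZl//; last exact: (integrable_weightX N 1).
by rewrite /C /A -/(weight_mean N) le_eqVlt; apply/orP; left; apply/eqP; ring.
Qed.

Let D1le z y : `|dot (projP (D z)) y| <= B * weight y.
Proof.
have -> : dot (projP (D z)) y = dot (D z) (vw y [tuple 0 | i < N]).
  rewrite dot_vwr; suff -> : dot (projQ (D z)) [tuple 0 | i < N] = 0 by rewrite addr0.
  by rewrite /dot big1// => i _; rewrite [X in _ * X]tnth_mktuple mulr0.
apply: (le_trans (hgrad_dot_le mH e0 HeK d0 c0 c1 dc _ _)).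
apply: ler_wpM2l => //; rewrite /weight sqnorm_vw.
suff -> : sqnorm [tuple 0 | i < N] = 0 :> R by rewrite addr0.
by rewrite /sqnorm big1// => i _; rewrite tnth_mktuple expr0n.
Qed.

Lemma measurable_fisherP : measurable_fun setT fisherP.
Proof.
rewrite /fisherP; have := mD1; rewrite /D => mD1'.
have := @measurable_fun_inv _ _ _ (fun z => 2 * b z).
move=> /(_ (ltac:(msolve3)) b2); rewrite /b => mi.
by msolve3.
Qed.

Lemma fisherP_ge0 z : 0 <= fisherP z.
Proof.
rewrite /fisherP divr_ge0 ?(ltW (b2 z))// mulr_ge0 ?sqnorm_ge0//.
by apply: Rintegral_ge0 => x _; exact: sqr_ge0.
Qed.

Lemma fisherP_le z : fisherP z <= fisher H c c' t z.
Proof.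
rewrite /fisherP /fisher ler_wpM2r//; first by rewrite invr_ge0 (ltW (b2 z)).
rewrite ler_wpM2l//; first by apply: Rintegral_ge0 => x _; exact: sqr_ge0.
by rewrite [leRHS]sqnorm_split lerDl sqnorm_ge0.
Qed.

Let ell z y : R := dot (projP (D z)) y ^+ 2 / (2 * b z).

Let mell : measurable_fun setT (fun p : M.-tuple R * (N.-tuple R * M.-tuple R) => ell (vw p.1 p.2.1) p.2.2).
Proof.
have m1 := @measurable_fun_inv _ _ _ (fun z => 2 * b z) (ltac:(msolve3)) b2.
have m2 := mD1.
rewrite /ell.
apply: measurable_funM.
  apply: measurable_funX; apply: measurable_fun_dot.
    by apply: (measurableT_comp m2); msolve3.
  by msolve3.
by apply: (measurableT_comp m1); msolve3.
Qed.

Let ell_le z y : 0 <= ell z y <= B ^+ 2 / (2 * eps) * weight y ^+ 2.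
Proof.
rewrite /ell divr_ge0 ?sqr_ge0 ?(ltW (b2 z))//=.
have -> : B ^+ 2 / (2 * eps) * weight y ^+ 2 = (B * weight y) ^+ 2 / (2 * eps) by ring.
apply: ler_pM.
- exact: sqr_ge0.
- by rewrite invr_ge0 (ltW (b2 z)).
- rewrite -[leLHS]ger0_norm ?sqr_ge0// normrX lerXn2r// ?nnegrE.
  exact: le_trans (D1le z y).
- have h2 : 0 < 2 * eps by rewrite mulr_gt0.
  have /andP[h3 _] := bb z; have b2z := b2 z.
  by rewrite lef_pV2// ler_pM2l.
Qed.

Let ebar v y := \int[gauss N]_w ea v w y.
Let bbar v := \int[gauss N]_w b (vw v w).

Let mbv v : measurable_fun setT (fun w => b (vw v w)).
Proof. by rewrite /b; msolve3. Qed.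

Let mev v y : measurable_fun setT (fun w => ea v w y).
Proof.
exact: (measurableT_comp (g := fun w => (v, (w, y))) mea (ltac:(msolve3))).
Qed.

Let mbbar : measurable_fun setT bbar.
Proof. by rewrite /bbar /b; msolve3. Qed.

Let mebar : measurable_fun setT (fun p : M.-tuple R * M.-tuple R => ebar p.1 p.2).
Proof.
rewrite /ebar.
apply: (@measurable_partial_Rintegral _ _ _ _ _ _ (fun q : (M.-tuple R * M.-tuple R) * N.-tuple R =>
  ea q.1.1 q.2 q.1.2)).
exact: (measurableT_comp (g := fun q : (M.-tuple R * M.-tuple R) * N.-tuple R => (q.1.1, (q.2, q.1.2))) mea (ltac:(msolve3))).
Qed.

Let ebarb v y : eps <= ebar v y <= K.
Proof. by apply: Rintegral_between => [|w]; [exact: mev|exact: eab]. Qed.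

Let bbarb v : eps <= bbar v <= K.
Proof. by apply: Rintegral_between => [|w]; [exact: mbv|exact: bb]. Qed.

Let iN (f : N.-tuple R -> R) C : measurable_fun setT f -> (forall x, `|f x| <= C) ->
  (gauss N).-integrable setT (EFin \o f).
Proof. by move=> mf fC; exact: (@integrable_bounded _ _ _ (gauss N) _ C). Qed.

Let mellw v y : measurable_fun setT (fun w => ell (vw v w) y).
Proof.
exact: (measurableT_comp (g := fun w => (v, (w, y))) mell (ltac:(msolve3))).
Qed.

Let iell v y : (gauss N).-integrable setT (EFin \o (fun w => ell (vw v w) y)).
Proof.
apply: (iN (C := B ^+ 2 / (2 * eps) * weight y ^+ 2)) => // w.
by have /andP[h1 h2] := ell_le (vw v w) y; rewrite ger0_norm.
Qed.

(** Expanding [xlnx] between the marginals leaves the square of an integral over w, divided by a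
    marginal. Cauchy-Schwarz moves the square inside while the increments are still exact; they are
    linearised only afterwards. *)
Let pointwise v y :
  xlnx (ebar v y) - xlnx (bbar v) - (1 + ln (bbar v)) * (ebar v y - bbar v) <=
  s ^+ 2 * \int[gauss N]_w ell (vw v w) y + step_const eps K A B * s ^+ 3 * weight y ^+ 3.
Proof.
have V1 := weight_ge1 y.
have q w := quadratic_replacement e0 A0 B0 s01 V1
  (proj1 (andP (bb (vw v w)))) (einc v w y) (D1le (vw v w) y).
pose d w := ea v w y - b (vw v w).
have md : measurable_fun setT d by have := mev v y; have := mbv v; rewrite /d => ? ?; msolve3.
have dK w : `|d w| <= K.
  have /andP[? ?] := eab v w y; have /andP[? ?] := bb (vw v w).
  by rewrite /d ler_norml; apply/andP; split; have := e0; lra.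
have iea : (gauss N).-integrable setT (EFin \o (fun w => ea v w y)).
  exact: (iN (mev v y) (fun w => ean v w y)).
have ib : (gauss N).-integrable setT (EFin \o (fun w => b (vw v w))).
  exact: (iN (mbv v) (fun w => bn (vw v w))).
have Ed : ebar v y - bbar v = \int[gauss N]_w d w by rewrite /d (RintegralB measurableT iea ib).
have dn : `|ebar v y - bbar v| <= (A + B) * s * weight y.
  by rewrite Ed; apply: le_normr_Rintegral_bounded => // w; have [] := q w.
have dn3 : `|ebar v y - bbar v| ^+ 3 <= (A + B) ^+ 3 * s ^+ 3 * weight y ^+ 3.
  rewrite -!exprMn lerXn2r// ?nnegrE; exact: le_trans dn.
have cs := @sqr_Rintegral_div_le _ _ _ (gauss N) _ _ _ _ md (mbv v) e0 (ltW K0) (fun w => bb (vw v w)) dK.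
rewrite -Ed -/(bbar v) in cs.
have mb2 := @measurable_fun_inv _ _ _ (fun w => b (vw v w)) (mbv v) (fun w => lt_le_trans e0 (proj1 (andP (bb (vw v w))))).
pose r w := d w ^+ 2 / b (vw v w).
have ir : (gauss N).-integrable setT (EFin \o r).
  apply: (iN (C := K ^+ 2 / eps)); first exact: (measurable_funM (measurable_funX 2 md) mb2).
  move=> w; have /andP[h1 h2] := bb (vw v w); have b0 := lt_le_trans e0 h1.
  rewrite /r normrM normrX [`|(b _)^-1|]ger0_norm ?invr_ge0 ?(ltW b0)//.
  apply: ler_pM; rewrite ?exprn_ge0 ?invr_ge0 ?(ltW b0)//.
    by rewrite lerXn2r// ?nnegrE// ltW.
  by rewrite lef_pV2 ?posrE.
pose k := A * (2 * B + A) / (2 * eps) * s ^+ 3 * weight y ^+ 3.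
have i2 : (gauss N).-integrable setT (EFin \o (fun w => 2 * (s ^+ 2 * ell (vw v w) y + k))).
  have i1 : (gauss N).-integrable setT (EFin \o (fun w => s ^+ 2 * ell (vw v w) y)).
    exact: (integrableZl measurableT _ (iell v y)).
  have ik : (gauss N).-integrable setT (EFin \o (fun w => k)) by exact: (iN (C := `|k|)).
  have i3 : (gauss N).-integrable setT (EFin \o (fun w => s ^+ 2 * ell (vw v w) y + k)).
    exact: (integrableD measurableT i1 ik).
  exact: (integrableZl measurableT _ i3).
have rE : \int[gauss N]_w r w <= 2 * (s ^+ 2 * \int[gauss N]_w ell (vw v w) y + k).
  have i1 : (gauss N).-integrable setT (EFin \o (fun w => s ^+ 2 * ell (vw v w) y)).
    exact: (integrableZl measurableT _ (iell v y)).
  have ik : (gauss N).-integrable setT (EFin \o (fun w => k)) by exact: (iN (C := `|k|)).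
  have i3 : (gauss N).-integrable setT (EFin \o (fun w => s ^+ 2 * ell (vw v w) y + k)).
    exact: (integrableD measurableT i1 ik).
  rewrite -RintegralZl// -[X in _ * (_ + X)](Rintegral_prob_cst (gauss N)) -(RintegralD measurableT i1 ik) -RintegralZl//.
  apply: le_Rintegral => // w _.
  have [q1 _ _] := q w; move: q1; rewrite ler_norml => /andP[_ q1].
  rewrite /r; have b0 : b (vw v w) != 0.
    by have /andP[h1 _] := bb (vw v w); rewrite gt_eqF// (lt_le_trans e0).
  have -> : d w ^+ 2 / b (vw v w) = 2 * (d w ^+ 2 / (2 * b (vw v w))) by field.
  by rewrite ler_pM2l//; move: q1; rewrite /d /ell /k; lra.
have t1 := xlnx_taylor e0 (ebarb v y) (bbarb v).
have C0 : 0 <= K ^+ 2 / eps ^+ 4 by rewrite divr_ge0 ?exprn_ge0// ltW.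
have q4 := ler_wpM2l C0 dn3.
have E2 : (ebar v y - bbar v) ^+ 2 / (2 * bbar v) = (ebar v y - bbar v) ^+ 2 / bbar v / 2.
  have /andP[h1 _] := bbarb v; have h0 : bbar v != 0 by rewrite gt_eqF// (lt_le_trans e0).
  by field.
move: t1; rewrite ler_norml => /andP[_]; rewrite E2 /step_const.
move: cs rE q4; rewrite -/(r) /k.
set X := xlnx _ - _ - _; set I := \int[gauss N]_w ell _ _; set Y := _ / bbar v; set Z := \int[gauss N]_w r w.
lra.
Qed.

Let iM (f : M.-tuple R -> R) C : measurable_fun setT f -> (forall x, `|f x| <= C) ->
  (gauss M).-integrable setT (EFin \o f).
Proof. by move=> mf fC; exact: (@integrable_bounded _ _ _ (gauss M) _ C). Qed.

Let ebarn v y : `|ebar v y| <= K.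
Proof. by have /andP[h1 h2] := ebarb v y; rewrite ger0_norm// (le_trans (ltW e0)). Qed.

Let mebarv v : measurable_fun setT (ebar v).
Proof. exact: (measurableT_comp (g := fun y => (v, y)) mebar (ltac:(msolve3))). Qed.

(** Integration over w commutes with that over the noise, so the marginals inherit the mean property
    of [heat_semigroup]. *)
Let ebar_mean v : \int[gauss M]_y ebar v y = bbar v.
Proof.
have mf : measurable_fun setT (fun p : M.-tuple R * N.-tuple R => ea v p.2 p.1).
  exact: (measurableT_comp (g := fun p : M.-tuple R * N.-tuple R => (v, (p.2, p.1))) mea (ltac:(msolve3))).
rewrite /ebar (Rfubini (f := fun y w => ea v w y)); last first.
  apply: (@integrable_bounded_prod _ _ _ _ _ (gauss M) (gauss N) (fun p => ea v p.2 p.1) K) => //.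
apply: eq_Rintegral => w _; rewrite /ea /b -(heat_semigroup mH (HK_norm e0 HeK) _ scc').
under [RHS]eq_Rintegral do rewrite lc_scale.
rewrite Rintegral_gauss_vw//.
apply: (@integrable_bounded _ _ _ (gauss (M + N)) _ K); first by msolve3.
by move=> y; exact: an.
Qed.

Let ell_mean v :
  \int[gauss M]_y \int[gauss N]_w ell (vw v w) y = \int[gauss N]_w fisherP (vw v w).
Proof.
have mf : measurable_fun setT (fun p : M.-tuple R * N.-tuple R => ell (vw v p.2) p.1).
  exact: (measurableT_comp (g := fun p : M.-tuple R * N.-tuple R => (v, (p.2, p.1))) mell (ltac:(msolve3))).
rewrite (Rfubini (f := fun y w => ell (vw v w) y)); last first.
  apply: (@integrable_prod _ _ _ _ _ (gauss M) (gauss N) (fun p => ell (vw v p.2) p.1)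
    (fun y => B ^+ 2 / (2 * eps) * weight y ^+ 2) (fun=> 1)) => //.
  - exact: (integrableZl measurableT _ (integrable_weightX M 2)).
  - by apply: (iN (C := 1)) => // x; rewrite normr1.
  - by move=> y; have /andP[h1 h2] := ell_le (vw [tuple 0 | i < M] [tuple 0 | i < N]) y; exact: le_trans h2.
  - move=> y w; have /andP[h1 h2] := ell_le (vw v w) y.
    by rewrite mulr1 ger0_norm.
apply: eq_Rintegral => w _; rewrite /ell.
transitivity (\int[gauss M]_y ((2 * b (vw v w))^-1 * dot (projP (D (vw v w))) y ^+ 2)).
  by apply: eq_Rintegral => y _; rewrite mulrC.
rewrite RintegralZl//; last exact: integrable_dot.
by rewrite gauss_dot_var mulrC.
Qed.

Lemma integrable_fisherP : (gauss (M + N)).-integrable setT (EFin \o fisherP).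
Proof.
apply: (integrable_dominated (g := fisher H c c' t)).
- exact: measurable_fisherP.
- apply: (@integrable_bounded _ _ _ (gauss (M + N)) _ (B ^+ 2 * (\int[gauss (M + N)]_y (weight y ^+ 2)) / (2 * eps))).
    exact: (measurable_fisher mH e0 HeK).
  by move=> z; exact: (fisher_le mH e0 HeK d0 c' t c0 c1 dc).
- by move=> z; rewrite ger0_norm ?fisherP_ge0// fisherP_le.
Qed.

Lemma upper_step :
  \int[gauss M]_v xlnx (\int[gauss N]_w heat H c (scale t' (vw v w))) -
  \int[gauss M]_v xlnx (\int[gauss N]_w heat H c' (scale t (vw v w))) <=
  s ^+ 2 * \int[gauss (M + N)]_z fisherP z + upper_const * s ^+ 3.
Proof.
have xe v y := xlnx_norm e0 (ebarb v y).
have xb v := xlnx_norm e0 (bbarb v).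
have mxe : measurable_fun setT (fun p : M.-tuple R * M.-tuple R => xlnx (ebar p.1 p.2)).
  exact: (measurable_fun_xlnx mebar).
(* Each block of t' (v, w) is replaced by a sum of independent Gaussians with the same law, the
   second one inside the marginal. *)
have E : \int[gauss M]_v xlnx (\int[gauss N]_w heat H c (scale t' (vw v w))) =
    \int[gauss M]_v \int[gauss M]_y xlnx (ebar v y).
  pose psi v := \int[gauss N]_w heat H c (vw v (scale t' w)).
  have mpsi : measurable_fun setT psi by rewrite /psi; msolve3.
  have psiE0 v : \int[gauss N]_w heat H c (scale t' (vw v w)) = psi (scale t' v).
    by apply: eq_Rintegral => w _; rewrite scale_vw.
  transitivity (\int[gauss M]_v xlnx (psi (scale t' v))).
    by apply: eq_Rintegral => v _; rewrite psiE0.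
  rewrite -(@Rgauss_conv _ M t s t' (fun v => xlnx (psi v)))//; last exact: (measurable_fun_xlnx mpsi).
  have psiE p : psi (lc t s p.1 p.2) = ebar p.1 p.2.
    rewrite /psi -(@Rgauss_conv _ N t s t' (fun w => heat H c (vw (lc t s p.1 p.2) w)))//; last by msolve3.
    rewrite Rfubini1/=; last first.
      apply: (@integrable_bounded_prod _ _ _ _ _ (gauss N) (gauss N)
        (fun q => heat H c (vw (lc t s p.1 p.2) (lc t s q.1 q.2))) K); first by msolve3.
      by move=> q; exact: (heat_norm mH e0 HeK).
    apply: eq_Rintegral => w _; apply: eq_Rintegral => y' _.
    by rewrite /a lc_vw.
  transitivity (\int[(gauss M \x gauss M)%E]_p xlnx (ebar p.1 p.2)).
    by apply: eq_Rintegral => p _; rewrite psiE.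
  rewrite (Rfubini1 (f := fun p => xlnx (ebar p.1 p.2)))//.
  apply: (@integrable_bounded_prod _ _ _ _ _ (gauss M) (gauss M) _ (K ^+ 2 + 1)) => //.
have mxe1 v : measurable_fun setT (fun y => xlnx (ebar v y)).
  exact: (measurable_fun_xlnx (mebarv v)).
have iye v : (gauss M).-integrable setT (EFin \o (fun y => xlnx (ebar v y))).
  exact: (iM (mxe1 v) (xe v)).
have ie : (gauss M).-integrable setT (EFin \o (fun v => \int[gauss M]_y xlnx (ebar v y))).
  apply: (iM (C := K ^+ 2 + 1)).
    exact: (@measurable_partial_Rintegral _ _ _ _ _ _ (fun p => xlnx (ebar p.1 p.2))).
  by move=> v; exact: (@le_normr_Rintegral_bounded _ _ _ (gauss M) _ _ (mxe1 v) (xe v)).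
have ib : (gauss M).-integrable setT (EFin \o (fun v => xlnx (bbar v))).
  exact: (iM (measurable_fun_xlnx mbbar) xb).
have ic (r : R) : (gauss M).-integrable setT (EFin \o (fun _ => r)).
  exact: (iM (C := `|r|)).
have mfv : measurable_fun setT (fun v => \int[gauss N]_w fisherP (vw v w)).
  apply: (@measurable_partial_Rintegral _ _ _ _ _ _ (fun p => fisherP (vw p.1 p.2))).
  exact: (measurableT_comp measurable_fisherP (@measurable_vw _ M N)).
pose CF := (incr_const2 (M + N) K delta) ^+ 2 * \int[gauss (M + N)]_y (weight y ^+ 2) / (2 * eps).
have fPn z : `|fisherP z| <= CF.
  rewrite ger0_norm ?fisherP_ge0//; apply: (le_trans (fisherP_le z)).
  by apply: (le_trans (ler_norm _)); exact: (fisher_le mH e0 HeK d0 c' t c0 c1 dc).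
have ifv : (gauss M).-integrable setT (EFin \o (fun v => \int[gauss N]_w fisherP (vw v w))).
  apply: (iM (C := CF) mfv) => v.
  apply: le_normr_Rintegral_bounded => [|w]; last exact: fPn.
  exact: (measurableT_comp (g := fun w => vw v w) measurable_fisherP (ltac:(msolve3))).
have isf : (gauss M).-integrable setT (EFin \o (fun v => s ^+ 2 * \int[gauss N]_w fisherP (vw v w))).
  exact: (integrableZl measurableT _ ifv).
have conv (x x' y r : R) : x = x' -> x' - y <= r -> x - y <= r by move=> ->.
apply: (conv _ _ (\int[gauss M]_v xlnx (bbar v)) _ E).
rewrite -(RintegralB measurableT ie ib) (Rintegral_gauss_vw integrable_fisherP).
rewrite -RintegralZl// -[upper_const * _](Rintegral_prob_cst (gauss M)).
rewrite -(RintegralD measurableT isf (ic _)).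
apply: le_Rintegral => //.
- exact: (integrableB measurableT ie ib).
- exact: (integrableD measurableT isf (ic _)).
move=> v _.
have iev : (gauss M).-integrable setT (EFin \o (ebar v)) by exact: (iM (mebarv v) (ebarn v)).
have id1 : (gauss M).-integrable setT (EFin \o (fun y => ebar v y - bbar v)).
  exact: (integrableB measurableT iev (ic _)).
have id2 : (gauss M).-integrable setT (EFin \o (fun y => (1 + ln (bbar v)) * (ebar v y - bbar v))).
  exact: (integrableZl measurableT _ id1).
have ixd : (gauss M).-integrable setT (EFin \o (fun y => xlnx (ebar v y) - xlnx (bbar v))).
  exact: (integrableB measurableT (iye v) (ic _)).
have -> : \int[gauss M]_y xlnx (ebar v y) - xlnx (bbar v) =
    \int[gauss M]_y (xlnx (ebar v y) - xlnx (bbar v) - (1 + ln (bbar v)) * (ebar v y - bbar v)).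
  rewrite (RintegralB measurableT ixd id2) (RintegralB measurableT (iye v) (ic _)).
  rewrite RintegralZl// (RintegralB measurableT iev (ic _)) ebar_mean !Rintegral_prob_cst.
  by rewrite subrr mulr0 subr0.
have mely : measurable_fun setT (fun p : M.-tuple R * N.-tuple R => ell (vw v p.2) p.1).
  exact: (measurableT_comp (g := fun p : M.-tuple R * N.-tuple R => (v, (p.2, p.1))) mell (ltac:(msolve3))).
have iely : (gauss M).-integrable setT (EFin \o (fun y => \int[gauss N]_w ell (vw v w) y)).
  apply: (@integrable_dominated _ _ _ (gauss M) _ (fun y => B ^+ 2 / (2 * eps) * weight y ^+ 2)).
  - exact: (@measurable_partial_Rintegral _ _ _ _ _ _ (fun p => ell (vw v p.2) p.1)).
  - exact: (integrableZl measurableT _ (integrable_weightX M 2)).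
  - move=> y; apply: le_normr_Rintegral_bounded => // w.
    by have /andP[h1 h2] := ell_le (vw v w) y; rewrite ger0_norm.
have isl : (gauss M).-integrable setT (EFin \o (fun y => s ^+ 2 * \int[gauss N]_w ell (vw v w) y)).
  exact: (integrableZl measurableT _ iely).
have iw : (gauss M).-integrable setT (EFin \o (fun y : M.-tuple R => step_const eps K A B * s ^+ 3 * weight y ^+ 3)).
  exact: (integrableZl measurableT _ (integrable_weightX M 3)).
have -> : s ^+ 2 * \int[gauss N]_w fisherP (vw v w) + upper_const * s ^+ 3 =
   \int[gauss M]_y (s ^+ 2 * \int[gauss N]_w ell (vw v w) y + step_const eps K A B * s ^+ 3 * weight y ^+ 3).
  rewrite (RintegralD measurableT isl iw) RintegralZl// ell_mean RintegralZl//.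
    by rewrite /upper_const; congr (_ + _); ring.
  exact: integrable_weightX.
apply: le_Rintegral => //.
- exact: (integrableB measurableT ixd id2).
- exact: (integrableD measurableT isl iw).
Qed.

End UpperStep.

(** * Averages over rotations *)

Section Average.
Context {R : realType} d (T : measurableType d) (Q : probability T R)
  (I : finType) (P : pred I) (Lam : I -> R).
Hypothesis Lam0 : forall i, P i -> 0 <= Lam i.

(* The total weight may be smaller than 1: there is no pair inside the first
   (or the second) block when M = 1 (or N = 1). *)
Definition avg (f : I -> T -> R) : R := \sum_(i | P i) Lam i * \int[Q]_th f i th.

Definition tame (f : I -> T -> R) : Prop := forall i, P i ->
  measurable_fun setT (f i) /\ exists C, forall th, `|f i th| <= C.

Lemma tame_integrable f i : tame f -> P i -> Q.-integrable setT (EFin \o f i).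
Proof. by move=> tf Pi; have [mf [C fC]] := tf _ Pi; exact: (@integrable_bounded _ _ _ Q _ C). Qed.

Lemma avg_le f g : tame f -> tame g -> (forall i th, P i -> f i th <= g i th) ->
  avg f <= avg g.
Proof.
move=> tf tg fg; apply: ler_sum => i Pi; apply: ler_wpM2l; first exact: Lam0.
by apply: le_Rintegral; [by []|exact: tame_integrable|exact: tame_integrable|move=> th _; exact: fg].
Qed.

Lemma avgB f g : tame f -> tame g -> avg (fun i th => f i th - g i th) = avg f - avg g.
Proof.
move=> tf tg; rewrite /avg -sumrB; apply: eq_bigr => i Pi.
by rewrite (RintegralB measurableT (tame_integrable tf Pi) (tame_integrable tg Pi)) mulrBr.
Qed.

Lemma avgD f g : tame f -> tame g -> avg (fun i th => f i th + g i th) = avg f + avg g.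
Proof.
move=> tf tg; rewrite /avg -big_split; apply: eq_bigr => i Pi /=.
by rewrite (RintegralD measurableT (tame_integrable tf Pi) (tame_integrable tg Pi)) mulrDr.
Qed.

Lemma avgZ f r : tame f -> avg (fun i th => r * f i th) = r * avg f.
Proof.
move=> tf; rewrite /avg mulr_sumr; apply: eq_bigr => i Pi.
by rewrite (RintegralZl _ measurableT (tame_integrable tf Pi)) mulrCA.
Qed.

Definition avg1 : R := \sum_(i | P i) Lam i.

Lemma avg_cst r : avg (fun _ _ => r) = avg1 * r.
Proof. by rewrite /avg /avg1 mulr_suml; apply: eq_bigr => i _; rewrite Rintegral_prob_cst. Qed.

Lemma avg1_ge0 : 0 <= avg1. Proof. exact: sumr_ge0. Qed.

Lemma tame_cst r : tame (fun _ _ => r).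
Proof. by move=> i _; split => //; exists `|r|. Qed.

Lemma eq_avg f g : (forall i th, P i -> f i th = g i th) -> avg f = avg g.
Proof.
move=> fg; apply: eq_bigr => i Pi; congr (_ * _).
by apply: eq_Rintegral => th _; exact: fg.
Qed.

Lemma avg_exchange d' (U : measurableType d') (G : probability U R)
    (f : I -> T -> U -> R) (C : R) :
  (forall i, P i -> measurable_fun setT (fun p : T * U => f i p.1 p.2)) ->
  (forall i th z, P i -> `|f i th z| <= C) ->
  avg (fun i th => \int[G]_z f i th z) = \int[G]_z avg (fun i th => f i th z).
Proof.
move=> mf fC; have mi i : P i -> measurable_fun setT (fun z => \int[Q]_th f i th z).
  move=> Pi; apply: (@measurable_partial_Rintegral _ _ _ _ _ _ (fun p => f i p.2 p.1)).
  apply: (measurableT_comp (mf i Pi) (g := fun p : U * T => (p.2, p.1))).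
  by msolve.
have ii i : P i -> G.-integrable setT (EFin \o (fun z => \int[Q]_th f i th z)).
  move=> Pi; apply: (@integrable_bounded _ _ _ G _ C); first exact: mi.
  move=> z; apply: le_normr_Rintegral_bounded => [|th]; last exact: fC.
  exact: (measurableT_comp (mf i Pi) (g := fun th : T => (th, z)) (ltac:(msolve))).
have ifi i : G.-integrable setT
    (EFin \o (fun z => if P i then Lam i * \int[Q]_th f i th z else 0)).
  case: (boolP (P i)) => Pi; last first.
    by apply: (@integrable_bounded _ _ _ G _ 0) => // z; rewrite normr0.
  exact: (integrableZl measurableT _ (ii i Pi)).
rewrite /avg.
under [RHS]eq_Rintegral do rewrite big_mkcond.
have [_ ->] := @Rintegral_sum _ _ _ G _ (index_enum I)
  (fun i z => if P i then Lam i * \int[Q]_th f i th z else 0) ifi.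
rewrite big_mkcond; apply: eq_bigr => i _; case: ifPn => Pi; last by rewrite Rintegral_prob_cst.
rewrite (Rfubini (f := f i)); last first.
  apply: (@integrable_bounded_prod _ _ _ _ _ Q G (fun p => f i p.1 p.2) C); first exact: mf.
  by move=> p; exact: fC.
by rewrite (RintegralZl _ measurableT (ii i Pi)).
Qed.

End Average.

Section RotatedHeat.
Context {R : realType} (n : nat) (H : n.-tuple R -> R) (K : R).
Hypotheses (mH : measurable_fun setT H) (HK : forall x, `|H x| <= K).
Variables (O fw : n.-tuple R -> n.-tuple R).

(** [fw] is the adjoint of [O], carried as data because gradients transform by the adjoint while
    functions are composed with [O]. *)
Definition is_rotation : Prop :=
  [/\ measurable_fun setT O, has_law (gauss n) O (gauss n),
      forall a b x y, O (lc a b x y) = lc a b (O x) (O y),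
      forall x y, dot x (O y) = dot (fw x) y &
      forall x y, dot (O x) (O y) = dot x y].

Hypothesis rotO : is_rotation.

Lemma rot_scale r x : O (scale r x) = scale r (O x).
Proof. by have [_ _ lO _ _] := rotO; rewrite scaleE lO. Qed.

Lemma heat_rot c x : heat (H \o O) c x = heat H c (O x).
Proof.
have [mO gO lO _ _] := rotO; rewrite /heat.
rewrite -(has_law_Rintegral gO (f := fun z => H (lc 1 c (O x) z))); last by msolve3.
by apply: eq_Rintegral => z _; rewrite /= lO.
Qed.

Lemma dot_inj (x y : n.-tuple R) : (forall z, dot x z = dot y z) -> x = y.
Proof.
move=> h; apply: eq_from_tnth => i.
have e (u : n.-tuple R) : dot u [tuple (i == j)%:R | j < n] = tnth u i.
  rewrite /dot (bigD1 i)//= tnth_mktuple eqxx mulr1 big1 ?addr0// => j ji.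
  by rewrite tnth_mktuple eq_sym (negbTE ji) mulr0.
by rewrite -e h e.
Qed.

(** The chain rule, read off from the pairings of [hgrad_dot] and the invariance of the Gaussian. *)
Lemma hgrad_rot c x : hgrad (H \o O) c x = fw (hgrad H c (O x)).
Proof.
have [mO gO lO aO iO] := rotO.
have mHO : measurable_fun setT (H \o O) by exact: measurableT_comp.
apply: dot_inj => y; rewrite -aO !(hgrad_dot (K := K))//; last by move=> z; exact: HK.
rewrite -(has_law_Rintegral gO (f := fun z => H (lc 1 c (O x) z) * dot (O y) z)); last by msolve3.
by congr (_ * _); apply: eq_Rintegral => z _; rewrite /= lO iO.
Qed.

End RotatedHeat.

(** * One step of the interpolation, averaged over rotations *)

Section AveragedStep.
Context {R : realType} (M N : nat) d (T : measurableType d) (Q : probability T R)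
  (I : finType) (P : pred I) (Lam : I -> R).
Hypothesis Lam0 : forall i, P i -> 0 <= Lam i.
Variables (H : (M + N).-tuple R -> R) (eps K : R).
Hypotheses (mH : measurable_fun setT H) (e0 : 0 < eps)
  (HeK : forall x, eps <= H x <= K).
Hypothesis HP : forall v w w', H (vw v w) = H (vw v w').
Variables (O fw : I -> T -> (M + N).-tuple R -> (M + N).-tuple R).
Hypotheses (rotO : forall i th, P i -> is_rotation (O i th) (fw i th))
  (mO : forall i, P i -> measurable_fun setT (fun p : T * (M + N).-tuple R => O i p.1 p.2))
  (mfw : forall i, P i -> measurable_fun setT (fun p : T * (M + N).-tuple R => fw i p.1 p.2)).
Variable ck : R.
Hypothesis ck0 : 0 <= ck.
Hypothesis fw_avg : forall x, sqnorm (projQ x) = 0 ->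
  avg Q P Lam (fun i th => sqnorm (projP (fw i th x))) = ck * sqnorm x.

Definition Psi (c t : R) (i : I) (th : T) : R :=
  \int[gauss M]_v xlnx (\int[gauss N]_w heat H c (O i th (scale t (vw v w)))).

Definition Phi (c t : R) : R := \int[gauss (M + N)]_z xlnx (heat H c (scale t z)).

(** The adjoint of an isometry is a contraction: |fw x|^2 is the inner product of x with O (fw x),
    hence at most half of |x|^2 + |fw x|^2. *)
Lemma is_rotation_adjoint_le i th x : P i -> sqnorm (fw i th x) <= sqnorm x.
Proof.
move=> Pi; have [_ _ _ aO iO] := rotO th Pi.
have h := dot_le x (O i th (fw i th x)).
have e : sqnorm (O i th (fw i th x)) = sqnorm (fw i th x) by rewrite !sqnormE iO.
rewrite e aO -sqnormE in h; have := ler_norm (sqnorm (fw i th x)); lra.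
Qed.

(** [H] ignores w, so the integral defining a second-block component contains the mean of a Gaussian
    coordinate as a factor. *)
Lemma hgrad_projQ c x : sqnorm (projQ (hgrad H c x)) = 0.
Proof.
rewrite /sqnorm big1// => j _; rewrite !tnth_mktuple.
suff -> : \int[gauss (M + N)]_z (H (lc 1 c x z) * tnth z (rshift M j)) = 0.
  by rewrite mulr0 expr0n.
pose ej : N.-tuple R := [tuple (j == k)%:R | k < N].
have ejE w : dot ej w = tnth w j.
  rewrite /dot (bigD1 j)//= tnth_mktuple eqxx mul1r big1 ?addr0// => k kj.
  by rewrite tnth_mktuple eq_sym (negbTE kj) mul0r.
pose e : (M + N).-tuple R := vw [tuple 0 | _ < M] ej.
have eE z : dot e z = tnth z (rshift M j).
  rewrite dotC -[LHS]/(dot z (vw _ _)) dot_vwr dotC [X in X + _]big1 ?add0r; last first.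
    by move=> k _; rewrite [tnth [tuple _ | _ < _] _]tnth_mktuple mul0r.
  by rewrite dotC ejE tnth_mktuple.
transitivity (\int[gauss (M + N)]_z (H (lc 1 c x z) * dot e z)).
  by apply: eq_Rintegral => z _; rewrite eE.
rewrite Rintegral_gauss_vw; last exact: (integrable_heat_dot mH (HK_norm e0 HeK)).
have xE : x = vw (projP x) (projQ x).
  apply: eq_from_tnth => i.
  by case: (split_ordP i) => k ->; rewrite ?tnth_vwl ?tnth_vwr tnth_mktuple.
transitivity (\int[gauss M]_v (0 : R)); last exact: Rintegral_prob_cst.
apply: eq_Rintegral => v _.
transitivity (\int[gauss N]_w (H (vw (lc 1 c (projP x) v) (projQ x)) * dot ej w)).
  apply: eq_Rintegral => w _.
  by rewrite eE tnth_vwr ejE [in LHS]xE lc_vw (HP _ _ (projQ x)).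
rewrite RintegralZl//; last exact: (integrable_dot ej 1).
by rewrite gauss_dot_mean mulr0.
Qed.

Lemma measurable_heat_rot c t i : P i -> measurable_fun setT
  (fun q : (T * M.-tuple R) * N.-tuple R => heat H c (O i q.1.1 (scale t (vw q.1.2 q.2)))).
Proof.
move=> Pi; apply: measurable_fun_heat => //.
apply: (measurableT_comp (mO Pi)
  (g := fun q : (T * M.-tuple R) * N.-tuple R => (q.1.1, scale t (vw q.1.2 q.2)))).
by msolve3.
Qed.

Lemma measurable_Psi_inner c t i : P i -> measurable_fun setT
  (fun q : T * M.-tuple R => \int[gauss N]_w heat H c (O i q.1 (scale t (vw q.2 w)))).
Proof.
move=> Pi.
exact: (@measurable_partial_Rintegral _ _ _ _ _ _ (fun q : (T * M.-tuple R) * N.-tuple R =>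
  heat H c (O i q.1.1 (scale t (vw q.1.2 q.2))))
  (measurable_heat_rot c t Pi)).
Qed.

Lemma Psi_inner_between c t i th v : P i ->
  eps <= \int[gauss N]_w heat H c (O i th (scale t (vw v w))) <= K.
Proof.
move=> Pi; apply: Rintegral_between => [|w]; last exact: (heat_between mH HeK).
exact: (measurableT_comp (g := fun w : N.-tuple R => ((th, v), w)) (measurable_heat_rot c t Pi) (ltac:(msolve3))).
Qed.

Lemma tame_Psi c t : tame P (Psi c t).
Proof.
move=> i Pi; split.
  apply: (@measurable_partial_Rintegral _ _ _ _ _ _ (fun q : T * M.-tuple R =>
    xlnx (\int[gauss N]_w heat H c (O i q.1 (scale t (vw q.2 w)))))).
  exact: (measurable_fun_xlnx (measurable_Psi_inner c t Pi)).
exists (K ^+ 2 + 1) => th; apply: le_normr_Rintegral_bounded => [|v].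
  apply: measurable_fun_xlnx.
  exact: (measurableT_comp (g := fun v : M.-tuple R => (th, v)) (measurable_Psi_inner c t Pi) (ltac:(msolve3))).
exact: (xlnx_norm e0 (Psi_inner_between c t th v Pi)).
Qed.

Section OneStep.
Variable delta : R.
Hypothesis d0 : 0 < delta.
Variables (c c' s t t' : R).
Hypotheses (c0 : 0 < c) (c1 : c <= 1) (dc : delta <= c ^+ 2)
  (s01 : 0 <= s <= 1) (scc' : s ^+ 2 + c ^+ 2 = c' ^+ 2)
  (stt' : t ^+ 2 + s ^+ 2 = t' ^+ 2).

Let D z := hgrad H c (scale t z).
Let b z := heat H c' (scale t z).
Let G i th z : R := gauss_var * sqnorm (projP (fw i th (D z))) / (2 * b z).

Let b2 z : 0 < 2 * b z.
Proof.
rewrite mulr_gt0//; have /andP[h _] := heat_between mH HeK c' (scale t z).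
exact: lt_le_trans h.
Qed.

Let mG i : P i -> measurable_fun setT (fun p : T * (M + N).-tuple R => G i p.1 p.2).
Proof.
move=> Pi; rewrite /G; apply: measurable_funM.
  apply: measurable_funM; first exact: measurable_cst.
  apply: measurable_fun_sqnorm; apply: measurable_fun_projP.
  apply: (measurableT_comp (mfw Pi) (g := fun p : T * (M + N).-tuple R => (p.1, D p.2))).
  by rewrite /D; msolve3.
apply: measurable_fun_inv => [|p]; last exact: b2.
by rewrite /b; msolve3.
Qed.

Let G0 i th z : 0 <= G i th z.
Proof.
rewrite /G divr_ge0 ?(ltW (b2 z))// mulr_ge0 ?sqnorm_ge0//.
by apply: Rintegral_ge0 => x _; exact: sqr_ge0.
Qed.

Let G_le i th z : P i -> G i th z <= fisher H c c' t z.
Proof.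
move=> Pi; rewrite /G /fisher; apply: ler_wpM2r; first by rewrite invr_ge0 (ltW (b2 z)).
apply: ler_wpM2l; first by apply: Rintegral_ge0 => x _; exact: sqr_ge0.
apply: le_trans (is_rotation_adjoint_le th (D z) Pi).
by rewrite [leRHS]sqnorm_split lerDl sqnorm_ge0.
Qed.

Let CF := (incr_const2 (M + N) K delta) ^+ 2 * \int[gauss (M + N)]_y (weight y ^+ 2) / (2 * eps).

Let GC i th z : P i -> `|G i th z| <= CF.
Proof.
move=> Pi; rewrite ger0_norm//; apply: (le_trans (G_le th z Pi)).
apply: (le_trans (ler_norm _)).
exact: (fisher_le mH e0 HeK d0 c' t c0 c1 dc).
Qed.

Let avgG z : avg Q P Lam (fun i th => G i th z) = ck * fisher H c c' t z.
Proof.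
have tG : tame P (fun i th => sqnorm (projP (fw i th (D z)))).
  move=> i Pi; split; last first.
    exists (sqnorm (D z)) => th; rewrite ger0_norm ?sqnorm_ge0//.
    apply: le_trans (is_rotation_adjoint_le th (D z) Pi).
    by rewrite [leRHS]sqnorm_split lerDl sqnorm_ge0.
  apply: measurable_fun_sqnorm; apply: measurable_fun_projP.
  exact: (measurableT_comp (mfw Pi) (g := fun th : T => (th, D z)) (ltac:(msolve3))).
transitivity (avg Q P Lam (fun i th => (gauss_var / (2 * b z)) * sqnorm (projP (fw i th (D z))))).
  by apply: eq_avg => i th _; rewrite /G; ring.
rewrite avgZ// fw_avg; last exact: hgrad_projQ.
by rewrite /fisher -/(D z) -/(b z); ring.
Qed.

Let one_rotation i th : P i ->
  Psi c t' i th - Psi c' t i th <=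
  s ^+ 2 * \int[gauss (M + N)]_z G i th z + upper_const M N eps K delta * s ^+ 3.
Proof.
move=> Pi; have rot := rotO th Pi; have [mOi gO lO aO iO] := rot.
have HK := HK_norm e0 HeK.
have mHO : measurable_fun setT (H \o O i th) by exact: measurableT_comp.
have HOeK x : eps <= (H \o O i th) x <= K by exact: HeK.
have E c1' t1 : \int[gauss M]_v xlnx (\int[gauss N]_w heat (H \o O i th) c1' (scale t1 (vw v w))) = Psi c1' t1 i th.
  apply: eq_Rintegral => v _; congr (xlnx _); apply: eq_Rintegral => w _.
  by rewrite (heat_rot mH rot).
have Gf : \int[gauss (M + N)]_z fisherP (H \o O i th) c c' t z = \int[gauss (M + N)]_z G i th z.
  rewrite -(has_law_Rintegral gO (f := G i th)); last first.
  exact: (measurableT_comp (mG Pi) (g := fun z : (M + N).-tuple R => (th, z)) (ltac:(msolve3))).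
  apply: eq_Rintegral => z _; rewrite /fisherP /G /D /b.
  by rewrite (heat_rot mH rot) (hgrad_rot mH HK rot) !(rot_scale rot).
rewrite -(E c t') -(E c' t) -Gf.
exact: (upper_step mHO e0 HOeK d0 c0 c1 dc s01 scc' stt').
Qed.

Definition avg_const : R :=
  avg1 P Lam * upper_const M N eps K delta + ck * lower_const (M + N) eps K delta.

(** [upper_step] is applied to each composite of [H] with a rotation. A change of variables by the
    rotation turns its Fisher term into one with [fw] of a fixed gradient; the average is [ck] times
    the full term, since that gradient has no second block. [lower_step] bounds the full term by the
    growth of [Phi]. *)
Lemma avg_step :
  avg Q P Lam (Psi c t') - avg Q P Lam (Psi c' t) <=
  ck * (Phi c t' - Phi c' t) + avg_const * s ^+ 3.
Proof.
pose F i th := \int[gauss (M + N)]_z G i th z.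
have tF : tame P F.
  move=> i Pi; split; last first.
    exists CF => th; apply: le_normr_Rintegral_bounded => [|z]; last exact: GC.
    exact: (measurableT_comp (mG Pi) (g := fun z : (M + N).-tuple R => (th, z)) (ltac:(msolve3))).
  exact: (@measurable_partial_Rintegral _ _ _ _ _ _ (fun p => G i p.1 p.2) (mG Pi)).
have tsF : tame P (fun i th => s ^+ 2 * F i th).
  move=> i Pi; have [mF [C FC]] := tF i Pi; split; first by msolve3.
  by exists (s ^+ 2 * C) => th; rewrite normrM ger0_norm ?sqr_ge0// ler_wpM2l// sqr_ge0.
have tUB : tame P (fun i th => s ^+ 2 * F i th + upper_const M N eps K delta * s ^+ 3).
  move=> i Pi; have [mF [C FC]] := tsF i Pi; split; first exact: (measurable_funD mF (measurable_cst _)).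
  exists (C + `|upper_const M N eps K delta * s ^+ 3|) => th.
  by apply: (le_trans (ler_normD _ _)); rewrite lerD2r.
have tL : tame P (fun i th => Psi c t' i th - Psi c' t i th).
  move=> i Pi; have [m1 [C1 h1]] := tame_Psi c t' Pi; have [m2 [C2 h2]] := tame_Psi c' t Pi.
  split; first exact: (measurable_funB m1 m2).
  by exists (C1 + C2) => th; apply: (le_trans (ler_normB _ _)); rewrite lerD.
rewrite -avgB; [|exact: tame_Psi|exact: tame_Psi].
apply: (le_trans (avg_le Q Lam0 tL tUB (fun i th Pi => one_rotation th Pi))).
rewrite avgD//; last exact: tame_cst.
rewrite avgZ// avg_cst (avg_exchange Q Lam (gauss (M + N)) mG GC).
have -> : \int[gauss (M + N)]_z avg Q P Lam (fun i th => G i th z) =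
    ck * \int[gauss (M + N)]_z fisher H c c' t z.
  rewrite -RintegralZl//; first by apply: eq_Rintegral => z _; exact: avgG.
  apply: (@integrable_bounded _ _ _ (gauss (M + N)) _ CF).
    exact: (measurable_fisher mH e0 HeK).
  by move=> z; exact: (fisher_le mH e0 HeK d0 c' t c0 c1 dc).
have arith (s2 f u l s3 A1 ph : R) : ck * (s2 * f - l * s3) <= ck * ph ->
    s2 * (ck * f) + A1 * (u * s3) <= ck * ph + (A1 * u + ck * l) * s3 by lra.
apply: arith; apply: (ler_wpM2l ck0).
exact: (lower_step mH e0 HeK d0 c0 c1 dc s01 scc' stt').
Qed.

End OneStep.
End AveragedStep.

(** * Summation of the steps *)

Section SummedSteps.
Context {R : realType} (M N : nat) d (T : measurableType d) (Q : probability T R)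
  (I : finType) (P : pred I) (Lam : I -> R).
Hypothesis Lam0 : forall i, P i -> 0 <= Lam i.
Variables (H : (M + N).-tuple R -> R) (eps K : R).
Hypotheses (mH : measurable_fun setT H) (e0 : 0 < eps)
  (HeK : forall x, eps <= H x <= K).
Hypothesis HP : forall v w w', H (vw v w) = H (vw v w').
Variables (O fw : I -> T -> (M + N).-tuple R -> (M + N).-tuple R).
Hypotheses (rotO : forall i th, P i -> is_rotation (O i th) (fw i th))
  (mO : forall i, P i -> measurable_fun setT (fun p : T * (M + N).-tuple R => O i p.1 p.2))
  (mfw : forall i, P i -> measurable_fun setT (fun p : T * (M + N).-tuple R => fw i p.1 p.2)).
Variable ck : R.
Hypothesis ck0 : 0 <= ck.
Hypothesis fw_avg : forall x, sqnorm (projQ x) = 0 ->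
  avg Q P Lam (fun i th => sqnorm (projP (fw i th x))) = ck * sqnorm x.

Let D c t := avg Q P Lam (Psi H O c t) - ck * Phi H c t.

(** All steps have the same variance h = (1 - delta) / m, so c_l^2 = 1 - l h and t_l^2 = l h.
    Stopping at c^2 = delta allows one constant for all steps, and m errors of size s^3 add up to (1
    - delta) s. *)
Lemma avg_sum (delta : R) (m : nat) : 0 < delta < 1 -> (0 < m)%N ->
  D (Num.sqrt delta) (Num.sqrt (1 - delta)) - D 1 0 <=
  avg_const M N P Lam eps K ck delta * (1 - delta) * Num.sqrt ((1 - delta) / m%:R).
Proof.
have arith (l : nat) (a b e f g q : R) : a - b <= ck * (f - g) + q ->
    (b - ck * g) - e <= l%:R * q -> (a - ck * f) - e <= l.+1%:R * q by rewrite -natr1; lra.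
move=> /andP[d0 d1] m0; set C := avg_const _ _ _ _ _ _ _ _.
have m0R : (0 : R) < m%:R by rewrite ltr0n.
pose h : R := (1 - delta) / m%:R; set s := Num.sqrt (_ / _).
have h0 : 0 <= h by rewrite divr_ge0 ?ltW// subr_gt0.
have hm : m%:R * h = 1 - delta by rewrite /h mulrC divfK// gt_eqF.
have s0 : 0 <= s by exact: sqrtr_ge0.
have s2 : s ^+ 2 = h by exact: sqr_sqrtr.
have h1 : h <= 1.
  have : 1 * h <= m%:R * h by rewrite ler_wpM2r// ler1n.
  lra.
have s1 : s <= 1 by rewrite -[leRHS]sqrtr1 ler_wsqrtr.
clearbody h s.
pose c (l : nat) := Num.sqrt (1 - l%:R * h).
pose t (l : nat) := Num.sqrt (l%:R * h).
have lm l : (l <= m)%N -> l%:R * h <= 1 - delta.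
  by move=> lm; rewrite -hm ler_wpM2r// ler_nat.
have step l : (l <= m)%N -> D (c l) (t l) - D (c 0%N) (t 0%N) <= l%:R * (C * s ^+ 3).
  elim: l => [|l IH] lm1; first by rewrite subrr mul0r.
  have lh := lm _ lm1; have lh' := lm _ (ltnW lm1).
  have l0 : 0 <= l%:R * h by rewrite mulr_ge0.
  have lS : l.+1%:R * h = l%:R * h + h by rewrite -natr1 mulrDl mul1r.
  have := IH (ltnW lm1).
  have le1 k : (k <= m)%N -> k%:R * h <= 1 by move=> /lm /le_trans; apply; rewrite lerBlDr lerDl ltW.
  have c2 : c l.+1 ^+ 2 = 1 - l.+1%:R * h by rewrite sqr_sqrtr// subr_ge0 le1.
  have := @avg_step _ M N _ _ Q _ P Lam Lam0 H eps K mH e0 HeK HP O fw rotO mO mfw ck ck0 fw_avg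
    delta d0 (c l.+1) (c l) s (t l) (t l.+1).
  rewrite -/C c2 /c /t !sqr_sqrtr ?mulr_ge0//; last by rewrite subr_ge0 le1// ltnW.
  rewrite s2 sqrtr_gt0 -/(c l.+1) -/(c l) -/(t l) -/(t l.+1) lS.
  have c1 : c l.+1 <= 1 by rewrite -[leRHS]sqrtr1 ler_wsqrtr// gerBl mulr_ge0.
  have s01 : 0 <= s <= 1 by rewrite s0.
  have p1 : 0 < 1 - (l%:R * h + h) by rewrite -lS subr_gt0 (le_lt_trans lh)// gtrBl.
  have p2 : delta <= 1 - (l%:R * h + h) by rewrite -lS lerBrDr addrC -lerBrDr.
  have p3 : h + (1 - (l%:R * h + h)) = 1 - l%:R * h by ring.
  move=> /(_ p1 c1 p2 s01 p3 erefl).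
  exact: arith.
have := step m (leqnn m).
rewrite /c /t hm mul0r subr0 sqrtr1 sqrtr0 subKr exprS s2.
by rewrite (_ : m%:R * (C * (s * h)) = C * (1 - delta) * s)//; rewrite -hm; ring.
Qed.


Let C delta := avg_const M N P Lam eps K ck delta * (1 - delta).

(** A positive excess X would satisfy X^2 <= B / m for every m. *)
Lemma avg_heat_le (delta : R) : 0 < delta < 1 ->
  D (Num.sqrt delta) (Num.sqrt (1 - delta)) <= D 1 0.
Proof.
move=> d01; rewrite -subr_le0 leNgt; apply/negP; set X := _ - _ => X0.
pose B := C delta ^+ 2 * (1 - delta).
have d1 : 0 <= 1 - delta by lra.
have B0 : 0 <= B by rewrite mulr_ge0 ?sqr_ge0.
pose m := (Num.bound (B / X ^+ 2)).+1.
have m0 : (0 : R) < m%:R by rewrite ltr0n.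
have := avg_sum d01 (m := m) isT; rewrite -/X -/(C delta) => le.
have : X ^+ 2 <= (C delta * Num.sqrt ((1 - delta) / m%:R)) ^+ 2.
  by rewrite lerXn2r// nnegrE ?(ltW X0)//; apply: le_trans le; exact: ltW.
rewrite exprMn sqr_sqrtr ?divr_ge0// mulrA -/B ler_pdivlMr// mulrC -ler_pdivlMr ?exprn_gt0//.
apply/negP; rewrite -ltNge.
have := archi_boundP (divr_ge0 B0 (sqr_ge0 X)).
move=> /lt_trans; apply; rewrite ltr_nat; exact: ltnSn.
Qed.

Let hbar := \int[gauss (M + N)]_z H z.

Lemma heat_origin z : heat H 1 (scale 0 z) = hbar.
Proof.
apply: eq_Rintegral => x _; congr H; apply: eq_from_tnth => i.
by rewrite tnth_lc tnth_scale mul0r mulr0 add0r mul1r.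
Qed.

(** At c = 1 and t = 0 the function has become the constant [hbar], on which rotations and marginals
    act trivially. *)
Lemma avg_heat_origin : D 1 0 = (avg1 P Lam - ck) * xlnx hbar.
Proof.
rewrite /D mulrBl; congr (_ - _).
  rewrite -(avg_cst Q); apply: eq_avg => i th Pi.
  rewrite /Psi -[RHS](Rintegral_prob_cst (gauss M)); apply: eq_Rintegral => v _.
  congr xlnx; rewrite -[RHS](Rintegral_prob_cst (gauss N)); apply: eq_Rintegral => w _.
  by rewrite (rot_scale (rotO th Pi)) heat_origin.
congr (_ * _); rewrite /Phi -[RHS](Rintegral_prob_cst (gauss (M + N))).
by apply: eq_Rintegral => z _; rewrite heat_origin.
Qed.

Lemma avg_heat (delta : R) : 0 < delta < 1 ->
  avg Q P Lam (Psi H O (Num.sqrt delta) (Num.sqrt (1 - delta))) <=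
  ck * Phi H (Num.sqrt delta) (Num.sqrt (1 - delta)) +
  (avg1 P Lam - ck) * xlnx (\int[gauss (M + N)]_z H z).
Proof. by move=> /avg_heat_le; rewrite avg_heat_origin /D lerBlDl. Qed.

End SummedSteps.

Lemma Rintegral_cvg_bounded {R : realType} d (T : measurableType d) (P : probability T R)
    (f_ : nat -> T -> R) (f : T -> R) (C : R) :
  (forall m, measurable_fun setT (f_ m)) -> (forall m x, `|f_ m x| <= C) ->
  (forall x, f_ m x @[m --> \oo] --> f x) ->
  \int[P]_x f_ m x @[m --> \oo] --> \int[P]_x f x.
Proof.
move=> mf fC ff; apply: fine_cvg.
have mfoo : measurable_fun setT f.
  exact: (measurable_fun_cvg mf (fun x _ => ff x)).
have fC' x : `|f x| <= C.
  have cf : `|f_ m x| @[m --> \oo] --> `|f x| by apply: cvg_norm; exact: ff.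
  by apply: (cvgr_to_le cf); apply: nearW => m.
rewrite fineK; last first.
  exact: (integrable_fin_num measurableT (@integrable_bounded _ _ _ P _ C mfoo fC')).
apply: (@dominated_cvg _ _ _ P _ measurableT (fun m x => (f_ m x)%:E) (EFin \o f) (fun _ => C%:E)).
- by move=> m; apply/measurable_EFinP.
- by move=> x _; apply: cvg_EFin; [exact: nearW|exact: ff].
- by [].
- by apply: (@integrable_bounded _ _ _ P (fun _ => C) `|C|).
- by move=> m x _; rewrite lee_fin.
Qed.

(** * Removal of the noise *)

Section EqualLaws.
Context {R : realType} (n : nat) d (U : measurableType d) (G : probability U R)
  (mu : probability (n.-tuple R) R) (X : U -> n.-tuple R) (Y : nat -> U -> n.-tuple R).
Hypotheses (mX : measurable_fun setT X) (mY : forall m, measurable_fun setT (Y m)).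
Hypotheses (lawX : forall (f : n.-tuple R -> R) (C : R), measurable_fun setT f -> (forall x, `|f x| <= C) ->
    \int[G]_p f (X p) = \int[mu]_x f x)
  (lawY : forall m (f : n.-tuple R -> R) (C : R), measurable_fun setT f -> (forall x, `|f x| <= C) ->
    \int[G]_p f (Y m p) = \int[mu]_x f x).
Hypothesis YX : forall i p, tnth (Y m p) i @[m --> \oo] --> tnth (X p) i.

Let bm (f : n.-tuple R -> R) := measurable_fun setT f /\ exists C, forall x, `|f x| <= C.

(** This tends to 0 for all bounded measurable f with values in some [0, K], continuous or not. As X
    and every Y m have the law mu, the functions with this property are closed under approximation
    in L1(mu), and indicators of rays have it. *)
Definition L1dist (f : n.-tuple R -> R) (m : nat) : R := \int[G]_p `|f (Y m p) - f (X p)|.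

Let good f := bm f /\ (forall e, 0 < e -> \forall m \near \oo, L1dist f m <= e).

Let iY f m : bm f -> G.-integrable setT (EFin \o (fun p => f (Y m p))).
Proof. by move=> [mf [C fC]]; apply: (@integrable_bounded _ _ _ G _ C) => //; exact: (measurableT_comp mf). Qed.

Let iX f : bm f -> G.-integrable setT (EFin \o (fun p => f (X p))).
Proof. by move=> [mf [C fC]]; apply: (@integrable_bounded _ _ _ G _ C) => //; exact: (measurableT_comp mf). Qed.

Let iD f m : bm f -> G.-integrable setT (EFin \o (fun p => `|f (Y m p) - f (X p)|)).
Proof.
move=> [mf [C fC]]; apply: (@integrable_bounded _ _ _ G _ (C + C)).
  apply: measurable_fun_normr; apply: measurable_funB; exact: (measurableT_comp mf).
by move=> p; rewrite normr_id; apply: (le_trans (ler_normB _ _)); exact: lerD.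
Qed.

Let bm_dist f g : bm f -> bm g -> bm (fun x => `|f x - g x|).
Proof.
move=> [mf [C fC]] [mg [D gD]]; split; first by apply: measurable_fun_normr; exact: measurable_funB.
exists (C + D) => x; rewrite normr_id; apply: (le_trans (ler_normB _ _)); exact: lerD.
Qed.

Let good_le f g h c : 0 <= c -> bm f -> good g -> good h ->
  (forall x y, `|f x - f y| <= c * (`|g x - g y| + `|h x - h y|)) -> good f.
Proof.
move=> c0 bf [bg gg] [bh gh] fgh; split=> // e e0.
pose e' := e / (2 * (c + 1)).
have c2 : 0 < 2 * (c + 1) by lra.
have e'0 : 0 < e' by rewrite divr_gt0.
have ee : c * (e' + e') <= e.
  have -> : e = 2 * (c + 1) * e' by rewrite /e' mulrC divfK// gt_eqF.
  have := e'0; nra.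
near=> m.
have hg : L1dist g m <= e' by near: m; exact: gg.
have hh : L1dist h m <= e' by near: m; exact: gh.
have : L1dist f m <= c * (L1dist g m + L1dist h m).
  have iS := integrableD measurableT (iD m bg) (iD m bh).
  rewrite /L1dist -(RintegralD measurableT (iD m bg) (iD m bh)) -(RintegralZl _ measurableT iS).
  apply: le_Rintegral => //; first exact: iD.
    exact: (integrableZl measurableT c iS).
move=> /le_trans; apply; apply: le_trans ee; apply: ler_wpM2l => //; exact: lerD.
Unshelve. all: by end_near.
Qed.

(** In the triangle inequality through g the two outer terms are integrals of |f - g| at Y m and at
    X; the common law turns both into the same integral over mu, uniformly in m. *)
Let good_approx f : bm f ->
  (forall e, 0 < e -> exists2 g, good g & \int[mu]_x `|f x - g x| <= e) -> good f.
Proof.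
move=> bf fg; split=> // e e0.
have e30 : 0 < e / 3 by lra.
have [g [bg gg] fge] := fg _ e30.
near=> m.
have hg : L1dist g m <= e / 3 by near: m; exact: gg.
have bd := bm_dist bf bg; have [md [C dC]] := bd.
have iS := integrableD measurableT (iY m bd) (iD m bg).
have : L1dist f m <= (\int[G]_p `|f (Y m p) - g (Y m p)| + L1dist g m) + \int[G]_p `|f (X p) - g (X p)|.
  rewrite /L1dist -(RintegralD measurableT (iY m bd) (iD m bg)) -(RintegralD measurableT iS (iX bd)).
  apply: le_Rintegral => //; first exact: iD.
    exact: (integrableD measurableT iS (iX bd)).
  move=> p _; set a := f _; set b := f _; set c := g _; set k := g _.
  rewrite [`|b - _|]distrC (_ : a - b = (a - c) + (c - k) + (k - b)); last by ring.
  by rewrite (le_trans (ler_normD _ _))// lerD2r ler_normD.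
rewrite (lawX md dC) (lawY m md dC) => /le_trans; apply.
have -> : e = e / 3 + e / 3 + e / 3 by lra.
by rewrite !lerD.
Unshelve. all: by end_near.
Qed.

(* [|1_U(Y) - 1_U(X)| = 2 (1_U(X) - 1_U(Y))^+ + (1_U(Y) - 1_U(X))], where the
   last term has mean zero because [X] and [Y m] have the same law, and the
   first one tends to zero pointwise because the ray [U] is open. *)
Let good_ray (a : R) (i : 'I_n) : good (fun z => (a < tnth z i)%R%:R).
Proof.
pose f (z : n.-tuple R) : R := (a < tnth z i)%R%:R.
have mf : measurable_fun setT f.
  rewrite (_ : f = fun z => if a < tnth z i then 1 else 0); last first.
    by apply/funext => z; rewrite /f; case: (_ < _).
  apply: measurable_fun_ifT; [|exact: measurable_cst|exact: measurable_cst].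
  by apply: measurable_fun_ltr; [exact: measurable_cst|msolve3].
have fC z : `|f z| <= 1 by rewrite /f; case: (_ < _); rewrite ?normr1 ?normr0.
have bf : bm f by split => //; exists 1.
split => // e e0.
pose u m p := f (X p) * (1 - f (Y m p)).
have mu_ m : measurable_fun setT (u m).
  apply: measurable_funM; first exact: (measurableT_comp mf).
  apply: measurable_funB => //; exact: (measurableT_comp mf).
have uC m p : `|u m p| <= 1.
  rewrite /u /f; do 2 case: (_ < _); rewrite ?subrr ?subr0 ?mulr0 ?mul0r ?mulr1 ?normr0 ?normr1//.
have iu m : G.-integrable setT (EFin \o u m) by exact: (@integrable_bounded _ _ _ G _ 1).
have u0 : \int[G]_p u m p @[m --> \oo] --> (0 : R).
  rewrite -(Rintegral_prob_cst G 0).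
  apply: (@Rintegral_cvg_bounded _ _ _ G u (fun _ => 0) 1) => // p.
  apply: cvg_near_cst; rewrite /u /f.
  have [aX|_] := ltP a (tnth (X p) i); last by apply: nearW => m; rewrite mul0r.
  near=> m; have -> : a < tnth (Y m p) i by near: m; exact: (cvgr_gt _ (@YX i p) _ aX).
  by rewrite subrr mulr0.
have L m : L1dist f m = 2 * \int[G]_p u m p.
  have E p : `|f (Y m p) - f (X p)| = 2 * u m p + (f (Y m p) - f (X p)).
    rewrite /u /f; do 2 case: (_ < _) => /=; rewrite ?mulr1n ?mulr0n ?subrr ?subr0 ?sub0r ?normrN ?normr1 ?normr0; lra.
  rewrite /L1dist; under eq_Rintegral do rewrite E.
  have i2 : G.-integrable setT (EFin \o (fun p => 2 * u m p)) by exact: (integrableZl measurableT _ (iu m)).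
  rewrite (RintegralD measurableT i2 (integrableB measurableT (iY m bf) (iX bf))).
  rewrite (RintegralB measurableT (iY m bf) (iX bf)) (lawX mf fC) (lawY m mf fC) subrr addr0.
  by rewrite (RintegralZl _ measurableT (iu m)).
near=> m; rewrite -/f L.
have : \int[G]_p u m p <= e / 2 by near: m; apply: (cvgr_le _ u0); lra.
lra.
Unshelve. all: by end_near.
Qed.

Let good_cst (c : R) : good (fun _ => c).
Proof.
split; first by split => //; exists `|c|.
move=> e e0; apply: nearW => m; rewrite /L1dist.
under eq_Rintegral do rewrite subrr normr0.
by rewrite Rintegral_prob_cst ltW.
Qed.

Let goodS (A : set (n.-tuple R)) := measurable A /\ good \1_A.

Let bm_indic (A : set (n.-tuple R)) : measurable A -> bm \1_A.
Proof.
move=> mA; split; first exact: measurable_indic.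
by exists 1 => x; rewrite indicE; case: (_ \in _); rewrite /= ?normr1 ?normr0.
Qed.

Let goodSU A B : goodS A -> goodS B -> goodS (A `|` B).
Proof.
move=> [mA gA] [mB gB]; split; first exact: measurableU.
apply: (good_le (c := 1) _ _ gA gB) => //; first by apply: bm_indic; exact: measurableU.
move=> x y; rewrite mul1r !indicE !in_setU.
by case: (x \in A); case: (y \in A); case: (x \in B); case: (y \in B);
  rewrite /= ?mulr1n ?mulr0n ?subrr ?subr0 ?sub0r ?normrN ?normr1 ?normr0; lra.
Qed.

Let goodSC A : goodS A -> goodS (~` A).
Proof.
move=> [mA gA]; split; first exact: measurableC.
apply: (good_le (c := 1) _ _ gA gA) => //; first by apply: bm_indic; exact: measurableC.
move=> x y; rewrite mul1r !indicE !in_setC.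
by case: (x \in A); case: (y \in A);
  rewrite /= ?mulr1n ?mulr0n ?subrr ?subr0 ?sub0r ?normrN ?normr1 ?normr0; lra.
Qed.

Let goodS0 : goodS set0.
Proof. by split => //; rewrite indic0; exact: good_cst. Qed.

Let goodS_bigcup (F : nat -> set (n.-tuple R)) : (forall k, goodS (F k)) -> goodS (\bigcup_k F k).
Proof.
move=> gF; have mF : measurable (\bigcup_k F k).
  by apply: bigcup_measurable => k _; exact: (gF k).1.
split => //; pose B k := \big[setU/set0]_(j < k) F j.
have gB k : goodS (B k).
  rewrite /B; elim: k => [|k IH]; first by rewrite big_ord0.
  by rewrite big_ord_recr; exact: goodSU.
apply: good_approx => [|e e0]; first exact: bm_indic.
have : \int[mu]_x `|\1_(\bigcup_k F k) x - \1_(B k) x| @[k --> \oo] --> (0 : R).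
  rewrite -(Rintegral_prob_cst mu 0).
  apply: (@Rintegral_cvg_bounded _ _ _ mu _ (fun _ => 0) 2) => [k|k x|x].
  - exact: (bm_dist (bm_indic mF) (bm_indic (gB k).1)).1.
  - rewrite normr_id !indicE; do 2 case: (_ \in _);
    rewrite /= ?mulr1n ?mulr0n ?subrr ?subr0 ?sub0r ?normrN ?normr1 ?normr0; lra.
  - apply: cvg_near_cst; rewrite indicE.
    have [|nx] := boolP (x \in _); last first.
      apply: nearW => k; rewrite indicE (_ : x \in B k = false) ?subrr ?normr0//.
      apply/negbTE; apply: contra nx; rewrite !inE /B -bigcup_mkord.
      by move=> [j _ Fx]; exists j.
    rewrite inE => -[j _ Fx]; exists j.+1 => // k /= jk.
    rewrite indicE (_ : x \in B k) ?subrr ?normr0//.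
    by rewrite inE /B -bigcup_mkord; exists j.
move=> /cvgr_le /(_ _ e0) [k _ /(_ k (leqnn k)) h].
by exists \1_(B k); [exact: (gB k).2|exact: h].
Qed.

(** The good sets form a sigma-algebra. Rays generate the Borel sets of each coordinate, and the
    preimages of these generate the product sigma-algebra. *)
Let goodS_measurable A : measurable A -> goodS A.
Proof.
have coord i (B : set R) : measurable B -> goodS ((@tnth n R)^~ i @^-1` B).
  move=> mB; have : (@RGenOInfty.G R).-sigma.-measurable B by rewrite -RGenOInfty.measurableE.
  apply: (@smallest_sub _ _ _ (fun B => goodS ((@tnth n R)^~ i @^-1` B))); last first.
    move=> _ [a ->]; split.
      rewrite -[X in measurable X]setTI; apply: (_ : measurable_fun setT ((@tnth n R)^~ i)) => //.
      by msolve3.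
    rewrite (_ : \1_ _ = fun z => (a < tnth z i)%R%:R); first exact: good_ray.
    apply/funext => z; rewrite indicE; congr (nat_of_bool _)%:R.
    by apply/idP/idP; rewrite inE/= in_itv/= andbT.
  split => [|C|F].
  - by rewrite preimage_set0.
  - by rewrite setTD preimage_setC; exact: goodSC.
  - by rewrite preimage_bigcup; exact: goodS_bigcup.
apply: (@smallest_sub _ _ _ goodS).
  split => [|C|F]; [exact: goodS0|by rewrite setTD; exact: goodSC|exact: goodS_bigcup].
apply: (big_ind (fun S => S `<=` goodS)) => [|S1 S2 h1 h2|i _].
- exact: sub0set.
- by rewrite subUset.
- by move=> _ [B mB <-]; rewrite setTI; exact: coord.
Qed.

(* [stairs m] rounds down, and is a sum of indicators of superlevel sets. *)
Let stairs (m : nat) (x : R) : R := \sum_(j < m) (j.+1%:R <= x)%R%:R.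

Let stairs_near m x : 0 <= x <= m%:R -> `|x - stairs m x| <= 1.
Proof.
move=> /andP[x0 xm].
(* A strengthening for the induction: the rounding is accurate up to m + 1, and the staircase stays
   at m beyond m. *)
suff [S1 [S2 [S3 S4]]] : stairs m x <= x /\ stairs m x <= m%:R /\
    (x < m%:R + 1 -> x - 1 <= stairs m x) /\ (m%:R <= x -> stairs m x = m%:R).
  by rewrite ler_norml; have := S3 ltac:(lra); lra.
rewrite {xm} /stairs; elim: m => [|m [S1 [S2 [S3 S4]]]].
  rewrite big_ord0; do !split => //; lra.
rewrite big_ord_recr/=; move: S1 S2 S3 S4; set S := \sum_(_ < m) _ => S1 S2 S3 S4.
have mm : m.+1%:R = m%:R + 1 :> R by rewrite -natr1.
have [le|lt] := leP (m.+1%:R) x; rewrite ?mulr1n ?mulr0n.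
  have := S4 ltac:(lra) => ->; rewrite mm in le *; do !split; lra.
rewrite addr0 mm; rewrite mm in lt; split=> //; split; first lra.
by split=> // _; exact: S3.
Qed.

Lemma L1dist_cvg (f : n.-tuple R -> R) (K : R) : measurable_fun setT f -> (forall x, 0 <= f x <= K) ->
  forall e, 0 < e -> \forall m \near \oo, L1dist f m <= e.
Proof.
move=> mf fK.
have fn x : `|f x| <= K by have /andP[f0] := fK x; rewrite ger0_norm.
have bf : bm f by split => //; exists K.
suff [] : good f by [].
apply: good_approx => // e e0.
(* Rounding q f down and dividing by q costs at most 1 / q <= e. The number m of stairs chosen below
   exceeds q K, so the staircase covers all values. *)
pose q : R := (Num.bound e^-1).+1%:R; have q0 : 0 < q by rewrite ltr0n.
have qe : q^-1 <= e.
  rewrite -[leRHS]invrK lef_pV2 ?posrE ?invr_gt0// /q.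
  apply: (le_trans (ltW (archi_boundP _))); first by rewrite invr_ge0 ltW.
  by rewrite ler_nat.
pose m := Num.bound (q * K).
have gst k : good (fun x => stairs k (q * f x)).
  elim: k => [|k IH].
    by rewrite (_ : (fun _ => _) = fun _ => 0); [exact: good_cst|apply/funext => x; rewrite /stairs big_ord0].
  have mq : measurable_fun setT (fun x => q * f x) by apply: measurable_funM.
  have mA : measurable [set x | (k.+1%:R <= q * f x)%R].
    rewrite -[X in measurable X]setTI -[X in _ `&` X]preimage_true.
    by apply: (measurable_fun_ler (measurable_cst _) mq).
  have gA : good (fun x => (k.+1%:R <= q * f x)%R%:R).
    rewrite (_ : (fun _ => _) = \1_[set x | (k.+1%:R <= q * f x)%R]); first exact: (goodS_measurable mA).2.
    apply/funext => x; rewrite indicE; congr (nat_of_bool _)%:R.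
    by apply/idP/idP; rewrite inE.
  rewrite (_ : (fun x => stairs k.+1 (q * f x)) = fun x => stairs k (q * f x) + (k.+1%:R <= q * f x)%R%:R); last first.
    by apply/funext => x; rewrite /stairs big_ord_recr.
  apply: (good_le (c := 1) _ _ IH gA) => //.
    have [[m1 [C1 h1]] _] := IH; have [[m2 [C2 h2]] _] := gA.
    split; first exact: measurable_funD.
    by exists (C1 + C2) => x; apply: (le_trans (ler_normD _ _)); exact: lerD.
  by move=> x y; rewrite mul1r opprD addrACA; exact: ler_normD.
have [[mg [C gC]] _] := gst m.
have bg : bm (fun x => q^-1 * stairs m (q * f x)).
  split; first exact: measurable_funM.
  by exists (q^-1 * C) => x; rewrite normrM gtr0_norm ?invr_gt0// ler_wpM2l// invr_ge0 ltW.
exists (fun x => q^-1 * stairs m (q * f x)).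
  apply: (good_le (c := q^-1) _ bg (gst m) (gst m)); first by rewrite invr_ge0 ltW.
  move=> x y; rewrite -mulrBr normrM gtr0_norm ?invr_gt0// ler_wpM2l ?invr_ge0 ?(ltW q0)//.
  by rewrite lerDl.
rewrite -[leRHS](Rintegral_prob_cst mu).
apply: le_Rintegral => //.
- by have [md [D hD]] := bm_dist bf bg; exact: (@integrable_bounded _ _ _ mu _ D).
- exact: (@integrable_bounded _ _ _ mu _ `|e|).
move=> x _; have /andP[f0 fK'] := fK x.
have -> : f x - q^-1 * stairs m (q * f x) = q^-1 * (q * f x - stairs m (q * f x)).
  by rewrite mulrBr mulKf// gt_eqF.
rewrite normrM gtr0_norm ?invr_gt0//; apply: le_trans qe.
rewrite ler_piMr ?invr_ge0 ?(ltW q0)//; apply: stairs_near.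
rewrite mulr_ge0 ?(ltW q0)//=; apply: (le_trans _ (ltW (archi_boundP _))).
  by rewrite ler_wpM2l// ltW.
by rewrite mulr_ge0 ?(ltW q0)//; exact: le_trans f0 fK'.
Qed.

End EqualLaws.

(** * Vanishing noise *)

Section OrnsteinUhlenbeck.
Context {R : realType}.

Lemma measurable_fun_projQ M N d (T : measurableType d) (f : T -> (M + N).-tuple R) :
  measurable_fun setT f -> measurable_fun setT (fun x => projQ (f x)).
Proof.
move=> mf; apply/measurable_fun_tnthP => i.
rewrite (_ : _ \o _ = fun x => tnth (f x) (rshift M i)); first by msolve3.
by apply/funext => x; rewrite /= tnth_mktuple.
Qed.

Lemma projQ_vw M N (v : M.-tuple R) (w : N.-tuple R) : projQ (vw v w) = w.
Proof. by apply: eq_from_tnth => i; rewrite tnth_mktuple tnth_vwr. Qed.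

(** For independent Gaussians z and w the vector Y m = sqrt(1 - dl) z + sqrt(dl) w has the law of z
    and tends to z. The noisy function at the scaled point is the mean of H (Y m) over w, so its
    distance to H z is at most the mean of |H (Y m) - H z|. *)
Lemma heat_L1_cvg n (H : n.-tuple R -> R) (K e : R) :
  measurable_fun setT H -> (forall x, 0 <= H x <= K) -> 0 < e ->
  exists2 delta : R, 0 < delta < 1 &
    \int[gauss n]_z `|heat H (Num.sqrt delta) (scale (Num.sqrt (1 - delta)) z) - H z| <= e.
Proof.
move=> mH HK e0.
have Hn x : `|H x| <= K by have /andP[h0 h1] := HK x; rewrite ger0_norm.
(* The factor 1/2 keeps [dl m] below 1 already for m = 0. *)
pose dl m : R := (m.+1%:R)^-1 * 2^-1.
have dl0 m : 0 < dl m by rewrite mulr_gt0// invr_gt0 ltr0n.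
have dl1 m : dl m < 1.
  have half (y : R) : y <= 1 -> y * 2^-1 < 1 by lra.
  by apply: half; rewrite invf_le1 ?ltr0n// ler1n.
have dlc : dl m @[m --> \oo] --> (0 : R).
  by rewrite -(mul0r (2^-1)); apply: cvgM; [exact: cvg_harmonic|exact: cvg_cst].
pose Y m (p : (n + n).-tuple R) := lc (Num.sqrt (1 - dl m)) (Num.sqrt (dl m)) (projP p) (projQ p).
have mP : measurable_fun setT (@projP R n n) by exact: measurable_fun_projP.
have mQ : measurable_fun setT (@projQ R n n) by exact: measurable_fun_projQ.
have mY m : measurable_fun setT (Y m) by apply: measurable_fun_lc.
have lX (f : n.-tuple R -> R) (C : R) : measurable_fun setT f -> (forall x, `|f x| <= C) ->
    \int[gauss (n + n)]_p f (projP p) = \int[gauss n]_x f x.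
  move=> mf fC; rewrite Rintegral_gauss_vw; last first.
    by apply: (@integrable_bounded _ _ _ (gauss (n + n)) _ C) => //; exact: measurableT_comp.
  apply: eq_Rintegral => v _; rewrite -[RHS](Rintegral_prob_cst (gauss n)).
  by apply: eq_Rintegral => w _; rewrite projP_vw.
have lY m (f : n.-tuple R -> R) (C : R) : measurable_fun setT f -> (forall x, `|f x| <= C) ->
    \int[gauss (n + n)]_p f (Y m p) = \int[gauss n]_x f x.
  move=> mf fC; rewrite Rintegral_gauss_vw; last first.
    by apply: (@integrable_bounded _ _ _ (gauss (n + n)) _ C) => //; exact: measurableT_comp.
  have -> : \int[gauss n]_x f x = \int[gauss n]_x f (scale 1 x).
    by apply: eq_Rintegral => x _; congr f; apply: eq_from_tnth => i; rewrite tnth_scale mul1r.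
  rewrite -(@Rgauss_conv _ n (Num.sqrt (1 - dl m)) (Num.sqrt (dl m)) 1)//; last first.
    by rewrite !sqr_sqrtr ?subr_ge0 ?(ltW (dl0 m)) ?(ltW (dl1 m))//; lra.
  rewrite Rfubini1; last first.
    apply: (@integrable_bounded_prod _ _ _ _ _ (gauss n) (gauss n)
      (fun p => f (lc (Num.sqrt (1 - dl m)) (Num.sqrt (dl m)) p.1 p.2)) C) => //.
    by msolve3.
  by apply: eq_Rintegral => v _; apply: eq_Rintegral => w _; rewrite /Y projP_vw projQ_vw.
have YX i p : tnth (Y m p) i @[m --> \oo] --> tnth (projP p : n.-tuple R) i.
  rewrite (_ : (fun m => _) = fun m => Num.sqrt (1 - dl m) * tnth (projP p : n.-tuple R) i +
      Num.sqrt (dl m) * tnth (projQ p : n.-tuple R) i); last by apply/funext => m; rewrite tnth_lc.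
  have s1 : Num.sqrt (1 - dl m) @[m --> \oo] --> (1 : R).
    have c1 : 1 - dl m @[m --> \oo] --> (1 - 0 : R) by apply: cvgB => //; exact: cvg_cst.
    rewrite subr0 in c1.
    by have := cvg_comp _ _ c1 (@sqrt_continuous R 1); rewrite sqrtr1.
  have s0 : Num.sqrt (dl m) @[m --> \oo] --> (0 : R).
    by have := cvg_comp _ _ dlc (@sqrt_continuous R 0); rewrite sqrtr0.
  have := cvgD (cvgM s1 (cvg_cst (tnth (projP p : n.-tuple R) i)))
    (cvgM s0 (cvg_cst (tnth (projQ p : n.-tuple R) i))).
  by rewrite mul1r mul0r addr0; apply.
have [m _ /(_ m (leqnn m)) hm] := L1dist_cvg mP mY lX lY YX mH HK e0.
exists (dl m); first by rewrite dl0 dl1.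
apply: le_trans hm; set a := Num.sqrt (1 - _); set b := Num.sqrt _.
have bd (x y : n.-tuple R) : `|(`|H x - H y|)| <= K + K.
  by rewrite normr_id; apply: (le_trans (ler_normB _ _)); exact: lerD.
have md : measurable_fun setT (fun q => `|H (Y m q) - H (projP q)|) by msolve3.
rewrite /L1dist Rintegral_gauss_vw; last first.
  exact: (@integrable_bounded _ _ _ (gauss (n + n)) _ (K + K) md).
have mdw z : measurable_fun setT (fun w => `|H (Y m (vw z w)) - H (projP (vw z w))|).
  exact: (measurableT_comp (g := fun w => vw z w) md (ltac:(msolve3))).
apply: le_Rintegral => //.
- apply: (@integrable_bounded _ _ _ (gauss n) _ (K + K)); first by msolve3.
  move=> z; rewrite normr_id; apply: (le_trans (ler_normB _ _)); apply: lerD => //.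
  by apply: le_normr_Rintegral_bounded => //; msolve3.
- apply: (@integrable_bounded _ _ _ (gauss n) _ (K + K)).
    apply: (@measurable_partial_Rintegral _ _ _ _ _ _
      (fun p => `|H (Y m (vw p.1 p.2)) - H (projP (vw p.1 p.2))|)).
    exact: (measurableT_comp md (@measurable_vw _ n n)).
  by move=> z; apply: le_normr_Rintegral_bounded.
move=> z _; rewrite /heat -[X in _ - X](Rintegral_prob_cst (gauss n)).
have i1 : (gauss n).-integrable setT (EFin \o (fun x => H (lc 1 b (scale a z) x))).
  by apply: (@integrable_bounded _ _ _ (gauss n) _ K) => //; msolve3.
have i2 : (gauss n).-integrable setT (EFin \o (fun x : n.-tuple R => H z)).
  exact: (@integrable_bounded _ _ _ (gauss n) _ K).
rewrite -(RintegralB measurableT i1 i2).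
have i3 : (gauss n).-integrable setT (EFin \o (fun w => `|H (Y m (vw z w)) - H (projP (vw z w))|)).
  exact: (@integrable_bounded _ _ _ (gauss n) _ (K + K) (mdw z)).
apply: (le_normr_Rintegral_dominated _ i3).
  by apply: measurable_funB; msolve3.
by move=> w; rewrite /Y projP_vw projQ_vw lc_scale.
Qed.


(** Convexity of x ln x, from ln (a / b) <= a / b - 1; for b = 0 it reads - a <= 0. *)
Lemma xlnx_tangent (a b : R) : 0 < a -> 0 <= b -> xlnx a + (1 + ln a) * (b - a) <= xlnx b.
Proof.
move=> a0; rewrite le_eqVlt => /predU1P[<-|b0]; first by rewrite /xlnx; lra.
have h : 1 + ln (a / b) <= a / b.
  by rewrite -[leRHS]lnK ?posrE ?divr_gt0// expR_ge1Dx.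
rewrite ln_div ?posrE// in h.
have := ler_wpM2l (ltW b0) h; rewrite mulrCA divff ?gt_eqF// mulr1 /xlnx; lra.
Qed.

Definition xlnx_lip (eps K : R) : R := 1 + `|ln eps| + `|ln K|.

Lemma xlnx_lipschitz (eps K a b : R) : 0 < eps -> eps <= a <= K -> eps <= b <= K ->
  `|xlnx a - xlnx b| <= xlnx_lip eps K * `|a - b|.
Proof.
move=> e0 aK bK; have lip x y : eps <= x <= K -> eps <= y <= K ->
    xlnx x - xlnx y <= xlnx_lip eps K * `|x - y|.
  move=> /andP[ex xK] /andP[ey yK]; have x0 := lt_le_trans e0 ex.
  have y0 := lt_le_trans e0 ey; have K0 := lt_le_trans x0 xK.
  have h := xlnx_tangent x0 (ltW y0).
  have l : `|1 + ln x| <= xlnx_lip eps K.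
    rewrite /xlnx_lip -addrA; apply: (le_trans (ler_normD _ _)); rewrite normr1 lerD2l.
    have l1 : ln eps <= ln x by rewrite ler_ln ?posrE.
    have l2 : ln x <= ln K by rewrite ler_ln ?posrE.
    rewrite ler_norml; have := ler_norm (ln K); have := ler_norm (- ln eps); rewrite normrN.
    have := normr_ge0 (ln K); have := normr_ge0 (ln eps); lra.
  have := ler_wpM2r (normr_ge0 (x - y)) l; rewrite -normrM.
  have := ler_norm ((1 + ln x) * (x - y)); lra.
rewrite ler_norml; have := lip _ _ aK bK; have := lip _ _ bK aK; rewrite distrC; lra.
Qed.

End OrnsteinUhlenbeck.

Section AveragedEntropy.
Context {R : realType} (M N : nat) d (T : measurableType d) (Q : probability T R)
  (I : finType) (P : pred I) (Lam : I -> R).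
Hypothesis Lam0 : forall i, P i -> 0 <= Lam i.
Variables (H : (M + N).-tuple R -> R) (eps K : R).
Hypotheses (mH : measurable_fun setT H) (e0 : 0 < eps)
  (HeK : forall x, eps <= H x <= K).
Hypothesis HP : forall v w w', H (vw v w) = H (vw v w').
Variables (O fw : I -> T -> (M + N).-tuple R -> (M + N).-tuple R).
Hypotheses (rotO : forall i th, P i -> is_rotation (O i th) (fw i th))
  (mO : forall i, P i -> measurable_fun setT (fun p : T * (M + N).-tuple R => O i p.1 p.2))
  (mfw : forall i, P i -> measurable_fun setT (fun p : T * (M + N).-tuple R => fw i p.1 p.2)).
Variable ck : R.
Hypothesis ck0 : 0 <= ck.
Hypothesis fw_avg : forall x, sqnorm (projQ x) = 0 ->
  avg Q P Lam (fun i th => sqnorm (projP (fw i th x))) = ck * sqnorm x.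

Definition Psi0 (i : I) (th : T) : R :=
  \int[gauss M]_v xlnx (\int[gauss N]_w H (O i th (vw v w))).

Let HK := HK_norm e0 HeK.

Let mHO i : P i -> measurable_fun setT
  (fun q : (T * M.-tuple R) * N.-tuple R => H (O i q.1.1 (vw q.1.2 q.2))).
Proof.
move=> Pi; apply: (measurableT_comp mH).
apply: (measurableT_comp (mO Pi)
  (g := fun q : (T * M.-tuple R) * N.-tuple R => (q.1.1, vw q.1.2 q.2))).
by msolve3.
Qed.

Let mHOv i th v : P i -> measurable_fun setT (fun w => H (O i th (vw v w))).
Proof.
move=> Pi; exact: (measurableT_comp (g := fun w : N.-tuple R => ((th, v), w)) (mHO Pi) (ltac:(msolve3))).
Qed.

Let m_inner i : P i -> measurable_fun setT
  (fun q : T * M.-tuple R => \int[gauss N]_w H (O i q.1 (vw q.2 w))).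
Proof.
move=> Pi.
exact: (@measurable_partial_Rintegral _ _ _ _ _ _ (fun q : (T * M.-tuple R) * N.-tuple R =>
  H (O i q.1.1 (vw q.1.2 q.2))) (mHO Pi)).
Qed.

Let m_innerv i th : P i -> measurable_fun setT (fun v => \int[gauss N]_w H (O i th (vw v w))).
Proof.
move=> Pi; exact: (measurableT_comp (g := fun v : M.-tuple R => (th, v)) (m_inner Pi) (ltac:(msolve3))).
Qed.

Let inner_between i th v : P i -> eps <= \int[gauss N]_w H (O i th (vw v w)) <= K.
Proof. by move=> Pi; apply: Rintegral_between => [|w]; [exact: mHOv|exact: HeK]. Qed.

Lemma tame_Psi0 : tame P Psi0.
Proof.
move=> i Pi; split.
  apply: (@measurable_partial_Rintegral _ _ _ _ _ _ (fun q : T * M.-tuple R =>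
    xlnx (\int[gauss N]_w H (O i q.1 (vw q.2 w))))).
  exact: (measurable_fun_xlnx (m_inner Pi)).
exists (K ^+ 2 + 1) => th; apply: le_normr_Rintegral_bounded => [|v].
  exact: (measurable_fun_xlnx (m_innerv th Pi)).
exact: (xlnx_norm e0 (inner_between th v Pi)).
Qed.

Section Noise.
Variables c t : R.
Let dist z := `|heat H c (scale t z) - H z|.
Let w0 := \int[gauss (M + N)]_z dist z.

Let mdist : measurable_fun setT dist. Proof. by rewrite /dist; msolve3. Qed.

Let distC z : `|dist z| <= K + K.
Proof.
rewrite normr_id; apply: (le_trans (ler_normB _ _)); apply: lerD; last exact: HK.
exact: (heat_norm mH e0 HeK).
Qed.

(** Marginals do not increase the L1 distance and the rotation preserves the Gaussian, so the
    unrotated distance [w0] serves all rotations at once. *)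
Lemma Psi_dist i th : P i -> `|Psi H O c t i th - Psi0 i th| <= xlnx_lip eps K * w0.
Proof.
move=> Pi; have [mOi gO lO aO iO] := rotO th Pi.
pose A v := \int[gauss N]_w heat H c (O i th (scale t (vw v w))).
pose B v := \int[gauss N]_w H (O i th (vw v w)).
have bA v : eps <= A v <= K by exact: (Psi_inner_between mH HeK mO c t th v Pi).
have bB v : eps <= B v <= K by exact: inner_between.
have mA : measurable_fun setT A.
  exact: (measurableT_comp (g := fun v : M.-tuple R => (th, v)) (measurable_Psi_inner mH mO c t Pi) (ltac:(msolve3))).
have mB : measurable_fun setT B by exact: m_innerv.
have ix f : measurable_fun setT f -> (forall v, eps <= f v <= K) ->
    (gauss M).-integrable setT (EFin \o (fun v => xlnx (f v))).
  move=> mf fK; apply: (@integrable_bounded _ _ _ (gauss M) _ (K ^+ 2 + 1)).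
    exact: (measurable_fun_xlnx mf).
  by move=> v; exact: (xlnx_norm e0 (fK v)).
pose E z := dist (O i th z).
have mE : measurable_fun setT E by exact: measurableT_comp.
have mEv v : measurable_fun setT (fun w => E (vw v w)).
  exact: (measurableT_comp (g := fun w => vw v w) mE (ltac:(msolve3))).
have iEv v : (gauss N).-integrable setT (EFin \o (fun w => E (vw v w))).
  by apply: (@integrable_bounded _ _ _ (gauss N) _ (K + K)) => // w; exact: distC.
have mEi : measurable_fun setT (fun v => \int[gauss N]_w E (vw v w)).
  apply: (@measurable_partial_Rintegral _ _ _ _ _ _ (fun p => E (vw p.1 p.2))).
  exact: (measurableT_comp mE (@measurable_vw _ M N)).
have iEi : (gauss M).-integrable setT (EFin \o (fun v => \int[gauss N]_w E (vw v w))).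
  apply: (@integrable_bounded _ _ _ (gauss M) _ (K + K)) => // v.
  by apply: le_normr_Rintegral_bounded => // w; exact: distC.
have AB v : `|A v - B v| <= \int[gauss N]_w E (vw v w).
  have mh : measurable_fun setT (fun w => heat H c (O i th (scale t (vw v w)))).
    exact: (measurableT_comp (g := fun w : N.-tuple R => ((th, v), w)) (measurable_heat_rot mH mO c t Pi) (ltac:(msolve3))).
  have i1 : (gauss N).-integrable setT (EFin \o (fun w => heat H c (O i th (scale t (vw v w))))).
    by apply: (@integrable_bounded _ _ _ (gauss N) _ K) => // w; exact: (heat_norm mH e0 HeK).
  have i2 : (gauss N).-integrable setT (EFin \o (fun w => H (O i th (vw v w)))).
    apply: (@integrable_bounded _ _ _ (gauss N) _ K); first exact: mHOv.
    by move=> w; exact: HK.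
  rewrite /A /B -(RintegralB measurableT i1 i2).
  apply: (le_normr_Rintegral_dominated _ (iEv v)); first exact: (measurable_funB mh (mHOv th v Pi)).
  by move=> w; rewrite (rot_scale (rotO th Pi)).
have E0 : w0 = \int[gauss M]_v \int[gauss N]_w E (vw v w).
  rewrite -Rintegral_gauss_vw; last first.
    by apply: (@integrable_bounded _ _ _ (gauss (M + N)) _ (K + K)) => // z; exact: distC.
  by rewrite /w0 -(has_law_Rintegral gO mdist).
have conv (x y x' y' r : R) : x = x' -> y = y' -> `|x' - y'| <= r -> `|x - y| <= r by move=> -> ->.
apply: (conv _ _ (\int[gauss M]_v xlnx (A v)) (\int[gauss M]_v xlnx (B v)) _ erefl erefl).
rewrite -(RintegralB measurableT (ix _ mA bA) (ix _ mB bB)) E0.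
rewrite -(RintegralZl _ measurableT iEi).
apply: (le_normr_Rintegral_dominated _ (integrableZl measurableT _ iEi)).
  exact: (measurable_funB (measurable_fun_xlnx mA) (measurable_fun_xlnx mB)).
move=> v; apply: (le_trans (xlnx_lipschitz e0 (bA v) (bB v))).
by apply: ler_wpM2l; [rewrite /xlnx_lip !addr_ge0|exact: AB].
Qed.

Lemma Phi_dist : `|Phi H c t - \int[gauss (M + N)]_z xlnx (H z)| <= xlnx_lip eps K * w0.
Proof.
have bA z : eps <= heat H c (scale t z) <= K by exact: (heat_between mH HeK).
have ix f : measurable_fun setT f -> (forall v, eps <= f v <= K) ->
    (gauss (M + N)).-integrable setT (EFin \o (fun v => xlnx (f v))).
  move=> mf fK; apply: (@integrable_bounded _ _ _ (gauss (M + N)) _ (K ^+ 2 + 1)).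
    exact: (measurable_fun_xlnx mf).
  by move=> v; exact: (xlnx_norm e0 (fK v)).
have mh : measurable_fun setT (fun z => heat H c (scale t z)) by msolve3.
have id : (gauss (M + N)).-integrable setT (EFin \o dist).
  exact: (@integrable_bounded _ _ _ (gauss (M + N)) _ (K + K)).
rewrite /Phi -(RintegralB measurableT (ix _ mh bA) (ix _ mH HeK)).
rewrite -(RintegralZl _ measurableT id).
apply: (le_normr_Rintegral_dominated _ (integrableZl measurableT _ id)).
  exact: (measurable_funB (measurable_fun_xlnx mh) (measurable_fun_xlnx mH)).
by move=> z; exact: (xlnx_lipschitz e0 (bA z) (HeK z)).
Qed.

End Noise.

Lemma avg_entropy_le : avg Q P Lam Psi0 <=
  ck * \int[gauss (M + N)]_z xlnx (H z) +
  (avg1 P Lam - ck) * xlnx (\int[gauss (M + N)]_z H z).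
Proof.
have arith (p0 p1 ph w s a b e : R) :
    p1 <= ck * ph + (s - ck) * b -> p0 <= p1 + s * w -> ck * ph <= ck * (a + w) ->
    (s + ck) * w <= e -> p0 <= ck * a + (s - ck) * b + e by lra.
have L0 : 0 <= xlnx_lip eps K by rewrite /xlnx_lip !addr_ge0.
have A0 : 0 <= avg1 P Lam := avg1_ge0 Lam0.
apply/ler_addgt0Pr => e ee0.
(* The noise is chosen so small that the errors on both sides, weighted by [avg1] and [ck], total at
   most e; the + 1 keeps L positive. *)
pose L := (avg1 P Lam + ck) * xlnx_lip eps K + 1.
have LL : 0 < L by rewrite ltr_wpDl// mulr_ge0// addr_ge0.
have H0K x : 0 <= H x <= K by have /andP[h1 ->] := HeK x; rewrite andbT (le_trans (ltW e0)).
have [delta d01 hd] := heat_L1_cvg mH H0K (divr_gt0 ee0 LL).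
have l0 := avg_heat Lam0 mH e0 HeK HP rotO mO mfw ck0 fw_avg d01.
set c := Num.sqrt delta in hd l0; set t := Num.sqrt (1 - delta) in hd l0.
have h1 := ler_wpM2l L0 hd.
have tP := tame_Psi mH e0 HeK mO c t.
have l1 : avg Q P Lam Psi0 <= avg Q P Lam (Psi H O c t) + avg1 P Lam * (xlnx_lip eps K * (e / L)).
  rewrite -(avg_cst Q) -avgD//; last exact: tame_cst.
  apply: (avg_le _ Lam0) => [||i th Pi]; first exact: tame_Psi0.
    move=> i Pi; have [m1 [C1 k1]] := tP i Pi; split.
      exact: (measurable_funD m1 (measurable_cst _)).
    exists (C1 + `|xlnx_lip eps K * (e / L)|) => th.
    by apply: (le_trans (ler_normD _ _)); rewrite lerD2r.
  have := Psi_dist c t th Pi; rewrite ler_norml => /andP[k1 _].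
  rewrite -lerBlDl -opprB lerNl; apply: le_trans k1; rewrite lerN2; exact: h1.
have l2 : Phi H c t <= \int[gauss (M + N)]_z xlnx (H z) + xlnx_lip eps K * (e / L).
  have := Phi_dist c t; rewrite ler_norml => /andP[_ k1].
  by rewrite -lerBlDl; apply: (le_trans k1).
have l3 : (avg1 P Lam + ck) * (xlnx_lip eps K * (e / L)) <= e.
  rewrite !mulrA ler_pdivrMr// [leRHS]mulrC ler_wpM2r ?(ltW ee0)//.
  by rewrite /L lerDl.
exact: (arith _ _ _ _ _ _ _ _ l0 l1 (ler_wpM2l ck0 l2) l3).
Qed.

End AveragedEntropy.

(** * Jensen's inequality and truncation *)

Section Jensen.
Context {R : realType} d (T : measurableType d) d' (U : measurableType d')
  (Q : probability T R) (G : probability U R)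
  (I : finType) (P : pred I) (Lam : I -> R).
Hypothesis Lam0 : forall i, P i -> 0 <= Lam i.
Hypotheses (A0 : 0 < avg1 P Lam) (A1 : avg1 P Lam <= 1).
Variables (f : I -> T -> U -> R) (eps K : R).
Hypotheses (mf : forall i, P i -> measurable_fun setT (fun p : T * U => f i p.1 p.2))
  (e0 : 0 < eps) (feK : forall i th v, P i -> eps <= f i th v <= K).

Let mfv i v : P i -> measurable_fun setT (fun th => f i th v).
Proof. by move=> Pi; exact: (measurableT_comp (g := fun th : T => (th, v)) (mf Pi) (ltac:(msolve3))). Qed.

Let fn i th v : P i -> `|f i th v| <= K.
Proof. by move=> Pi; have /andP[h1 h2] := feK th v Pi; rewrite ger0_norm// (le_trans (ltW e0)). Qed.

Let tf v : tame P (fun i th => f i th v).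
Proof. by move=> i Pi; split; [exact: mfv|exists K => th; exact: fn]. Qed.

Let tx v : tame P (fun i th => xlnx (f i th v)).
Proof.
move=> i Pi; split; first exact: (measurable_fun_xlnx (mfv v Pi)).
by exists (K ^+ 2 + 1) => th; exact: (xlnx_norm e0 (feK th v Pi)).
Qed.

Lemma avg_between v : avg1 P Lam * eps <= avg Q P Lam (fun i th => f i th v) <= avg1 P Lam * K.
Proof.
rewrite -!(avg_cst Q); apply/andP; split; apply: (avg_le _ Lam0) => //; try exact: tame_cst.
  by move=> i th Pi; have /andP[] := feK th v Pi.
by move=> i th Pi; have /andP[] := feK th v Pi.
Qed.

Let X v := avg Q P Lam (fun i th => f i th v).

Lemma measurable_avg : measurable_fun setT X.
Proof.
rewrite /X /avg; under eq_fun do rewrite big_mkcond.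
apply: measurable_sum => i; case: (P i) (@mf i) => [/(_ isT) mfi|_]; last exact: measurable_cst.
apply: measurable_funM; first exact: measurable_cst.
apply: (@measurable_partial_Rintegral _ _ _ _ _ _ (fun p => f i p.2 p.1)).
exact: (measurableT_comp mfi (g := fun p : U * T => (p.2, p.1)) (ltac:(msolve3))).
Qed.

(** The tangent at the average a is averaged. With total weight S = [avg1 P Lam] this gives [xlnx a]
    + (1 - S) a, so the missing mass helps when S <= 1; S > 0 makes a positive. *)
Lemma xlnx_avg v : xlnx (X v) <= avg Q P Lam (fun i th => xlnx (f i th v)).
Proof.
set a := X v; have a0 : 0 < a.
  by have /andP[h _] := avg_between v; apply: lt_le_trans h; rewrite mulr_gt0.
have aE : avg Q P Lam (fun i th => (1 + ln a) * f i th v) = (1 + ln a) * a by rewrite avgZ.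
have tl : tame P (fun i th => (1 + ln a) * f i th v).
  move=> i Pi; split; first exact: (measurable_funM (measurable_cst _) (mfv v Pi)).
  by exists (`|1 + ln a| * K) => th; rewrite normrM ler_wpM2l//; exact: fn.
have tl2 : tame P (fun i th => (1 + ln a) * f i th v + (xlnx a - (1 + ln a) * a)).
  move=> i Pi; have [m1 [C1 h1]] := tl i Pi; split; first exact: (measurable_funD m1 (measurable_cst _)).
  exists (C1 + `|xlnx a - (1 + ln a) * a|) => th.
  by apply: (le_trans (ler_normD _ _)); rewrite lerD2r.
have : avg Q P Lam (fun i th => (1 + ln a) * f i th v + (xlnx a - (1 + ln a) * a)) <=
    avg Q P Lam (fun i th => xlnx (f i th v)).
  apply: (avg_le _ Lam0) => // i th Pi; have /andP[h1 h2] := feK th v Pi.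
  by have := xlnx_tangent a0 (le_trans (ltW e0) h1); lra.
rewrite avgD//; last exact: tame_cst.
rewrite aE avg_cst; apply: le_trans.
have : 0 <= (1 - avg1 P Lam) * a by rewrite mulr_ge0 ?subr_ge0// ltW.
rewrite /xlnx; lra.
Qed.

Lemma jensen_avg : \int[G]_v xlnx (X v) <=
  avg Q P Lam (fun i th => \int[G]_v xlnx (f i th v)).
Proof.
have mx i : P i -> measurable_fun setT (fun p : T * U => xlnx (f i p.1 p.2)).
  by move=> Pi; exact: (measurable_fun_xlnx (mf Pi)).
have bx i th v : P i -> `|xlnx (f i th v)| <= K ^+ 2 + 1.
  by move=> Pi; exact: (xlnx_norm e0 (feK th v Pi)).
rewrite (avg_exchange Q Lam G mx bx).
have e1 : 0 < avg1 P Lam * eps by exact: mulr_gt0.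
apply: le_Rintegral => //.
- apply: (@integrable_bounded _ _ _ G _ ((avg1 P Lam * K) ^+ 2 + 1)).
    exact: (measurable_fun_xlnx measurable_avg).
  by move=> v; exact: (xlnx_norm e1 (avg_between v)).
- apply: (@integrable_bounded _ _ _ G _ (avg1 P Lam * (K ^+ 2 + 1))).
    rewrite /avg; under eq_fun do rewrite big_mkcond.
    apply: measurable_sum => i; case: (P i) (mx i) => [/(_ isT) mxi|_]; last exact: measurable_cst.
    apply: measurable_funM; first exact: measurable_cst.
    apply: (@measurable_partial_Rintegral _ _ _ _ _ _ (fun p => xlnx (f i p.2 p.1))).
    exact: (measurableT_comp mxi (g := fun p : U * T => (p.2, p.1)) (ltac:(msolve3))).
  move=> v; rewrite /avg /avg1 mulr_suml; apply: (le_trans (ler_norm_sum _ _ _)).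
  apply: ler_sum => i Pi; rewrite normrM ger0_norm ?Lam0//.
  apply: (ler_wpM2l (Lam0 Pi)); apply: le_normr_Rintegral_bounded => [|th]; last exact: bx.
  exact: (measurable_fun_xlnx (mfv v Pi)).
by move=> v _; exact: xlnx_avg.
Qed.

End Jensen.

Section XlnxLimits.
Context {R : realType}.

(** From ln (1 / s) <= 1 / s - 1 at s = sqrt x. The bound tends to 0 with x, which gives continuity
    of x ln x at 0. *)
Lemma xlnx_ge_sqrt (x : R) : 0 <= x -> - (2 * Num.sqrt x) <= xlnx x.
Proof.
rewrite le_eqVlt => /predU1P[<-|x0]; first by rewrite /xlnx sqrtr0; lra.
set s := Num.sqrt x; have s0 : 0 < s by rewrite sqrtr_gt0.
have xE : x = s ^+ 2 by rewrite sqr_sqrtr// ltW.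
have h : 1 + ln s^-1 <= s^-1 by rewrite -[leRHS]lnK ?posrE ?invr_gt0// expR_ge1Dx.
rewrite lnV ?posrE// in h.
have h2 := ler_wpM2l (ltW (exprn_gt0 2 s0)) h.
have e : s ^+ 2 * s^-1 = s by rewrite expr2 mulfK// gt_eqF.
rewrite e in h2.
rewrite /xlnx xE lnXn// -mulr_natr; have := sqr_ge0 s; lra.
Qed.

Lemma xlnx_cvg (u : nat -> R) (x : R) : (forall j, 0 <= u j) ->
  u j @[j --> \oo] --> x -> xlnx (u j) @[j --> \oo] --> xlnx x.
Proof.
move=> u0 ux; have x0 : 0 <= x by apply: (cvgr_to_ge ux); apply: nearW.
move: x0; rewrite le_eqVlt => /predU1P[x0|x0]; last first.
  by rewrite /xlnx; apply: cvgM => //; apply: (cvg_comp _ _ ux); exact: continuous_ln.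
rewrite -x0 in ux *; rewrite /xlnx mul0r.
apply: (@squeeze_cvgr _ _ _ _ (fun j => - (2 * Num.sqrt (u j))) (fun j => u j * (u j - 1))).
- by apply: nearW => j; rewrite xlnx_ge_sqrt//= xlnx_le.
- have := cvgN (cvgM (cvg_cst (2 : R)) (cvg_comp _ _ ux (@sqrt_continuous R 0))).
  by rewrite sqrtr0 mulr0 oppr0; apply.
- have := cvgM ux (cvgB ux (cvg_cst (1 : R))).
  by rewrite mul0r; apply.
Qed.

(** A majorant for truncations. Above 1 the function is increasing, and the tangent at x + 1 shows
    that passing from x to x + 1 costs at most 1 + ln (x + 1) <= 1 + x. *)
Lemma xlnx_dominated (x y : R) : 0 <= x -> 0 <= y <= x + 1 -> `|xlnx y| <= xlnx x + x + 3.
Proof.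
move=> x0 /andP[y0 yx]; have g := xlnx_ge x0.
have x1 : 0 < x + 1 by lra.
have t := xlnx_tangent x1 x0.
have l : ln (x + 1) <= x.
  have : 1 + ln (x + 1) <= x + 1 by rewrite -[leRHS]lnK ?posrE// expR_ge1Dx.
  lra.
have gy := xlnx_ge y0.
suff : xlnx y <= xlnx x + x + 3 by rewrite ler_norml; lra.
have [y1|y1] := leP y 1.
  have := xlnx_le y0; have : y * (y - 1) <= 0 by rewrite mulr_ge0_le0//; lra.
  lra.
have : xlnx y <= xlnx (x + 1).
  by rewrite /xlnx ler_pM// ?ln_ge0 ?(ltW y1)// ler_ln ?posrE//; lra.
lra.
Qed.

End XlnxLimits.

Section LimitLemmas.
Context {R : realType} d (T : measurableType d).

Lemma integral_cvg_nd (P : {measure set T -> \bar R}) (g : nat -> T -> \bar R) (f : T -> \bar R) :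
  (forall n, measurable_fun setT (g n)) -> (forall n x, 0 <= g n x)%E ->
  (forall x n m, (n <= m)%N -> (g n x <= g m x)%E) ->
  (forall x, g n x @[n --> \oo] --> f x) ->
  (\int[P]_x g n x @[n --> \oo] --> \int[P]_x f x)%E.
Proof.
move=> mg g0 nd gf.
have := @cvg_monotone_convergence _ _ _ P setT measurableT g mg (fun n x _ => g0 n x) (fun x _ n m => nd x n m).
suff -> : (\int[P]_x limn (g^~ x) = \int[P]_x f x)%E by [].
by apply: eq_integral => x _; exact: cvg_lim.
Qed.

Lemma limn_einf_le (u r : nat -> \bar R) (l : \bar R) :
  (forall n, u n <= r n)%E -> r n @[n --> \oo] --> l -> (limn_einf u <= l)%E.
Proof.
move=> ur rl; rewrite limn_einf_lim -(cvg_lim (@ereal_hausdorff R) rl).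
apply: lee_lim; [exact: is_cvg_einfs|by apply/cvg_ex; exists l|].
apply: nearW => n; apply: le_trans (ur n); apply: ereal_inf_lbound.
by exists n => //=.
Qed.

(** The pointwise limits may be infinite, with g only below them: where an averaged density is
    infinite, its [fine] value is compared with +oo. *)
Lemma fatou_le (P : {measure set T -> \bar R}) (u : nat -> T -> R) (g : T -> R) (B : nat -> R) (l : R) :
  (forall n, measurable_fun setT (u n)) -> (forall n x, 0 <= u n x) ->
  measurable_fun setT g -> (forall x, 0 <= g x) ->
  (forall x, exists2 L, ((u n x)%:E @[n --> \oo] --> L) & ((g x)%:E <= L)%E) ->
  (forall n, \int[P]_x (u n x)%:E <= (B n)%:E)%E -> B n @[n --> \oo] --> l ->
  (\int[P]_x (g x)%:E <= l%:E)%E.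
Proof.
move=> mu u0 mg g0 ug uB Bl.
have mEu n : measurable_fun setT (fun x => (u n x)%:E) by exact/measurable_EFinP.
have := @fatou _ _ _ P setT measurableT (fun n x => (u n x)%:E) mEu
  (fun n x _ => ltac:(by rewrite lee_fin)).
have leg x : ((g x)%:E <= limn_einf (fun n => (u n x)%:E))%E.
  have [L uL gL] := ug x; rewrite is_cvg_limn_einfE; last by apply/cvg_ex; exists L.
  by rewrite (cvg_lim (@ereal_hausdorff R) uL).
move=> F; apply: (@le_trans _ _ (\int[P]_x limn_einf (fun n => (u n x)%:E))%E).
  apply: ge0_le_integral => //.
  - by move=> x _; rewrite lee_fin.
  - exact/measurable_EFinP.
  - apply: (@emeasurable_fun_cvg _ _ _ setT (fun n x => (u n x)%:E)) => // x _.
    have [L uL _] := ug x; rewrite is_cvg_limn_einfE; last by apply/cvg_ex; exists L.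
    by rewrite (cvg_lim (@ereal_hausdorff R) uL).
apply: (le_trans F); apply: (limn_einf_le uB).
by apply: cvg_EFin => //; exact: nearW.
Qed.

Lemma EFin_Rintegral (P : probability T R) (f : T -> R) (C : R) :
  measurable_fun setT f -> (forall x, `|f x| <= C) ->
  (\int[P]_x f x)%:E = (\int[P]_x (f x)%:E)%E.
Proof.
move=> mf fC; rewrite /Rintegral fineK//.
exact: (integrable_fin_num measurableT (@integrable_bounded _ _ _ P _ C mf fC)).
Qed.

Lemma Rintegral_cvg_dominated (P : {measure set T -> \bar R}) (f_ : nat -> T -> R) (f g : T -> R) :
  (forall m, measurable_fun setT (f_ m)) -> measurable_fun setT f ->
  P.-integrable setT (EFin \o g) -> (forall m x, `|f_ m x| <= g x) ->
  (forall x, f_ m x @[m --> \oo] --> f x) ->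
  \int[P]_x f_ m x @[m --> \oo] --> \int[P]_x f x.
Proof.
move=> mf_ mf ig fg ff; apply: fine_cvg.
have fg' x : `|f x| <= g x.
  have cf : `|f_ m x| @[m --> \oo] --> `|f x| by apply: cvg_norm; exact: ff.
  by apply: (cvgr_to_le cf); apply: nearW => m.
rewrite fineK; last first.
  exact: (integrable_fin_num measurableT (integrable_dominated mf ig fg')).
apply: (@dominated_cvg _ _ _ P _ measurableT (fun m x => (f_ m x)%:E) (EFin \o f) (EFin \o g)) => //.
- by move=> m; apply/measurable_EFinP.
- by move=> x _; apply: cvg_EFin; [exact: nearW|exact: ff].
- by move=> m x _; rewrite lee_fin.
Qed.

End LimitLemmas.

(** * Truncation of the initial density *)

Section Truncation.
Context {R : realType} d (T : measurableType d) d' (W : measurableType d')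
  (Q : probability T R) (G : probability W R)
  (I : finType) (P : pred I) (Lam : I -> R).
Hypothesis Lam0 : forall i, P i -> 0 <= Lam i.
Variable a : I -> T -> W -> R.
Hypotheses (ma : forall i, P i -> measurable_fun setT (fun p : T * W => a i p.1 p.2))
  (a0 : forall i th w, 0 <= a i th w).

(** The minimum is monotone in j, for monotone convergence; the added constant keeps the values away
    from 0 and splits off every integral. *)
Definition trunc (j : nat) (x : R) : R := Num.min x j%:R + j.+1%:R^-1.

Lemma trunc_between j x : 0 <= x -> j.+1%:R^-1 <= trunc j x <= j%:R + 1.
Proof.
move=> x0; have h : j.+1%:R^-1 <= 1 :> R by rewrite invf_le1 ?ltr0n// ler1n.
rewrite /trunc lerDr le_min x0 ler0n/=; apply: lerD => //.
by rewrite ge_min lexx orbT.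
Qed.

Lemma trunc_le j x : 0 <= x -> trunc j x <= x + 1.
Proof.
move=> x0; have h : j.+1%:R^-1 <= 1 :> R by rewrite invf_le1 ?ltr0n// ler1n.
by apply: lerD => //; rewrite ge_min lexx.
Qed.

Let min_cvg (x : R) : (Num.min x j%:R) @[j --> \oo] --> x.
Proof.
apply: cvg_near_cst; exists (Num.bound x) => // j /= xj.
apply/min_idPl; have [x0|x0] := leP 0 x; last by apply: (le_trans (ltW x0)).
by apply: (le_trans (ltW (archi_boundP x0))); rewrite ler_nat.
Qed.

Lemma trunc_cvg (x : R) : trunc j x @[j --> \oo] --> x.
Proof.
have := cvgD (@min_cvg x) (@cvg_harmonic R).
by rewrite addr0; apply.
Qed.

Lemma measurable_fun_trunc d1 (U : measurableType d1) (f : U -> R) j :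
  measurable_fun setT f -> measurable_fun setT (fun x => trunc j (f x)).
Proof.
move=> mf; apply: measurable_funD; last exact: measurable_cst.
exact: (measurable_minr mf (measurable_cst _)).
Qed.

Let E j i : \bar R := (\int[Q]_th \int[G]_w (Num.min (a i th w) j%:R)%:E)%E.

Let mmin j i : P i -> measurable_fun setT (fun p : T * W => Num.min (a i p.1 p.2) j%:R).
Proof. by move=> Pi; exact: (measurable_minr (ma Pi) (measurable_cst _)). Qed.

Let mminv j i th : P i -> measurable_fun setT (fun w => Num.min (a i th w) j%:R).
Proof. by move=> Pi; exact: (measurableT_comp (g := fun w : W => (th, w)) (mmin j Pi) (ltac:(msolve3))). Qed.

Let min0 j i th w : 0 <= Num.min (a i th w) j%:R.
Proof. by rewrite le_min a0 ler0n. Qed.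

Let minC j i th w : `|Num.min (a i th w) j%:R| <= j%:R.
Proof. by rewrite ger0_norm// ge_min lexx orbT. Qed.

Let mE j i : P i -> measurable_fun setT (fun th => \int[G]_w (Num.min (a i th w) j%:R)%:E)%E.
Proof.
move=> Pi; apply: (@measurable_fun_fubini_tonelli_F _ _ _ _ _ G
  (fun p => (Num.min (a i p.1 p.2) j%:R)%:E)); first by apply/measurable_EFinP; exact: mmin.
by move=> p; rewrite lee_fin.
Qed.

Let E_cvg i : P i -> E j i @[j --> \oo] --> (\int[Q]_th \int[G]_w (a i th w)%:E)%E.
Proof.
move=> Pi; have mono x (n m : nat) : (n <= m)%N -> Num.min x n%:R <= Num.min x m%:R :> R.
  by move=> nm; rewrite le_min ge_min lexx/= ge_min ler_nat nm orbT.
apply: (@integral_cvg_nd _ _ _ Q (fun j th => \int[G]_w (Num.min (a i th w) j%:R)%:E)%E).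
- by move=> j; exact: mE.
- by move=> j th; apply: integral_ge0 => w _; rewrite lee_fin.
- move=> th n m nm; apply: ge0_le_integral => //.
  + by move=> w _; rewrite lee_fin.
  + by apply/measurable_EFinP; exact: mminv.
  + by apply/measurable_EFinP; exact: mminv.
  + by move=> w _; rewrite lee_fin mono.
- move=> th; apply: (@integral_cvg_nd _ _ _ G (fun j w => (Num.min (a i th w) j%:R)%:E)).
  + by move=> j; apply/measurable_EFinP; exact: mminv.
  + by move=> j w; rewrite lee_fin.
  + by move=> w n m nm; rewrite lee_fin mono.
  + by move=> w; apply: cvg_EFin; [exact: nearW|exact: min_cvg].
Qed.

Let truncE j i : P i -> (\int[Q]_th \int[G]_w trunc j (a i th w))%:E = (E j i + (j.+1%:R^-1)%:E)%E.
Proof.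
move=> Pi.
have inner th : \int[G]_w trunc j (a i th w) = \int[G]_w Num.min (a i th w) j%:R + j.+1%:R^-1.
  have i1 : G.-integrable setT (EFin \o (fun w => Num.min (a i th w) j%:R)).
    by apply: (@integrable_bounded _ _ _ G _ j%:R) => //; exact: mminv.
  have i2 : G.-integrable setT (EFin \o (fun _ => j.+1%:R^-1 : R)).
    by apply: (@integrable_bounded _ _ _ G _ `|j.+1%:R^-1|).
  by rewrite /trunc (RintegralD measurableT i1 i2) Rintegral_prob_cst.
have mi : measurable_fun setT (fun th => \int[G]_w Num.min (a i th w) j%:R).
  exact: (@measurable_partial_Rintegral _ _ _ _ _ _ (fun p => Num.min (a i p.1 p.2) j%:R) (mmin j Pi)).
have bi th : `|\int[G]_w Num.min (a i th w) j%:R| <= j%:R.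
  by apply: le_normr_Rintegral_bounded => //; exact: mminv.
have -> : \int[Q]_th \int[G]_w trunc j (a i th w) =
    \int[Q]_th \int[G]_w Num.min (a i th w) j%:R + j.+1%:R^-1.
  under eq_Rintegral do rewrite inner.
  have i1 := @integrable_bounded _ _ _ Q _ j%:R mi bi.
  have i2 : Q.-integrable setT (EFin \o (fun _ => j.+1%:R^-1 : R)).
    by apply: (@integrable_bounded _ _ _ Q _ `|j.+1%:R^-1|).
  by rewrite (RintegralD measurableT i1 i2) Rintegral_prob_cst.
rewrite EFinD; congr (_ + _)%E; rewrite (EFin_Rintegral Q mi bi) /E.
apply: eq_integral => th _; apply: (EFin_Rintegral G (C := j%:R)) => //; exact: mminv.
Qed.

(** Monotone convergence in both integrals, so that the limit is right also when it is infinite. *)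
Lemma avg_trunc_cvg :
  (avg Q P Lam (fun i th => \int[G]_w trunc j (a i th w)))%:E @[j --> \oo] -->
  (\sum_(i | P i) (Lam i)%:E * \int[Q]_th \int[G]_w (a i th w)%:E)%E.
Proof.
rewrite (_ : (fun j => _) = fun j => (\sum_(i | P i) (Lam i)%:E * (E j i + (j.+1%:R^-1)%:E))%E); last first.
  by apply/funext => j; rewrite -sumEFin; apply: eq_bigr => i Pi; rewrite EFinM truncE.
apply: cvg_nnesum => i Pi.
  apply: nearW => j; rewrite mule_ge0 ?lee_fin ?Lam0//.
  rewrite adde_ge0 ?lee_fin ?invr_ge0//.
  by apply: integral_ge0 => th _; apply: integral_ge0 => w _; rewrite lee_fin.
apply: cvgeZl => //.
rewrite -[X in _ --> X]adde0; apply: cvgeD => //.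
- by rewrite fin_num_adde_defl.
- exact: E_cvg.
- by apply: cvg_EFin; [exact: nearW|exact: cvg_harmonic].
Qed.

End Truncation.

Section EntropyContraction.
Context {R : realType} (M N : nat) d (T : measurableType d) (Q : probability T R)
  (I : finType) (P : pred I) (Lam : I -> R).
Hypotheses (Lam0 : forall i, P i -> 0 <= Lam i)
  (A0 : 0 < avg1 P Lam) (A1 : avg1 P Lam <= 1).
Variables (O fw : I -> T -> (M + N).-tuple R -> (M + N).-tuple R).
Hypotheses (rotO : forall i th, P i -> is_rotation (O i th) (fw i th))
  (mO : forall i, P i -> measurable_fun setT (fun p : T * (M + N).-tuple R => O i p.1 p.2))
  (mfw : forall i, P i -> measurable_fun setT (fun p : T * (M + N).-tuple R => fw i p.1 p.2)).
Variable ck : R.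
Hypotheses (ck0 : 0 <= ck)
  (fw_avg : forall x, sqnorm (projQ x) = 0 ->
  avg Q P Lam (fun i th => sqnorm (projP (fw i th x))) = ck * sqnorm x).
Variable h0 : M.-tuple R -> R.
Hypotheses (mh : measurable_fun setT h0) (h00 : forall v, 0 <= h0 v)
  (ih : (gauss M).-integrable setT (EFin \o h0)) (h1 : \int[gauss M]_v h0 v = 1)
  (ix : (gauss M).-integrable setT (EFin \o (fun v => xlnx (h0 v)))).

(** Extended-valued, since the average may be infinite at some v; [hk] is its [fine] value. *)
Definition hX (v : M.-tuple R) : \bar R :=
  (\sum_(i | P i) (Lam i)%:E *
    \int[Q]_th \int[gauss N]_w (h0 (projP (O i th (vw v w))))%:E)%E.

Let mproj i : P i -> measurable_fun setT
  (fun q : (T * M.-tuple R) * N.-tuple R => projP (O i q.1.1 (vw q.1.2 q.2))).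
Proof.
move=> Pi; apply: measurable_fun_projP; apply: (measurableT_comp (mO Pi)
  (g := fun q : (T * M.-tuple R) * N.-tuple R => (q.1.1, vw q.1.2 q.2))).
by msolve3.
Qed.

Let mprojv i v : P i -> measurable_fun setT
  (fun p : T * N.-tuple R => projP (O i p.1 (vw v p.2))).
Proof.
move=> Pi; apply: (measurableT_comp (mproj Pi)
  (g := fun p : T * N.-tuple R => ((p.1, v), p.2))).
by msolve3.
Qed.

Lemma measurable_hX : measurable_fun setT hX.
Proof.
rewrite /hX; under eq_fun do rewrite big_mkcond.
apply: emeasurable_sum => i; case: (P i) (@mproj i) => [/(_ isT) mp|_]; last exact: measurable_cst.
apply: measurable_funeM.
apply: (@measurable_fun_fubini_tonelli_F _ _ _ _ _ Q (fun q : M.-tuple R * T =>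
  \int[gauss N]_w (h0 (projP (O i q.2 (vw q.1 w))))%:E)%E); last first.
  by move=> q; apply: integral_ge0 => w _; rewrite lee_fin.
apply: (@measurable_fun_fubini_tonelli_F _ _ _ _ _ (gauss N)
  (fun q : (M.-tuple R * T) * N.-tuple R => (h0 (projP (O i q.1.2 (vw q.1.1 q.2))))%:E)); last first.
  by move=> q; rewrite lee_fin.
apply/measurable_EFinP; apply: (measurableT_comp mh).
apply: (measurableT_comp mp
  (g := fun q : (M.-tuple R * T) * N.-tuple R => ((q.1.2, q.1.1), q.2))).
by msolve3.
Qed.

Let f j (v : M.-tuple R) : R := trunc j (h0 v).
Let ep (j : nat) : R := j.+1%:R^-1.
Let ep0 j : 0 < ep j. Proof. by rewrite invr_gt0 ltr0n. Qed.
Let fb j v : ep j <= f j v <= j%:R + 1. Proof. exact: trunc_between. Qed.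
Let mf j : measurable_fun setT (f j). Proof. exact: measurable_fun_trunc. Qed.
Let F j i th v := \int[gauss N]_w f j (projP (O i th (vw v w))).
Let X j v := avg Q P Lam (fun i th => F j i th v).

Let mFj j i : P i -> measurable_fun setT (fun p : T * M.-tuple R => F j i p.1 p.2).
Proof.
move=> Pi; apply: (@measurable_partial_Rintegral _ _ _ _ _ _ (fun q : (T * M.-tuple R) * N.-tuple R =>
  f j (projP (O i q.1.1 (vw q.1.2 q.2))))).
exact: (measurableT_comp (mf j) (mproj Pi)).
Qed.

Let Fb j i th v : P i -> ep j <= F j i th v <= j%:R + 1.
Proof.
move=> Pi; apply: Rintegral_between => [|w]; last exact: fb.
apply: (measurableT_comp (mf j)).
exact: (measurableT_comp (mproj Pi) (g := fun w : N.-tuple R => ((th, v), w)) (ltac:(msolve3))).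
Qed.

Let step j : \int[gauss M]_v xlnx (X j v) <=
  ck * \int[gauss M]_v xlnx (f j v) + (avg1 P Lam - ck) * xlnx (\int[gauss M]_v f j v).
Proof.
have marg (g : M.-tuple R -> R) (C : R) : measurable_fun setT g -> (forall v, `|g v| <= C) ->
    \int[gauss (M + N)]_z g (projP z) = \int[gauss M]_v g v.
  move=> mg gC; rewrite Rintegral_gauss_vw; last first.
    apply: (@integrable_bounded _ _ _ (gauss (M + N)) _ C) => //.
    by apply: (measurableT_comp mg); exact: measurable_fun_projP.
  apply: eq_Rintegral => v _; rewrite -[RHS](Rintegral_prob_cst (gauss N)).
  by apply: eq_Rintegral => w _; rewrite projP_vw.
have mH : measurable_fun setT (f j \o @projP R M N).
  by apply: (measurableT_comp (mf j)); exact: measurable_fun_projP.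
have HP v w w' : (f j \o @projP R M N) (vw v w) = (f j \o @projP R M N) (vw v w').
  by rewrite /= !projP_vw.
have := @avg_entropy_le _ M N _ _ Q _ P Lam Lam0 (f j \o @projP R M N) (ep j) (j%:R + 1)
  mH (ep0 j) (fun z => fb j _) HP O fw rotO mO mfw ck ck0 fw_avg.
rewrite (marg (fun v => xlnx (f j v)) ((j%:R + 1) ^+ 2 + 1)); last 2 first.
- exact: (measurable_fun_xlnx (mf j)).
- by move=> v; exact: (xlnx_norm (ep0 j) (fb j v)).
rewrite (marg (f j) (j%:R + 1)) //; last first.
  by move=> v; have /andP[l1 l2] := fb j v; rewrite ger0_norm// (le_trans (ltW (ep0 j))).
apply: le_trans.
exact: (jensen_avg Q (gauss M) Lam0 A0 A1 (mFj j) (ep0 j) (fun i th v Pi => Fb j th v Pi)).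
Qed.

Let fn j v : `|f j v| <= h0 v + 1.
Proof.
have /andP[l1 _] := fb j v; rewrite ger0_norm ?(le_trans (ltW (ep0 j)))//.
exact: trunc_le.
Qed.

Let ic (r : R) : (gauss M).-integrable setT (EFin \o (fun _ => r)).
Proof. by apply: (@integrable_bounded _ _ _ (gauss M) _ `|r|). Qed.

(** The masses of the truncations tend to 1, where x ln x vanishes, so only the entropy term
    survives. *)
Let rhs_cvg : ck * \int[gauss M]_v xlnx (f j v) +
   (avg1 P Lam - ck) * xlnx (\int[gauss M]_v f j v) @[j --> \oo] -->
  ck * \int[gauss M]_v xlnx (h0 v).
Proof.
have f1 : \int[gauss M]_v f j v @[j --> \oo] --> (1 : R).
  rewrite -h1; apply: (@Rintegral_cvg_dominated _ _ _ (gauss M) f h0 (fun v => h0 v + 1)) => //.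
    exact: (integrableD measurableT ih (ic 1)).
  by move=> v; exact: trunc_cvg.
have f2 : \int[gauss M]_v xlnx (f j v) @[j --> \oo] --> \int[gauss M]_v xlnx (h0 v).
  apply: (@Rintegral_cvg_dominated _ _ _ (gauss M) (fun j v => xlnx (f j v)) _
      (fun v => xlnx (h0 v) + h0 v + 3)).
  - by move=> j; exact: (measurable_fun_xlnx (mf j)).
  - exact: (measurable_fun_xlnx mh).
  - exact: (integrableD measurableT (integrableD measurableT ix ih) (ic 3)).
  - move=> j v; apply: xlnx_dominated => //; rewrite /f trunc_le// andbT.
    by have /andP[l1 _] := fb j v; exact: (le_trans (ltW (ep0 j))).
  - move=> v; apply: xlnx_cvg; last exact: trunc_cvg.
    by move=> j; have /andP[l1 _] := fb j v; exact: (le_trans (ltW (ep0 j))).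
have f3 : xlnx (\int[gauss M]_v f j v) @[j --> \oo] --> xlnx 1.
  apply: xlnx_cvg => // j; apply: Rintegral_ge0 => v _.
  by have /andP[l1 _] := fb j v; exact: (le_trans (ltW (ep0 j))).
have := cvgD (cvgM (cvg_cst ck) f2) (cvgM (cvg_cst (avg1 P Lam - ck)) f3).
have -> : xlnx 1 = 0 :> R by rewrite /xlnx ln1 mulr0.
by rewrite mulr0 addr0; apply.
Qed.

Let Xpos j v : 0 < X j v.
Proof.
have /andP[l1 _] := avg_between Q Lam0 (mFj j) (ep0 j) (fun i th v Pi => Fb j th v Pi) v.
by apply: lt_le_trans l1; exact: mulr_gt0.
Qed.

Let X_cvg v : (X j v)%:E @[j --> \oo] --> hX v.
Proof.
apply: (@avg_trunc_cvg _ _ T _ (N.-tuple R) Q (gauss N) _ P Lam Lam0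
  (fun i th w => h0 (projP (O i th (vw v w))))) => // i Pi.
exact: (measurableT_comp mh (mprojv v Pi)).
Qed.

Lemma entropy_hX : (\int[gauss M]_v (xlnx (fine (hX v)))%:E <=
  (ck * \int[gauss M]_v xlnx (h0 v))%:E)%E.
Proof.
have hX0 v : (0 <= hX v)%E.
  apply: sume_ge0 => i Pi; rewrite mule_ge0 ?lee_fin ?Lam0//.
  by apply: integral_ge0 => th _; apply: integral_ge0 => w _; rewrite lee_fin.
have mX j : measurable_fun setT (X j) by exact: (measurable_avg Q Lam (mFj j)).
have mk : measurable_fun setT (fun v => fine (hX v)).
  by apply: (measurableT_comp (fine_measurable measurableT)); exact: measurable_hX.
have k0 v : 0 <= fine (hX v) by exact: fine_ge0.
have x1 (x : R) : 0 <= x -> 0 <= xlnx x + 1 by move=> xp; have := xlnx_ge xp; lra.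
have ge1 (x : R) : 0 <= x -> -1 <= xlnx x by move=> xp; have := xlnx_ge xp; lra.
(* Adding 1 makes the integrands nonnegative, as Fatou's lemma requires. *)
suff : (\int[gauss M]_v (xlnx (fine (hX v)) + 1)%:E <=
    (ck * \int[gauss M]_v xlnx (h0 v) + 1)%:E)%E.
  rewrite (eq_integral (fun v => (xlnx (fine (hX v)))%:E + 1)%E)// integral_add1.
  - by rewrite EFinD leeD2rE.
  - by apply/measurable_EFinP; exact: (measurable_fun_xlnx mk).
  - by move=> v; rewrite lee_fin ge1.
apply: (@fatou_le _ _ _ (gauss M) (fun j v => xlnx (X j v) + 1) _
  (fun j => ck * \int[gauss M]_v xlnx (f j v) +
   (avg1 P Lam - ck) * xlnx (\int[gauss M]_v f j v) + 1)).
- by move=> j; apply: measurable_funD => //; exact: measurable_fun_xlnx.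
- by move=> j v; rewrite x1// ltW.
- by apply: measurable_funD => //; exact: (measurable_fun_xlnx mk).
- by move=> v; exact: x1.
- move=> v; case E : (hX v) => [r| |].
  + exists (xlnx (fine (hX v)) + 1)%:E; last by rewrite E.
    apply: cvg_EFin; first exact: nearW.
    apply: cvgD; last exact: cvg_cst.
    apply: xlnx_cvg => [j|]; first exact: ltW.
    by rewrite E; have := @X_cvg v; rewrite E => /fine_cvgP[_].
  (* [fine +oo = 0] does no harm: [xlnx (X j v)] tends to [+oo] there. *)
  + exists +oo%E; last exact: leey.
    have := @X_cvg v; rewrite E => /cvgeyPge hA.
    apply/cvgeyPge => A; near=> j.
    have : (A%:E <= (X j v)%:E)%E by near: j; exact: hA.
    rewrite !lee_fin => /le_trans; apply.
    by have := xlnx_ge (ltW (Xpos j v)); lra.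
  + by have := hX0 v; rewrite E.
- move=> j; rewrite (eq_integral (fun v => (xlnx (X j v))%:E + 1)%E)// integral_add1.
  + rewrite EFinD leeD2rE//.
    have e1 : 0 < avg1 P Lam * ep j by exact: mulr_gt0.
    rewrite -(EFin_Rintegral (gauss M) (C := (avg1 P Lam * (j%:R + 1)) ^+ 2 + 1)) ?lee_fin.
    * exact: step.
    * exact: measurable_fun_xlnx.
    * move=> v; apply: (xlnx_norm e1).
      exact: (avg_between Q Lam0 (mFj j) (ep0 j) (fun i th v Pi => Fb j th v Pi) v).
  + by apply/measurable_EFinP; exact: measurable_fun_xlnx.
  + by move=> v; rewrite lee_fin ge1// ltW.
- by apply: cvgD; [exact: rhs_cvg|exact: cvg_cst].
Unshelve. all: by end_near.
Qed.

End EntropyContraction.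

(** * Words of plane rotations *)

Section Words.
Context {R : realType} (n : nat).
Implicit Types (a : 'I_n * 'I_n) (al : seq ('I_n * 'I_n)) (x y z : n.-tuple R).

Lemma rot_invE a t z : rot_inv a t z = rotc a.1 a.2 (cos t) (sin t) z.
Proof. by []. Qed.

Lemma rot_invK a t z : a.1 != a.2 -> rot_inv a t (rot_inv a (- t) z) = z.
Proof.
move=> ij; have ji : a.2 != a.1 by rewrite eq_sym.
have e := cos2Dsin2 t; apply: eq_from_tnth => k.
rewrite !rot_invE !tnth_rotc !eqxx (negbTE ji) cosN sinN.
move: e; move: (cos t) (sin t) => c s e.
have [->|_] := eqVneq k a.1.
  by transitivity ((c ^+ 2 + s ^+ 2) * tnth z a.1); [ring|rewrite e mul1r].
have [->|//] := eqVneq k a.2.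
by transitivity ((c ^+ 2 + s ^+ 2) * tnth z a.2); [ring|rewrite e mul1r].
Qed.

Lemma sqnorm_rot_inv a t z : a.1 != a.2 -> sqnorm (rot_inv a t z) = sqnorm z.
Proof. by move=> ij; rewrite rot_invE sqnorm_rotc// cos2Dsin2. Qed.

Lemma rot_inv_lc a t b c x y :
  rot_inv a t (lc b c x y) = lc b c (rot_inv a t x) (rot_inv a t y).
Proof.
apply: eq_from_tnth => k; rewrite !rot_invE !tnth_lc !tnth_rotc !tnth_lc.
by case: (k == a.1); [ring|case: (k == a.2); [ring|]].
Qed.

(** Polarisation of the invariance of the norm. *)
Lemma dot_rot_inv a t x y : a.1 != a.2 -> dot (rot_inv a t x) (rot_inv a t y) = dot x y.
Proof.
move=> ij; have := sqnorm_rot_inv t (lc 1 1 x y) ij.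
rewrite rot_inv_lc !sqnorm_lc !sqnorm_rot_inv// !expr1n !mul1r => /addIr /addrI.
by rewrite !mulr2n; lra.
Qed.

Lemma is_rotation_rot_inv a (t : R) : a.1 != a.2 -> is_rotation (rot_inv a t) (rot_inv a (- t)).
Proof.
move=> ij; split.
- by apply: measurable_fun_rotc; msolve3.
- by apply: law_rotc => //; exact: cos2Dsin2.
- by move=> b c x y; exact: rot_inv_lc.
- by move=> x y; rewrite -[in LHS](rot_invK t x ij) dot_rot_inv.
- by move=> x y; exact: dot_rot_inv.
Qed.

Lemma is_rotation_comp (O1 fw1 O2 fw2 : n.-tuple R -> n.-tuple R) :
  is_rotation O1 fw1 -> is_rotation O2 fw2 -> is_rotation (O2 \o O1) (fw1 \o fw2).
Proof.
move=> [m1 l1 c1 a1 i1] [m2 l2 c2 a2 i2]; split.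
- exact: measurableT_comp.
- exact: (has_law_comp m2 l1 l2).
- by move=> a b x y /=; rewrite c1 c2.
- by move=> x y /=; rewrite a2 a1.
- by move=> x y /=; rewrite i2 i1.
Qed.

(** The adjoint of [rots_inv]: opposite angles, and the head letter acts last instead of first. *)
Fixpoint rots_fwd al (th : seq R) z : n.-tuple R :=
  match al, th with
  | a :: al', t :: th' => rot_inv a (- t) (rots_fwd al' th' z)
  | _, _ => z
  end.

Lemma is_rotation_rots al (th : seq R) : all (fun a => (a.1 < a.2)%N) al ->
  is_rotation (rots_inv al th) (rots_fwd al th).
Proof.
elim: al th => [|a al IH] [|t th] /=; try by move=> _; split.
case/andP=> ij /IH {}IH; apply: is_rotation_comp (IH th).
by apply: is_rotation_rot_inv; rewrite -val_eqE/= ltn_eqF.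
Qed.

Lemma measurable_fun_rot_inv d (T : measurableType d) a (t : T -> R) (z : T -> n.-tuple R) :
  measurable_fun setT t -> measurable_fun setT z ->
  measurable_fun setT (fun u0 => rot_inv a (t u0) (z u0)).
Proof.
by move=> mt mz; apply: measurable_fun_rotc; [exact: (measurable_fun_cos mt)|exact: (measurable_fun_sin mt)|].
Qed.

Let tuple_step d (T : measurableType d) k (th : T -> k.+1.-tuple R) :
  measurable_fun setT th ->
  [/\ measurable_fun setT (fun u0 => tnth (th u0) ord0),
      measurable_fun setT (fun u0 => behead_tuple (th u0)) &
      forall u0, th u0 = tnth (th u0) ord0 :: behead_tuple (th u0) :> seq R].
Proof.
move=> mth; split.
- by msolve3.
- apply/measurable_fun_tnthP => i.
  rewrite (_ : _ \o _ = fun u0 => tnth (th u0) (inord i.+1)); first by msolve3.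
  by apply/funext => u0; rewrite /= tnth_behead.
- by move=> u0; case/tupleP: (th u0) => u s.
Qed.

Lemma measurable_fun_rots_inv d (T : measurableType d) al k (th : T -> k.-tuple R)
    (z : T -> n.-tuple R) : measurable_fun setT th -> measurable_fun setT z ->
  measurable_fun setT (fun u0 => rots_inv al (th u0) (z u0)).
Proof.
elim: al k th z => [|a al IH] [|k] th z mth mz //.
  rewrite (_ : (fun u0 => _) = z)//; apply/funext => u0; by rewrite (tuple0 (th u0)).
have [m1 m2 e] := tuple_step mth.
rewrite (_ : (fun u0 => _) = fun u0 => rots_inv al (behead_tuple (th u0)) (rot_inv a (tnth (th u0) ord0) (z u0))).
  by apply: IH => //; exact: measurable_fun_rot_inv.
by apply/funext => u0; rewrite e.
Qed.

Lemma measurable_fun_rots_fwd d (T : measurableType d) al k (th : T -> k.-tuple R)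
    (z : T -> n.-tuple R) : measurable_fun setT th -> measurable_fun setT z ->
  measurable_fun setT (fun u0 => rots_fwd al (th u0) (z u0)).
Proof.
elim: al k th z => [|a al IH] [|k] th z mth mz //.
  rewrite (_ : (fun u0 => _) = z)//; apply/funext => u0; by rewrite (tuple0 (th u0)).
have [m1 m2 e] := tuple_step mth.
rewrite (_ : (fun u0 => _) = fun u0 => rot_inv a (- tnth (th u0) ord0) (rots_fwd al (behead_tuple (th u0)) (z u0))).
  by apply: measurable_fun_rot_inv; [exact: measurable_fun_opp|exact: IH].
by apply/funext => u0; rewrite e.
Qed.

Lemma sqnorm_rots_fwd al th z : all (fun a => (a.1 < a.2)%N) al ->
  sqnorm (rots_fwd al th z) = sqnorm z.
Proof.
elim: al th => [|a al IH] [|t th] //= /andP[ij h].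
by rewrite sqnorm_rot_inv ?IH// -val_eqE/= ltn_eqF.
Qed.

End Words.

Section WordAverage.
Context {R : realType} (n : nat) (Q : probability (measurableTypeR R) R)
  (lam : 'I_n * 'I_n -> R).

Definition up (a : 'I_n * 'I_n) : bool := (a.1 < a.2)%N.
Definition wordP k (al : k.-tuple ('I_n * 'I_n)) : bool := all up al.
Definition wordL k (al : k.-tuple ('I_n * 'I_n)) : R := \prod_(a <- al) lam a.

Hypothesis lam0 : forall a, up a -> 0 <= lam a.

Lemma wordL_ge0 k (al : k.-tuple ('I_n * 'I_n)) : wordP al -> 0 <= wordL al.
Proof. by move=> /allP h; rewrite /wordL big_seq; apply: prodr_ge0 => a /h /lam0. Qed.

Lemma big_wordS k (F : k.+1.-tuple ('I_n * 'I_n) -> R) :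
  \sum_(al | wordP al) F al =
  \sum_(al : k.-tuple _ | wordP al) \sum_(a | up a) F (cons_tuple a al).
Proof.
rewrite (reindex (fun p : k.-tuple ('I_n * 'I_n) * ('I_n * 'I_n) => cons_tuple p.2 p.1)) /=; last first.
  exists (fun al => (behead_tuple al, thead al)) => [[al a] _|al _] /=.
    by congr (_, _); apply: val_inj.
  by apply: val_inj; case/tupleP: al.
rewrite pair_big_dep /=; apply: eq_bigl => -[al a] /=.
by rewrite /wordP /= andbC.
Qed.

Lemma avg1_word k : avg1 (@wordP k) (@wordL k) = avg1 up lam ^+ k.
Proof.
rewrite /avg1; elim: k => [|k IH].
  rewrite (big_pred1 [tuple]) => [|al]; first by rewrite /wordL big_nil.
  by rewrite (tuple0 al) /wordP /= eqxx.
rewrite big_wordS exprS -IH mulr_sumr; apply: eq_bigr => al _.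
by rewrite mulr_suml; apply: eq_bigr => a _; rewrite /wordL big_cons.
Qed.

(** Diagonal forms are enough: one averaged letter maps them to diagonal forms, the cross term being
    a multiple of the mean of sin cos. *)
Definition quad (kap : 'I_n -> R) (y : n.-tuple R) : R := \sum_k kap k * tnth y k ^+ 2.

Lemma quad_norm kap y : `|quad kap y| <= (\sum_k `|kap k|) * sqnorm y.
Proof.
apply: (le_trans (ler_norm_sum _ _ _)); rewrite mulr_suml; apply: ler_sum => k _.
rewrite normrM ler_wpM2l// ger0_norm ?sqr_ge0//.
by rewrite /sqnorm (bigD1 k)//= lerDl; apply: sumr_ge0 => j _; exact: sqr_ge0.
Qed.

Lemma measurable_fun_quad d (T : measurableType d) kap (f : T -> n.-tuple R) :
  measurable_fun setT f -> measurable_fun setT (fun x => quad kap (f x)).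
Proof.
move=> mf; apply: measurable_sum => k; apply: measurable_funM; first exact: measurable_cst.
by msolve3.
Qed.

Variable step : ('I_n -> R) -> ('I_n -> R).
Hypothesis letter : forall kap y,
  avg Q up lam (fun a t => quad kap (rot_inv a (- t) y)) = quad (step kap) y.

(** The head letter acts last in [rots_fwd]; averaging it first replaces [kap] by [step kap] for the
    remaining word. *)
Lemma word_quad k kap x :
  avg (tuple_prob Q k) (@wordP k) (@wordL k) (fun al th => quad kap (rots_fwd al th x)) =
  quad (iter k step kap) x.
Proof.
elim: k kap => [|k IH] kap.
  rewrite /avg (big_pred1 [tuple]) => [|al]; last by rewrite (tuple0 al) /wordP /= eqxx.
  rewrite /wordL big_nil mul1r /= -[RHS](Rintegral_prob_cst (tuple_prob Q 0)).
  by apply: eq_Rintegral.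
rewrite iterSr -IH /avg big_wordS; apply: eq_bigr => al Pal.
have C z (th : seq R) : sqnorm z = sqnorm x -> `|quad kap z| <= (\sum_k `|kap k|) * sqnorm x.
  by move=> <-; exact: quad_norm.
have mf (a : 'I_n * 'I_n) : measurable_fun setT
    (fun p : measurableTypeR R * k.-tuple R => quad kap (rot_inv a (- p.1) (rots_fwd al p.2 x))).
  apply: measurable_fun_quad; apply: measurable_fun_rot_inv; first by apply: measurable_fun_opp; msolve3.
  by apply: measurable_fun_rots_fwd; msolve3.
have bf (a : 'I_n * 'I_n) t (th : k.-tuple R) : up a ->
    `|quad kap (rot_inv a (- t) (rots_fwd al th x))| <= (\sum_k `|kap k|) * sqnorm x.
  move=> ua; apply: (C _ [::]); rewrite sqnorm_rot_inv ?sqnorm_rots_fwd//.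
  by rewrite -val_eqE/= ltn_eqF.
transitivity (wordL al * avg Q up lam (fun a t =>
    \int[tuple_prob Q k]_th quad kap (rot_inv a (- t) (rots_fwd al th x)))).
  rewrite /avg mulr_sumr; apply: eq_bigr => a ua.
  rewrite {1}/wordL big_cons -/(wordL al) mulrA [wordL al * _]mulrC; congr (_ * _).
  rewrite -(has_law_Rintegral (law_tuple_cons Q (n := k))); last first.
    by apply: measurable_fun_quad; apply: measurable_fun_rots_fwd; msolve3.
  rewrite Rfubini1//.
  apply: (@integrable_bounded_prod _ _ _ _ _ Q (tuple_prob Q k)
    (fun p => quad kap (rot_inv a (- p.1) (rots_fwd al p.2 x))) ((\sum_k `|kap k|) * sqnorm x)).
    exact: mf.
  by move=> p; exact: bf.
congr (_ * _).
rewrite (avg_exchange (P := up) Q lam (tuple_prob Q k)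
  (f := fun a t th => quad kap (rot_inv a (- t) (rots_fwd al th x)))
  (C := (\sum_k `|kap k|) * sqnorm x) (fun a _ => mf a)); last by move=> a t th ua; exact: bf.
by apply: eq_Rintegral => th _; exact: letter.
Qed.

End WordAverage.

(** * Action of one random letter on diagonal forms *)

Section Letter.
Context {R : realType} (n : nat) (Q : probability (measurableTypeR R) R)
  (lam : 'I_n * 'I_n -> R).

Let m2 := \int[Q]_t (sin t ^+ 2).
Hypothesis sc0 : \int[Q]_t (sin t * cos t) = 0.

(* In the plane (i, j) the rotation transfers weight between [y_i^2] and
   [y_j^2]; the cross term is killed by [sc0]. *)
Definition letter_step (kap : 'I_n -> R) (k : 'I_n) : R :=
  avg1 (@up n) lam * kap k + m2 * \sum_(a | up a)
    lam a * (kap a.1 - kap a.2) * ((k == a.2)%:R - (k == a.1)%:R).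

Let isin2 : Q.-integrable setT (EFin \o (fun t => sin t ^+ 2)).
Proof.
apply: (@integrable_bounded _ _ _ Q _ 1); first by msolve3.
move=> t; rewrite ger0_norm ?sqr_ge0// -(cos2Dsin2 t) lerDr sqr_ge0.
Qed.

Let isc : Q.-integrable setT (EFin \o (fun t => sin t * cos t)).
Proof.
apply: (@integrable_bounded _ _ _ Q _ 1); first by msolve3.
move=> t; have e := cos2Dsin2 t.
have := sqr_ge0 (cos t - sin t); have := sqr_ge0 (cos t + sin t).
by rewrite ler_norml; move: e; move: (cos t) (sin t) => c s; nra.
Qed.

Let one_letter (kap : 'I_n -> R) a (y : n.-tuple R) : up a -> \int[Q]_t quad kap (rot_inv a (- t) y) =
  quad kap y + m2 * ((kap a.1 - kap a.2) * (tnth y a.2 ^+ 2 - tnth y a.1 ^+ 2)).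
Proof.
move=> ua; have ij : a.1 != a.2 by rewrite -val_eqE/= ltn_eqF.
set D := (kap a.1 - kap a.2) * (tnth y a.2 ^+ 2 - tnth y a.1 ^+ 2).
set B := 2 * (kap a.1 - kap a.2) * tnth y a.1 * tnth y a.2.
transitivity (\int[Q]_t (quad kap y + (D * sin t ^+ 2 + B * (sin t * cos t)))).
  apply: eq_Rintegral => t _.
  rewrite /quad rot_invE (@big_rotc _ _ _ _ (fun k x => kap k * x ^+ 2))//.
  rewrite cosN sinN -addrA; congr (_ + _).
  have e : cos t ^+ 2 = 1 - sin t ^+ 2 by rewrite -(cos2Dsin2 t) addrK.
  rewrite /D /B; move: e; move: (cos t) (sin t) (tnth y a.1) (tnth y a.2) (kap a.1) (kap a.2).
  move=> c s y1 y2 k1 k2 e.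
  transitivity (k1 * (y1 ^+ 2 * c ^+ 2 + 2 * y1 * y2 * (s * c) + y2 ^+ 2 * s ^+ 2 - y1 ^+ 2) +
    k2 * (y1 ^+ 2 * s ^+ 2 - 2 * y1 * y2 * (s * c) + y2 ^+ 2 * c ^+ 2 - y2 ^+ 2)); first by ring.
  by rewrite e; ring.
have ic : Q.-integrable setT (EFin \o (fun _ => quad kap y)).
  by apply: (@integrable_bounded _ _ _ Q _ `|quad kap y|).
have i1 : Q.-integrable setT (EFin \o (fun t => D * sin t ^+ 2)).
  exact: (integrableZl measurableT _ isin2).
have i2 : Q.-integrable setT (EFin \o (fun t => B * (sin t * cos t))).
  exact: (integrableZl measurableT _ isc).
rewrite (RintegralD measurableT ic (integrableD measurableT i1 i2)).
rewrite (RintegralD measurableT i1 i2) Rintegral_prob_cst.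
rewrite (RintegralZl _ measurableT isin2) (RintegralZl _ measurableT isc) sc0 mulr0 addr0.
by rewrite [D * _]mulrC.
Qed.

Lemma letter_stepP kap (y : n.-tuple R) :
  avg Q (@up n) lam (fun a t => quad kap (rot_inv a (- t) y)) = quad (letter_step kap) y.
Proof.
transitivity (\sum_(a | up a) lam a * (quad kap y +
    m2 * ((kap a.1 - kap a.2) * (tnth y a.2 ^+ 2 - tnth y a.1 ^+ 2)))).
  by apply: eq_bigr => a ua; rewrite one_letter.
rewrite /quad /letter_step.
under [RHS]eq_bigr => k _ do rewrite mulrDl -!mulrA.
rewrite big_split /= -!mulr_sumr.
under eq_bigr => a _ do rewrite mulrDr.
rewrite big_split /= -mulr_suml; congr (_ + _).
transitivity (m2 * \sum_k \sum_(a | up a) lam a * (kap a.1 - kap a.2) *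
    ((k == a.2)%:R - (k == a.1)%:R) * tnth y k ^+ 2); last first.
  by congr (_ * _); apply: eq_bigr => k _; rewrite mulr_suml.
rewrite exchange_big /= mulr_sumr; apply: eq_bigr => a _.
have pick (i : 'I_n) : \sum_k (k == i)%:R * tnth y k ^+ 2 = tnth y i ^+ 2.
  rewrite (bigD1 i)//= eqxx mul1r big1 ?addr0// => k /negbTE ->; exact: mul0r.
transitivity (m2 * (lam a * (kap a.1 - kap a.2) *
   \sum_k ((k == a.2)%:R * tnth y k ^+ 2 - (k == a.1)%:R * tnth y k ^+ 2))).
  by rewrite sumrB !pick; ring.
by congr (_ * _); rewrite mulr_sumr; apply: eq_bigr => k _; ring.
Qed.

End Letter.

(** * The contraction coefficient *)

Section Coefficients.
Context {R : realType} (M N : nat) (lS lR mu : R).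
Hypotheses (M0 : (0 < M)%N) (MN : (M <= N)%N) (lS0 : 0 < lS) (lR0 : 0 < lR) (mu0 : 0 < mu).

Let L := Lam M N lS lR mu.
Let lm := @lam R M N lS lR mu.

Let M0R : 0 < M%:R :> R. Proof. by rewrite ltr0n. Qed.
Let N0R : 0 < N%:R :> R. Proof. by rewrite ltr0n; exact: leq_trans MN. Qed.

Let L0 : 0 < L.
Proof. by rewrite /L /Lam !addr_gt0 ?mulr_gt0. Qed.

Lemma lam_ge0 a : 0 <= lm a.
Proof.
rewrite /lm /lam -/L; case: ifP => _; first by rewrite divr_ge0 ?mulr_ge0 ?(ltW lS0) ?(ltW L0).
by case: ifP => _; rewrite divr_ge0 ?mulr_ge0 ?(ltW lR0) ?(ltW mu0) ?(ltW L0).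
Qed.

Lemma big_pairs_split (G : 'I_(M + N) * 'I_(M + N) -> R) :
  \sum_(a | up a) G a =
  (\sum_(i < M) \sum_(j < M | (i < j)%N) G (lshift N i, lshift N j) +
   \sum_(i < M) \sum_(j < N) G (lshift N i, rshift M j)) +
  \sum_(i < N) \sum_(j < N | (i < j)%N) G (rshift M i, rshift M j).
Proof.
transitivity (\sum_(i < M + N) \sum_(j < M + N) if (i < j)%N then G (i, j) else 0).
  rewrite pair_big big_mkcond; apply: eq_bigr => -[i j] _ //=.
rewrite big_split_ord; congr (_ + _).
  rewrite -big_split; apply: eq_bigr => i _; rewrite big_split_ord /=; congr (_ + _).
    by rewrite [RHS]big_mkcond.
  by apply: eq_bigr => j _; rewrite ltn_addr.
apply: eq_bigr => i _; rewrite big_split_ord /= [X in X + _]big1 ?add0r.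
  rewrite [RHS]big_mkcond; apply: eq_bigr => j _; by rewrite ltn_add2l.
by move=> j _; rewrite ltnNge (ltnW (leq_trans (ltn_ord j) (leq_addr _ _))).
Qed.

Lemma lam_ll i j : lm (lshift N i, lshift N j) = lS / (L * (M - 1)%:R).
Proof. by rewrite /lm /lam /= ltn_ord. Qed.
Lemma lam_lr i j : lm (lshift N i, rshift M j) = mu / (L * N%:R).
Proof. by rewrite /lm /lam /= ltnNge leq_addr /= leqNgt ltn_ord. Qed.
Lemma lam_rr i j : lm (rshift M i, rshift M j) = lR / (L * (N - 1)%:R).
Proof. by rewrite /lm /lam /= ltnNge !leq_addr. Qed.

(** The pairs i < j and j < i contribute equally, and with the diagonal they fill the square. *)
Lemma sum_pairs_cst m (c : R) :
  \sum_(i < m) \sum_(j < m | (i < j)%N) c = c * (m%:R * (m%:R - 1)) / 2.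
Proof.
pose S := \sum_(i < m) \sum_(j < m | (i < j)%N) c.
have S1 : S = \sum_(i < m) \sum_(j < m | (j < i)%N) c.
  by rewrite /S (exchange_big_dep xpredT).
have : S + S + c * m%:R = c * (m%:R * m%:R).
  rewrite [X in _ + X + _]S1 /S -big_split /=.
  have -> : c * m%:R = \sum_(i < m) c by rewrite sumr_const card_ord mulr_natr.
  rewrite -big_split /= mulrA.
  have -> : c * m%:R * m%:R = \sum_(i < m) (c * m%:R) by rewrite sumr_const card_ord mulr_natr.
  apply: eq_bigr => i _.
  have -> : c * m%:R = \sum_(j < m) c by rewrite sumr_const card_ord mulr_natr.
  rewrite [RHS](bigID (fun j : 'I_m => (i < j)%N)) /= -addrA; congr (_ + _).
  rewrite [RHS](bigID (fun j : 'I_m => (j < i)%N)) /=; congr (_ + _).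
    by apply: eq_bigl => j; case: ltngtP.
  rewrite (big_pred1 i)// => j /=; rewrite -val_eqE /=.
  by case: ltngtP.
rewrite -/S; lra.
Qed.

Let sig := avg1 (@up (M + N)) lm.

Lemma sig_le1 : sig <= 1.
Proof.
rewrite /sig /avg1 big_pairs_split.
under eq_bigr => i _ do under eq_bigr => j _ do rewrite lam_ll.
under [X in _ + X + _]eq_bigr => i _ do under eq_bigr => j _ do rewrite lam_lr.
under [X in _ + _ + X]eq_bigr => i _ do under eq_bigr => j _ do rewrite lam_rr.
rewrite !sum_pairs_cst !sumr_const !card_ord.
(* Equality for m >= 2. For m = 1 the left side is 0, as the block contains no pair; division by m -
   1 = 0 also gives 0. *)
have half (l : R) m : (0 < m)%N -> 0 < l ->
    l / (L * (m - 1)%:R) * (m%:R * (m%:R - 1)) / 2 <= (l * m%:R / 2) / L.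
  move=> m0 l0; case: m m0 => // -[_|m _].
    by rewrite subn1 /= mulr0 invr0 mulr0 !mul0r divr_ge0 ?(ltW L0)// divr_ge0// mulr_ge0// ltW.
  rewrite subn1 /= -[m.+2%:R]natr1 addrK.
  have m1 : m.+1%:R != 0 :> R by rewrite pnatr_eq0.
  have Ln : L != 0 by rewrite gt_eqF.
  by rewrite le_eqVlt; apply/orP; left; apply/eqP; field; rewrite Ln nat1r m1.
have hS := half lS M M0 lS0; have hR := half lR N (leq_trans M0 MN) lR0.
have hX : mu / (L * N%:R) *+ N *+ M = mu * M%:R / L.
  by rewrite -mulr_natr -[_ / _ *+ N]mulr_natr; field; rewrite !gt_eqF.
rewrite hX; have : (lS * M%:R / 2) / L + mu * M%:R / L + (lR * N%:R / 2) / L = 1.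
  by rewrite -!mulrDl addrAC -/(Lam M N lS lR mu) divff// gt_eqF.
lra.
Qed.

(** The mixed pairs alone have this weight. It dominates [y], which keeps the coefficients of
    [coef_step] nonnegative. *)
Lemma sig_ge : mu * M%:R / L <= sig.
Proof.
rewrite /sig /avg1 big_pairs_split.
have hX : \sum_(i < M) \sum_(j < N) lm (lshift N i, rshift M j) = mu * M%:R / L.
  under eq_bigr => i _ do under eq_bigr => j _ do rewrite lam_lr.
  by rewrite !sumr_const !card_ord -mulr_natr -[_ / _ *+ N]mulr_natr; field; rewrite !gt_eqF.
rewrite hX -addrA addrCA lerDl addr_ge0//; apply: sumr_ge0 => i _; apply: sumr_ge0 => j _;
  exact: lam_ge0.
Qed.

Definition blk (p : R * R) (k : 'I_(M + N)) : R := if (k < M)%N then p.1 else p.2.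

Variable Q : probability (measurableTypeR R) R.
Let m2 := \int[Q]_t (sin t ^+ 2).
Let y := mu * m2 / L.

(** Each mixed pair has weight mu / (L N). A first-block coordinate meets N partners, a second-block
    one only M, whence the rates [y] and y M / N. *)
Definition coef_step (p : R * R) : R * R :=
  (sig * p.1 - y * (p.1 - p.2), sig * p.2 + y * (M%:R / N%:R) * (p.1 - p.2)).

(** Pairs inside a block drop out because the form is constant there; only mixed pairs transfer
    weight. *)
Lemma letter_step_blk p : letter_step Q lm (blk p) = blk (coef_step p).
Proof.
apply/funext => k; rewrite /letter_step.
pose G (a : 'I_(M + N) * 'I_(M + N)) : R :=
  lm a * (blk p a.1 - blk p a.2) * ((k == a.2)%:R - (k == a.1)%:R).
have bl i : blk p (lshift N i) = p.1 by rewrite /blk /= ltn_ord.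
have br i : blk p (rshift M i) = p.2 by rewrite /blk /= ltnNge leq_addr.
have LL : \sum_(i < M) \sum_(j < M | (i < j)%N) G (lshift N i, lshift N j) = 0.
  by apply: big1 => i _; apply: big1 => j _; rewrite /G /= !bl subrr mulr0 mul0r.
have RR : \sum_(i < N) \sum_(j < N | (i < j)%N) G (rshift M i, rshift M j) = 0.
  by apply: big1 => i _; apply: big1 => j _; rewrite /G /= !br subrr mulr0 mul0r.
rewrite (big_pairs_split G) LL RR add0r addr0 /G {G LL RR}.
under eq_bigr => i _ do under eq_bigr => j _ do rewrite lam_lr bl br /=.
rewrite -/sig -/m2; case: (split_ordP k) => i0 ->.
  rewrite (eq_bigr (fun i : 'I_M => - (mu / (L * N%:R) * (p.1 - p.2) * N%:R) * (i0 == i)%:R)); last first.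
    move=> i _; rewrite (eq_bigr (fun _ : 'I_N => - (mu / (L * N%:R) * (p.1 - p.2) * (i0 == i)%:R))).
      by rewrite sumr_const card_ord -mulr_natr; ring.
    by move=> j _; rewrite eq_lrshift sub0r mulrN (inj_eq (@lshift_inj _ _)).
  rewrite -mulr_sumr (bigD1 i0)//= eqxx big1 ?addr0 => [|i]; last by rewrite eq_sym => /negbTE ->.
  rewrite bl /blk /= ltn_ord /coef_step /= /y /m2.
  by move: (\int[Q]_t _) sig => a b; field; rewrite !gt_eqF.
rewrite (eq_bigr (fun i : 'I_M => mu / (L * N%:R) * (p.1 - p.2))); last first.
  move=> i _; rewrite (eq_bigr (fun j : 'I_N => mu / (L * N%:R) * (p.1 - p.2) * (i0 == j)%:R)).
    by rewrite -mulr_sumr (bigD1 i0)//= eqxx big1 ?addr0 ?mulr1 => [|j]; last by rewrite eq_sym => /negbTE ->.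
  by move=> j _; rewrite eq_rlshift subr0 (inj_eq (@rshift_inj _ _)).
rewrite sumr_const card_ord -mulr_natr br /blk /= ltnNge leq_addr /= /coef_step /= /y /m2.
by move: (\int[Q]_t _) sig => a b; field; rewrite !gt_eqF.
Qed.

Hypothesis (m20 : 0 <= m2) (m21 : m2 <= 1).

(** For sig = 1 the map [coef_step] has the eigenvalues 1 and 1 - r, with r = y (1 + M / N), and
    ([top], [bot]) is its orbit from (1, 0). *)
Let r := mu * m2 * (N + M)%:R / (N%:R * L).
Let top k : R := M%:R / (N + M)%:R + N%:R / (N + M)%:R * (1 - r) ^+ k.
Let bot k : R := M%:R / (N + M)%:R - M%:R / (N + M)%:R * (1 - r) ^+ k.

(* [sig < 1] happens when M = 1 or N = 1.  [coef_step] has nonnegative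
   coefficients and is monotone in [sig], so that its iterates are bounded by
   those for [sig = 1], which are [top] and [bot]. *)
Lemma coef_iter k : let p := iter k coef_step (1, 0) in
  0 <= p.1 <= top k /\ 0 <= p.2 <= bot k.
Proof.
have NMR : 0 < (N + M)%:R :> R by rewrite ltr0n addn_gt0 M0 orbT.
have y0 : 0 <= y by rewrite /y divr_ge0 ?(ltW L0)// mulr_ge0 ?(ltW mu0).
have ysig : y <= sig.
  apply: le_trans sig_ge; rewrite /y ler_pM2r ?invr_gt0// ler_pM2l//.
  by apply: (le_trans m21); rewrite ler1n.
have q0 : 0 <= M%:R / N%:R :> R by rewrite divr_ge0// ltW.
(* Here M <= N enters: the rate y M / N is then at most y, hence at most [sig], and the second
   coefficient is updated with nonnegative weights. *)
have q1 : M%:R / N%:R <= 1 :> R by rewrite ler_pdivrMr// mul1r ler_nat.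
elim: k => [|k [/andP[a0 a1] /andP[b0 b1]]] /=.
  rewrite /top /bot expr0 !mulr1 subrr -mulrDl -natrD addnC divff ?gt_eqF//.
  by rewrite !lexx ler01.
have topS : top k.+1 = (1 - y) * top k + y * bot k.
  rewrite /top /bot exprS /r /y natrD; move: ((1 - _) ^+ k) => z.
  by field; rewrite -natrD !gt_eqF.
have botS : bot k.+1 = (1 - y * (M%:R / N%:R)) * bot k + y * (M%:R / N%:R) * top k.
  rewrite /top /bot exprS /r /y natrD; move: ((1 - _) ^+ k) => z.
  by field; rewrite -natrD !gt_eqF.
have s1 := sig_le1.
rewrite topS botS; move: a0 a1 b0 b1; set p := iter k _ _; rewrite /coef_step /=.
move: (p.1) (p.2) => a b a0 a1 b0 b1.
have yq : y * (M%:R / N%:R) <= y by rewrite ler_piMr.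
have yq0 : 0 <= y * (M%:R / N%:R) by rewrite mulr_ge0.
move: s1 ysig y0 yq yq0 a1 b1; move: y sig (top k) (bot k) => u s A B s1 us u0.
pose z := u * (M%:R / N%:R); rewrite -/z => zu z0 aA bB.
change (0 <= (s * a - u * (a - b)) <= (1 - u) * A + u * B /\
  0 <= s * b + z * (a - b) <= (1 - z) * B + z * A).
clearbody z.
have -> : s * a - u * (a - b) = (s - u) * a + u * b by ring.
have -> : s * b + z * (a - b) = (s - z) * b + z * a by ring.
have zs : z <= s := le_trans zu us.
split; apply/andP; split.
- by rewrite addr_ge0 ?mulr_ge0 ?subr_ge0.
- by rewrite lerD ?ler_pM ?subr_ge0// lerD2r.
- by rewrite addr_ge0 ?mulr_ge0 ?subr_ge0.
- by rewrite lerD ?ler_pM ?subr_ge0// lerD2r.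
Qed.

Hypothesis sc0 : \int[Q]_t (sin t * cos t) = 0.

(** The squared norm of the first block is the form [blk (1, 0)]; on a vector without second block,
    only the first coefficient of the iterated form is seen. *)
Lemma word_coef k : exists2 ck, 0 <= ck <= top k &
  forall x : (M + N).-tuple R, sqnorm (projQ x) = 0 ->
  avg (tuple_prob Q k) (@wordP (M + N) k) (@wordL R (M + N) lm k)
    (fun al th => sqnorm (projP (rots_fwd al th x))) = ck * sqnorm x.
Proof.
exists (iter k coef_step (1, 0)).1; first by have [] := coef_iter k.
have quadE p (x : (M + N).-tuple R) : quad (blk p) x = p.1 * sqnorm (projP x) + p.2 * sqnorm (projQ x).
  rewrite /quad big_split_ord /= /sqnorm !mulr_sumr; congr (_ + _); apply: eq_bigr => i _.
    by rewrite tnth_mktuple /blk /= ltn_ord.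
  by rewrite tnth_mktuple /blk /= ltnNge leq_addr.
move=> x xQ.
transitivity (avg (tuple_prob Q k) (@wordP (M + N) k) (@wordL R (M + N) lm k)
    (fun al th => quad (blk (1, 0)) (rots_fwd al th x))).
  by apply: eq_avg => al th _; rewrite quadE mul1r mul0r addr0.
rewrite (word_quad (letter_stepP lm sc0)).
have -> : iter k (letter_step Q lm) (blk (1, 0)) = blk (iter k coef_step (1, 0)).
  by elim: k => //= k ->; rewrite letter_step_blk.
by rewrite quadE xQ mulr0 addr0 [in RHS]sqnorm_split xQ addr0.
Qed.

End Coefficients.

(** * Conclusion *)

Section AngleLaw.
Context {R : realType} (D : set (measurableTypeR R)) (rho : R -> R).
Hypotheses (mD : measurable D) (mrho : measurable_fun D rho)
  (rho0 : forall t, D t -> 0 <= rho t)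
  (rho1 : (\int[@lebesgue_measure R]_(t in D) (rho t)%:E = 1)%E).

Lemma angle_law : exists Q : probability (measurableTypeR R) R,
  forall F : measurableTypeR R -> \bar R,
  measurable_fun setT F -> (forall x, 0 <= F x)%E ->
  (\int[Q]_x F x = \int[lebesgue_measure]_(x in D) (F x * (rho x)%:E))%E.
Proof.
pose p : measurableTypeR R -> R := rho \_ D.
have mp : measurable_fun setT p by exact: (measurable_restrictT _ mD).1.
have p0 x : 0 <= p x by rewrite /p patchE; case: ifPn => // /set_mem; exact: rho0.
have pE (F : measurableTypeR R -> \bar R) : (\int[lebesgue_measure]_x (F x * (p x)%:E) =
    \int[lebesgue_measure]_(x in D) (F x * (rho x)%:E))%E.
  rewrite [RHS]integral_mkcond; apply: eq_integral => x _.
  by rewrite /p !patchE; case: ifPn => //; rewrite mule0.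
have p1 : (\int[@lebesgue_measure R]_x (p x)%:E = 1)%E.
  rewrite -rho1; have := pE (fun _ => 1%E).
  by under eq_integral do rewrite mul1e; under [in RHS]eq_integral do rewrite mul1e.
have [Q QE] := density_probability mp p0 p1.
by exists Q => F mF F0; rewrite QE// pE.
Qed.

Variable Q : probability (measurableTypeR R) R.
Hypothesis QE : forall F : measurableTypeR R -> \bar R,
  measurable_fun setT F -> (forall x, 0 <= F x)%E ->
  (\int[Q]_x F x = \int[lebesgue_measure]_(x in D) (F x * (rho x)%:E))%E.

Lemma Rintegral_angle_law (f : R -> R) : measurable_fun setT f ->
  \int[Q]_t f t = Rintegral (@lebesgue_measure R) D (fun t => rho t * f t).
Proof.
move=> mf; rewrite /Rintegral; congr fine.
rewrite (integral_densityE rho0 QE); last exact/measurable_EFinP.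
by apply: eq_integral => t _; rewrite -EFinM mulrC.
Qed.

(** Nonnegativity of [h0] lets the iterated integrals become integrals for product measures even
    where they are infinite. *)
Lemma hkE (M N : nat) (lS lR mu : R) (h0 : M.-tuple R -> R) (k : nat) (v : M.-tuple R) :
  D = `[(- pi)%R, pi%R]%classic ->
  measurable_fun setT h0 -> (forall u, 0 <= h0 u) ->
  hk N lS lR mu rho h0 k v =
  fine (hX (tuple_prob Q k) (@wordP (M + N) k) (@wordL R (M + N) (lam lS lR mu) k)
    (fun al th => rots_inv al th) h0 v).
Proof.
move=> DE mh h00; rewrite /hk /hX; congr fine; apply: eq_bigr => al _; congr (_ * _)%E.
have mq : measurable_fun setT (fun p : k.-tuple R * N.-tuple R =>
    h0 (projP (rots_inv al p.1 (vw v p.2)))).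
  apply: (measurableT_comp mh); apply: measurable_fun_projP.
  by apply: measurable_fun_rots_inv; msolve3.
have mG : measurable_fun setT (fun th : k.-tuple R =>
    \int[gauss N]_w (h0 (projP (rots_inv al th (vw v w))))%:E)%E.
  apply: (@measurable_fun_fubini_tonelli_F _ _ _ _ _ (gauss N)
    (fun p : k.-tuple R * N.-tuple R => (h0 (projP (rots_inv al p.1 (vw v p.2))))%:E)).
    exact/measurable_EFinP.
  by move=> p; rewrite lee_fin.
have leN1 (x : \bar R) : (0 <= x -> -1 <= x)%E by apply: le_trans; rewrite lee_fin lerN10.
transitivity (1%:E * \int[tuple_prob Q k]_th \int[gauss N]_w
    (h0 (projP (rots_inv al th (vw v w))))%:E)%E; last by rewrite mul1e.
rewrite -(iint_density mD mrho rho0 QE)//; last first.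
  by move=> th; apply: leN1; apply: integral_ge0 => w _; rewrite lee_fin.
rewrite -DE; congr (iint _ _); apply/funext => th.
rewrite mul1r big_tuple muleC; congr (_ * _)%E; apply: gintE.
  apply/measurable_EFinP.
  exact: (measurableT_comp mq (g := fun w : N.-tuple R => (th, w)) (ltac:(msolve3))).
by move=> w; apply: leN1; rewrite lee_fin.
Qed.

End AngleLaw.

(** The negative part is at most 1, so a finite integral also bounds the positive part. *)
Lemma integrable_shift_ge0 {R : realType} d (T : measurableType d) (P : probability T R)
    (f : T -> R) : measurable_fun setT f -> (forall x, -1 <= f x) ->
  (\int[P]_x (f x)%:E < +oo)%E -> P.-integrable setT (EFin \o f).
Proof.
move=> mf f1 foo; have mEf : measurable_fun setT (EFin \o f) by exact/measurable_EFinP.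
have i1 : P.-integrable setT (EFin \o (fun x => f x + 1)).
  apply/integrableP; split; first by apply/measurable_EFinP; exact: measurable_funD.
  rewrite (eq_integral (fun x => (EFin \o f) x + 1)%E).
    by rewrite integral_add1// lte_add_pinfty// ltry.
  move=> x _ /=; rewrite ger0_norm//; have := f1 x; lra.
have ic : P.-integrable setT (EFin \o (fun _ : T => 1 : R)).
  by apply: (@integrable_bounded _ _ _ P _ `|1|).
have := integrableB measurableT i1 ic; congr integrable.
by apply/funext => x /=; rewrite -EFinB addrK.
Qed.

Theorem theorem5p1 (R : realType) (M N : nat) (lS lR mu : R)
  (rho : R -> R) (h0 : M.-tuple R -> R) :
  (0 < M)%N -> (M <= N)%N ->
  0 < lS -> 0 < lR -> 0 < mu ->
  (* rho is a probability density on [-pi, pi] *)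
  measurable_fun `[- pi, pi] rho ->
  (forall t, - pi <= t <= pi -> 0 <= rho t) ->
  (\int[@lebesgue_measure R]_(t in `[(- pi)%R, pi%R]) (rho t)%:E = 1)%E ->
  (* absolutely convergent Fourier series:
     sum_{n in Z} |c_n| < oo, with |c_n| = |c_{-n}| = sqrt(a_n^2+b_n^2)/(2 pi) *)
  (\sum_(0 <= n <oo) (Num.sqrt (fcos rho n ^+ 2 + fsin rho n ^+ 2))%:E < +oo)%E ->
  Rintegral (@lebesgue_measure R) `[- pi, pi] (fun t => rho t * sin t * cos t) = 0 ->
  (* h0 *)
  measurable_fun setT h0 ->
  (forall v, 0 <= h0 v) ->
  gint (fun v => (h0 v)%:E) = 1%E ->
  (entropyS h0 < +oo)%E ->
  forall k : nat,
    let mu_rho := mu * Rintegral (@lebesgue_measure R) `[- pi, pi]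
                         (fun t => rho t * sin t ^+ 2) in
    (entropyS (hk N lS lR mu rho h0 k) <=
     (M%:R / (N + M)%:R + N%:R / (N + M)%:R *
        (1 - mu_rho * (N + M)%:R / (N%:R * Lam M N lS lR mu)) ^+ k)%:E
     * entropyS h0)%E.
Proof.
move=> M0 MN lS0 lR0 mu0 mrho rho0 rho1 _ sc mh h00 h01 hS k; cbv zeta.
pose D : set (measurableTypeR R) := `[(- pi)%R, pi%R]%classic.
have mD : measurable D by exact: measurable_itv.
have rD t : D t -> 0 <= rho t by rewrite /D/= in_itv/=; exact: rho0.
have [Q QE] := angle_law mD mrho rD rho1.
have m2E : \int[Q]_t (sin t ^+ 2) = Rintegral (@lebesgue_measure R) D (fun t => rho t * sin t ^+ 2).
  by apply: (Rintegral_angle_law rD QE); msolve3.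
have sc0 : \int[Q]_t (sin t * cos t) = 0.
  rewrite (Rintegral_angle_law rD QE); last by msolve3.
  by rewrite -sc; congr Rintegral; apply/funext => t; rewrite mulrA.
have /andP[m20 m21] : 0 <= \int[Q]_t (sin t ^+ 2) <= 1.
  apply: Rintegral_between; first by msolve3.
  by move=> t; rewrite sqr_ge0 -(cos2Dsin2 t) lerDr sqr_ge0.
have [ck /andP[ck0 ck1] fw_avg] := word_coef M0 MN lS0 lR0 mu0 m20 m21 sc0 k.
have lm0 := lam_ge0 M0 MN lS0 lR0 mu0.
(* Mixed pairs always exist, so the total weight is positive; Jensen's inequality takes the
   logarithm of the average. *)
have s0 : 0 < avg1 (@up (M + N)) (lam lS lR mu).
  apply: lt_le_trans (sig_ge M0 MN lS0 lR0 mu0).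
  by rewrite divr_gt0 ?mulr_gt0 ?ltr0n// /Lam !addr_gt0 ?mulr_gt0 ?ltr0n// (leq_trans M0).
have x1 (x : R) : 0 <= x -> -1 <= xlnx x by move=> xp; have := xlnx_ge xp; lra.
have mx := measurable_fun_xlnx mh.
have e0 : entropyS h0 = (\int[gauss M]_v (xlnx (h0 v))%:E)%E.
  by apply: gintE; [exact/measurable_EFinP|move=> v; rewrite lee_fin x1].
have g1 : (\int[gauss M]_v (h0 v)%:E = 1)%E.
  rewrite -h01 gintE//; first exact/measurable_EFinP.
  by move=> v; rewrite lee_fin (le_trans (lerN10 R)).
have ih : (gauss M).-integrable setT (EFin \o h0).
  apply: integrable_shift_ge0 => //; last by rewrite g1 ltry.
  by move=> v; rewrite (le_trans (lerN10 R)).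
have ix : (gauss M).-integrable setT (EFin \o (fun v => xlnx (h0 v))).
  by apply: integrable_shift_ge0 => //; [move=> v; exact: x1|rewrite -e0].
have h1 : \int[gauss M]_v h0 v = 1 by rewrite /Rintegral g1.
(* By x ln x >= x - 1 and unit mass. This sign allows [ck] to be replaced by its upper bound at the
   end. *)
have S0 : 0 <= \int[gauss M]_v xlnx (h0 v).
  have ic : (gauss M).-integrable setT (EFin \o (fun _ : M.-tuple R => 1 : R)).
    by apply: (@integrable_bounded _ _ _ (gauss M) _ `|1|).
  have : \int[gauss M]_v (h0 v - 1) <= \int[gauss M]_v xlnx (h0 v).
    apply: le_Rintegral => //; first exact: (integrableB measurableT ih ic).
    by move=> v _; exact: xlnx_ge.
  by rewrite (RintegralB measurableT ih ic) h1 Rintegral_prob_cst subrr.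
have e1 : entropyS h0 = (\int[gauss M]_v xlnx (h0 v))%:E.
  by rewrite e0 /Rintegral fineK//; exact: (integrable_fin_num measurableT ix).
have Lam0 (al : k.-tuple ('I_(M + N) * 'I_(M + N))) : wordP al -> 0 <= wordL (lam lS lR mu) al.
  by apply: wordL_ge0 => a _; exact: lm0.
pose O (al : k.-tuple ('I_(M + N) * 'I_(M + N))) (th : k.-tuple R) (z : (M + N).-tuple R) :=
  rots_inv al th z.
pose fw (al : k.-tuple ('I_(M + N) * 'I_(M + N))) (th : k.-tuple R) (z : (M + N).-tuple R) :=
  rots_fwd al th z.
have mO al : wordP al -> measurable_fun setT (fun p : k.-tuple R * (M + N).-tuple R => O al p.1 p.2).
  by move=> _; apply: measurable_fun_rots_inv; msolve3.
have mfw al : wordP al -> measurable_fun setT (fun p : k.-tuple R * (M + N).-tuple R => fw al p.1 p.2).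
  by move=> _; apply: measurable_fun_rots_fwd; msolve3.
have rotO al (th : k.-tuple R) : wordP al -> is_rotation (O al th) (fw al th).
  exact: is_rotation_rots.
have A0 : 0 < avg1 (@wordP (M + N) k) (@wordL R (M + N) (lam lS lR mu) k).
  by rewrite avg1_word exprn_gt0.
have A1 : avg1 (@wordP (M + N) k) (@wordL R (M + N) (lam lS lR mu) k) <= 1.
  by rewrite avg1_word exprn_ile1 ?(ltW s0)// (sig_le1 M0 MN lS0 lR0 mu0).
have main := entropy_hX Lam0 A0 A1 rotO mO mfw ck0 fw_avg mh h00 ih h1 ix.
have kE : hk N lS lR mu rho h0 k = (fun v => fine (hX (tuple_prob Q k) (@wordP (M + N) k)
    (@wordL R (M + N) (lam lS lR mu) k) O h0 v)).
  by apply/funext => v; exact: (hkE mD mrho rD QE).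
have hX0 v : (0 <= hX (tuple_prob Q k) (@wordP (M + N) k)
    (@wordL R (M + N) (lam lS lR mu) k) O h0 v)%E.
  apply: sume_ge0 => al Pal; rewrite mule_ge0 ?lee_fin ?Lam0//.
  by apply: integral_ge0 => th _; apply: integral_ge0 => w _; rewrite lee_fin.
have ek : entropyS (hk N lS lR mu rho h0 k) =
    (\int[gauss M]_v (xlnx (hk N lS lR mu rho h0 k v))%:E)%E.
  apply: gintE => [|v]; last by rewrite lee_fin kE x1// fine_ge0.
  apply/measurable_EFinP; apply: measurable_fun_xlnx; rewrite kE.
  apply: (measurableT_comp (fine_measurable measurableT)) => //.
  exact: (measurable_hX _ _ mO mh h00).
rewrite ek kE e1; apply: (le_trans main).
rewrite -EFinM lee_fin; apply: (ler_wpM2r S0); apply: (le_trans ck1).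
by rewrite m2E.
Qed.
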